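(* Let $d\ge2$, let $m\in\{0,\ldots,M-1\}$, and let $\gamma(\vec p)=\big(\sum_{\ell=1}^L[G_\ell\vec p\cdot\vec p]^{\frac r2}\big)^{\frac1r}$ with $r\in[1,\infty)$ and symmetric positive definite matrices $G_\ell\in\mathbb{R}^{d\times d}$, $\ell=1,\ldots,L$. Let $\langle\cdot,\cdot\rangle^{(h)}_{\Gamma^m}$ denote either one of $\langle\cdot,\cdot\rangle_{\Gamma^m}$ (true integration) or $\langle\cdot,\cdot\rangle^{h}_{\Gamma^m}$ (mass lumping), the same choice being made in both places below. Let $(U^{m+1},\vec X^{m+1},\kappa_\gamma^{m+1})\in S^m\times\underline V(\Gamma^m)\times V(\Gamma^m)$, with $\Gamma^{m+1}=\vec X^{m+1}(\Gamma^m)$, be a solution of the nonlinear system \begin{align*} (\nabla U^{m+1},\nabla\varphi)-\Big\langle \pi_{\Gamma^m}\Big[\frac{\vec X^{m+1}-\vec{\rm id}}{\Delta t_m}\cdot\vec\omega^{m+\frac12}\Big],\varphi\Big\rangle_{\Gamma^m}^{(h)}&=0\qquad\forall\,\varphi\in S^m,\\ \langle U^{m+1},\chi\rangle_{\Gamma^m}^{(h)}-\langle\kappa_\gamma^{m+1},\chi\rangle_{\Gamma^m}^{h}&=0\qquad\forall\,\chi\in V(\Gamma^m),\\ \langle\kappa_\gamma^{m+1}\vec\omega^{m+\frac12},\vec\eta\rangle_{\Gamma^m}^{h}+\langle\nabla_s^{\widetilde G_\ell}\vec X^{m+1},\nabla_s^{\widetilde G_\ell}\vec\eta\rangle_{\Gamma^m,\gamma}&=0\qquad\forall\,\vec\eta\in\underline{V}(\Gamma^m),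 \end{align*} where $\vec\omega^{m+\frac12}\in\underline V(\Gamma^m)$ is the averaged vertex normal (depending on $\Gamma^m$ and $\Gamma^{m+1}$) and $\langle\nabla_s^{\widetilde G_\ell}\cdot,\nabla_s^{\widetilde G_\ell}\cdot\rangle_{\Gamma^m,\gamma}$ is the anisotropic form, both defined in the context. Then the enclosed volume is preserved, i.e. \[ \operatorname{vol}(\Omega_-^{m+1})=\operatorname{vol}(\Omega_-^{m}). \] In addition, if $d=2$ or $d=3$, then the solution satisfies the stability estimate \[ |\Gamma^{m+1}|_\gamma+\Delta t_m\,(\nabla U^{m+1},\nabla U^{m+1})\le|\Gamma^m|_\gamma . \]
   Context: $\Omega\subset\mathbb{R}^d$ is a (bounded) polyhedral domain, $(\cdot,\cdot)$ is the $L^2$-inner product over $\Omega$, and $0=t_0<t_1<\dots<t_M=T$ with $\Delta t_m=t_{m+1}-t_m$. $\mathcal T^m$ is a regular partitioning of $\Omega$ into disjoint open simplices and $S^m=\{\chi\in C^0(\overline\Omega):\chi|_{o}\text{ is affine for all } o\in\mathcal T^m\}$. Polyhedral hypersurfaces. A closed polyhedral hypersurface $\Gamma^m\subset\Omega$ is of the form $\Gamma^m=\bigcup_{j=1}^J\overline{\sigma_j^m}$, where the $\sigma^m_j$ are disjoint, relatively open, nondegenerate $(d-1)$-simplices such that $\overline{\sigma^m_i}\cap\overline{\sigma^m_j}$, $i\neq j$, is empty or a common $k$-simplex of both, $0\le k<d$. Its vertices are $\{\vec q^m_k\}_{k=1}^K$, and the vertices of $\sigma^m_j$ are $\{\vec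 q^m_{j,k}\}_{k=1}^d$. $\Gamma^m$ is the boundary of its interior $\Omega_-^m$, and the local numbering is such that \[ \vec\nu^m=\frac{(\vec q^m_{j,2}-\vec q^m_{j,1})\wedge\cdots\wedge(\vec q^m_{j,d}-\vec q^m_{j,1})}{|(\vec q^m_{j,2}-\vec q^m_{j,1})\wedge\cdots\wedge(\vec q^m_{j,d}-\vec q^m_{j,1})|}\quad\text{on }\sigma^m_j \] is the outer unit normal to $\Omega^m_-$. Here $\vec v_1\wedge\cdots\wedge\vec v_{d-1}$ is the unique vector with $\vec b\cdot(\vec v_1\wedge\cdots\wedge\vec v_{d-1})=\det(\vec v_1,\ldots,\vec v_{d-1},\vec b)$ for all $\vec b\in\mathbb{R}^d$. $|\sigma|$ denotes the $(d-1)$-dimensional Hausdorff measure $\mathcal H^{d-1}$ of a simplex $\sigma$, and $\operatorname{vol}$ is $d$-dimensional Lebesgue measure. The anisotropic surface energy is $|\Gamma^m|_\gamma=\int_{\Gamma^m}\gamma(\vec\nu^m)\,{\rm d}\mathcal H^{d-1}$. Surface finite elements. $V(\Gamma^m)$ is the space of continuous functions on $\Gamma^m$ that are affine on each $\sigma_j^m$, and $\underline V(\Gamma^m)=[V(\Gamma^m)]^d$. $\pi_{\Gamma^m}:C^0(\Gamma^m)\to V(\Gamma^m)$ is the nodal interpolation operator (applied to functions through their values at the vertices), and $\vec{\rm id}$ is the identity function on $\mathbb{R}^d$. $\langle\cdot,\cdot\rangle_{\Gamma^m}$ is the $L^2$-inner product on $\Gamma^m$, and the mass lumped inner product of piecewise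 continuous functions is \[ \langle u,v\rangle^h_{\Gamma^m}=\frac1d\sum_{j=1}^J|\sigma^m_j|\sum_{k=1}^d(uv)((\vec q^m_{j,k})^-),\qquad u((\vec q)^-)=\lim_{\sigma^m_j\ni\vec p\to\vec q}u(\vec p), \] extended naturally to vector-valued functions. Averaged normals. $\Gamma^{m+1}=\vec X^{m+1}(\Gamma^m)$ is the polyhedral surface with vertices $\vec q^{m+1}_k=\vec X^{m+1}(\vec q^m_k)$ and the same connectivity. For $t\in[t_m,t_{m+1}]$, $\hat\Gamma^h(t)$ is the polyhedral surface with the same connectivity, elements $\hat\sigma^h_j(t)$, and vertices $\hat q^h_k(t)=\frac{t_{m+1}-t}{\Delta t_m}\vec q^m_k+\frac{t-t_m}{\Delta t_m}\vec q^{m+1}_k$. The surfaces $\hat\Gamma^h(t)$, $t\in[t_m,t_{m+1}]$, in particular $\Gamma^m=\hat\Gamma^h(t_m)$ and $\Gamma^{m+1}=\hat\Gamma^h(t_{m+1})$, are assumed to be closed polyhedral hypersurfaces contained in $\Omega$, i.e. $\hat\Gamma^h(t)=\bigcup_{j=1}^J\overline{\hat\sigma^h_j(t)}\subset\Omega$, where the $\hat\sigma^h_j(t)$ are disjoint, relatively open, nondegenerate $(d-1)$-simplices such that $\overline{\hat\sigma^h_i(t)}\cap\overline{\hat\sigma^h_j(t)}$, $i\ne j$, is empty or a common $k$-simplex of both, $0\le k<d$, and $\hat\Gamma^h(t)$ is the boundary of its interior (denoted $\Omega_-^m$ for $t=t_m$ and $\Omega_-^{m+1}$ for $t=t_{m+1}$),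 with outer unit normal $\hat\nu^h(t)$ given, with $\{\hat q^h_{j,k}(t)\}_{k=1}^d$ denoting the vertices of $\hat\sigma^h_j(t)$ in the local numbering inherited from $\sigma^m_j$, by \[ \hat\nu^h(t)=\frac{(\hat q^h_{j,2}(t)-\hat q^h_{j,1}(t))\wedge\cdots\wedge(\hat q^h_{j,d}(t)-\hat q^h_{j,1}(t))}{|(\hat q^h_{j,2}(t)-\hat q^h_{j,1}(t))\wedge\cdots\wedge(\hat q^h_{j,d}(t)-\hat q^h_{j,1}(t))|}\quad\text{on }\hat\sigma^h_j(t); \] $\vec\nu^{m+1}$ is the outer unit normal of $\Gamma^{m+1}$. The piecewise constant vector field $\vec\nu^{m+\frac12}\in[L^\infty(\Gamma^m)]^d$ is defined by \[ \vec\nu^{m+\frac12}=\frac1{\Delta t_m|\sigma^m_j|}\int_{t_m}^{t_{m+1}}\hat\nu^h|_{\hat\sigma^h_j(t)}\,|\hat\sigma^h_j(t)|\,{\rm d}t\quad\text{on }\sigma^m_j,\ j=1,\ldots,J, \] and $\vec\omega^{m+\frac12}\in\underline V(\Gamma^m)$ is defined by $\langle\vec\omega^{m+\frac12},\vec\varphi\rangle^h_{\Gamma^m}=\langle\vec\nu^{m+\frac12},\vec\varphi\rangle_{\Gamma^m}$ for all $\vec\varphi\in\underline V(\Gamma^m)$. Anisotropic form. Let $\gamma_\ell(\vec p)=[G_\ell\vec p\cdot\vec p]^{\frac12}$ and $\widetilde G_\ell=[\det G_\ell]^{\frac1{d-1}}G_\ell^{-1}$, and let $(\vec v,\vec w)_{\widetilde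 G_\ell}=\vec v\cdot\widetilde G_\ell\vec w$ be the inner product on $\mathbb{R}^d$ induced by $\widetilde G_\ell$. For $\vec X,\vec\eta\in\underline V(\Gamma^m)$, on each element $\sigma_j^m$, \[ (\nabla_s^{\widetilde G_\ell}\vec X,\nabla_s^{\widetilde G_\ell}\vec\eta)_{\widetilde G_\ell}=\sum_{i=1}^{d-1}(\partial_{\vec\tau_i}\vec X,\partial_{\vec\tau_i}\vec\eta)_{\widetilde G_\ell}, \] where $\{\vec\tau_1,\ldots,\vec\tau_{d-1}\}$ is a basis of the tangent space of $\sigma^m_j$ that is orthonormal with respect to $(\cdot,\cdot)_{\widetilde G_\ell}$, and $\partial_{\vec\tau}$ is the directional derivative (the value does not depend on the choice of basis). Then \[ \langle\nabla_s^{\widetilde G_\ell}\vec X^{m+1},\nabla_s^{\widetilde G_\ell}\vec\eta\rangle_{\Gamma^m,\gamma}=\sum_{\ell=1}^L\int_{\Gamma^m}\left[\frac{\gamma_\ell(\vec\nu^{m+1}\circ\vec X^{m+1})}{\gamma(\vec\nu^{m+1}\circ\vec X^{m+1})}\right]^{r-1}(\nabla_s^{\widetilde G_\ell}\vec X^{m+1},\nabla_s^{\widetilde G_\ell}\vec\eta)_{\widetilde G_\ell}\,\gamma_\ell(\vec\nu^m)\,{\rm d}\mathcal H^{d-1}, \] where the index $\ell$ on the left-hand side is purely notational. *)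

(* Defs.v *)
From HB Require Import structures.
From mathcomp Require Import all_boot all_order all_algebra.
From mathcomp Require Import all_classical all_reals all_analysis.

Set Implicit Arguments.
Unset Strict Implicit.
Unset Printing Implicit Defensive.

Import Order.TTheory GRing.Theory Num.Theory.
Import numFieldNormedType.Exports.

Local Open Scope classical_set_scope.
Local Open Scope ring_scope.

(** Points of the ambient space R^d are row vectors; throughout d = n.+1,
    so that hypersurface elements are n-dimensional simplices. *)

Section Vectors.
Context {R : realType} {d : nat}.
Implicit Types (u v : 'rV[R]_d) (H : 'M[R]_d).

(** v . (H w) *)
Definition bform H u v : R := (u *m H *m v^T) 0 0.

Definition dotv u v : R := \sum_i u 0 i * v 0 i.

(** Euclidean norm; the norm [`| v |] that the library puts on ['rV[R]_d] is
    the max norm, which only serves here to provide the topology. *)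
Definition enorm v : R := Num.sqrt (dotv v v).

Definition spd H : Prop := H^T = H /\ forall v, v != 0 -> 0 < bform H v v.

End Vectors.

Section Wedge.
Context {R : realType} {n : nat}.

(** The rows of [v] followed by the row [b]. *)
Definition rcons_row (v : 'M[R]_(n, n.+1)) (b : 'rV[R]_n.+1) : 'M[R]_n.+1 :=
  \matrix_(k < n.+1) oapp (fun i => row i v) b (unlift ord_max k).

Definition wedgev (v : 'M[R]_(n, n.+1)) : 'rV[R]_n.+1 :=
  \row_i \det (rcons_row v (delta_mx 0 i)).

Lemma wedgevP (v : 'M[R]_(n, n.+1)) (w : 'rV[R]_n.+1) :
  (forall b, dotv b w = \det (rcons_row v b)) <-> w = wedgev v.
Proof.
have detE (b : 'rV[R]_n.+1) :
    \det (rcons_row v b) = \sum_i b 0 i * cofactor (rcons_row v 0) ord_max i.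
  rewrite (expand_det_row _ ord_max); apply: eq_bigr => i _.
  rewrite mxE unlift_none /=; congr (_ * _); rewrite /cofactor.
  congr (_ * \det _); apply/matrixP => j k; rewrite !mxE.
  by have -> : unlift ord_max (lift ord_max j) = Some j by rewrite liftK.
have wE i : wedgev v 0 i = cofactor (rcons_row v 0) ord_max i.
  rewrite mxE detE (bigD1 i) //= big1 => [|k ki].
    by rewrite mxE !eqxx mul1r addr0.
  by rewrite mxE eqxx /= (negbTE ki) mul0r.
split=> [h|-> b]; last by rewrite detE; apply: eq_bigr => i _; rewrite wE.
apply/rowP => i; rewrite mxE -h /dotv (bigD1 i) //= big1 => [|k ki].
  by rewrite mxE !eqxx mul1r addr0.
by rewrite mxE eqxx /= (negbTE ki) mul0r.
Qed.

End Wedge.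

Section CoverMeasure.
Local Open Scope ereal_scope.
Context {R : realType} {T I : Type}.
Variables (C : set I) (E : I -> set T) (rho : I -> \bar R).

(** Infimum of the total weight of countable covers by the sets [E i],
    [i \in C]. *)
Definition cover_measure (A : set T) : \bar R :=
  ereal_inf [set \sum_(k <oo) rho (F k) | F in
    [set F : nat -> I | (forall k, C (F k)) /\ A `<=` \bigcup_k E (F k)]].

Hypotheses (rho_ge0 : forall i, 0 <= rho i) (rho0 : exists2 i, C i & rho i = 0).

Lemma cover_measure_ge0 A : 0 <= cover_measure A.
Proof.
by apply: le_ereal_inf_tmp => x [F _ <-]; apply: nneseries_ge0 => k _ _.
Qed.

Lemma cover_measure0 : cover_measure set0 = 0.
Proof.
have [i Ci ri] := rho0.
apply/eqP; rewrite eq_le cover_measure_ge0 andbT.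
apply: ereal_inf_lbound; exists (fun=> i); first by split.
by rewrite eseries0 // => k _ _; rewrite ri.
Qed.

Lemma le_cover_measure : {homo cover_measure : A B / A `<=` B >-> A <= B}.
Proof.
move=> A B AB; apply/ereal_inf_le_tmp => x [F [CF BF] <-{x}].
by exists F => //; split => //; exact: subset_trans AB BF.
Qed.

Lemma cover_measure_sigma_subadditive : sigma_subadditive cover_measure.
Proof.
move=> A; have [[i ioo]|] := pselect (exists i, cover_measure (A i) = +oo).
  rewrite (eseries_pinfty _ _ ioo) ?leey// => k _.
  by rewrite -ltNye (lt_le_trans _ (cover_measure_ge0 _)).
rewrite -forallNE => Aoo.
apply/lee_addgt0Pr => _/posnumP[e].
rewrite (le_trans _ (epsilon_trick _ _ _))//; last first.
  by move=> k; exact: cover_measure_ge0.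
pose P k (F : nat -> I) := ((forall l, C (F l)) /\ A k `<=` \bigcup_l E (F l))
  /\ \sum_(l <oo) rho (F l) <= cover_measure (A k) + (e%:num / (2 ^ k.+1)%:R)%:E.
have [G PG] : {G : nat -> nat -> I & forall k, P k (G k)}.
  apply: (@choice _ _ P) => k.
  have fA : cover_measure (A k) \is a fin_num.
    rewrite ge0_fin_numE ?cover_measure_ge0// ltey; exact/eqP/Aoo.
  have ek : (0 < e%:num / (2 ^ k.+1)%:R)%R by [].
  have [x [F FP <-] xS] := lb_ereal_inf_adherent ek fA.
  by exists F; split => //; exact/ltW.
pose r2 (ij : nat * nat) := rho (G ij.1 ij.2).
have r2_ge0 x : 0 <= r2 x by exact: rho_ge0.
apply: (@le_trans _ _ (\esum_(i in setT) r2 i)).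
  apply: ereal_inf_lbound => /=.
  have /card_esym/ppcard_eqP[f] := card_nat2.
  exists (fun k => G (f k).1 (f k).2).
    split => [k|t [i _ Ait]]; first exact: (PG (f k).1).1.1.
    have [j _ Gt] := (PG i).1.2 _ Ait.
    by exists (f^-1%FUN (i, j)) => //=; rewrite invK ?inE.
  by rewrite -(esum_pred_image r2 f xpredT) ?[fun=> _]set_true// image_eq.
rewrite (_ : esum _ _ = \sum_(i <oo) \sum_(j <oo ) rho (G i j)); last first.
  pose J : nat -> set (nat * nat) := fun i => [set (i, j) | j in setT].
  rewrite (_ : setT = \bigcup_k J k); last first.
    by rewrite predeqE => -[a b]; split => // _; exists a => //; exists b.
  rewrite esum_bigcupT /=; last 2 first.
    - apply/trivIsetP => i j _ _ ij.
      rewrite predeqE => -[n m] /=; split => //= -[] [_] _ [<-{n} _].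
      by move=> [m' _] [] /esym/eqP; rewrite (negbTE ij).
    - by move=> x; exact: r2_ge0.
  rewrite -(image_id [set: nat]) -fun_true esum_pred_image//; last first.
    by move=> k _; exact: esum_ge0.
  apply: eq_eseriesr => /= j _.
  rewrite -(esum_pred_image r2 (pair j) predT)//=; last first.
    by move=> ? ? _ _; exact: (@can_inj _ _ _ snd).
  by congr esum; rewrite predeqE => -[a b]; split; move=> [i _ <-]; exists i.
apply: lee_lim.
- apply: is_cvg_nneseries => k *.
  by apply: nneseries_ge0 => l *; exact: rho_ge0.
- by apply: is_cvg_nneseries => k *; apply: adde_ge0 => //; exact: cover_measure_ge0.
- by near=> k; apply: lee_sum => i _; exact: (PG i).2.
Unshelve. all: by end_near. Qed.

End CoverMeasure.

Arguments cover_measure_ge0 {R T I C E rho}.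
Arguments cover_measure0 {R T I C E rho}.
Arguments le_cover_measure {R T I} C E rho.
Arguments cover_measure_sigma_subadditive {R T I C E rho}.

(** d-dimensional Lebesgue (outer) measure; the Caratheodory-measurable sets
    of this outer measure are the Lebesgue measurable sets. *)
Section LebesgueMeasure.
Context {R : realType} {n : nat}.
Notation V := 'rV[R]_n.+1.

Definition box (ab : V * V) : set V :=
  [set x | forall i, ab.1 0 i <= x 0 i < ab.2 0 i].

Definition box_volume (ab : V * V) : \bar R :=
  (\prod_i Num.max 0 (ab.2 0 i - ab.1 0 i))%:E.

Definition volume : set V -> \bar R := cover_measure setT box box_volume.

Let box_volume_ge0 ab : (0 <= box_volume ab)%E.
Proof. by rewrite lee_fin; apply: prodr_ge0 => i _; rewrite le_max lexx. Qed.

Let box_volume0 : exists2 ab, [set: V * V] ab & box_volume ab = 0%E.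
Proof.
exists (0, 0) => //; rewrite /box_volume (bigD1 ord0)//= mxE subrr maxxx.
by rewrite mul0r.
Qed.

HB.instance Definition _ := isOuterMeasure.Build R V volume
  (cover_measure0 box_volume_ge0 box_volume0)
  (cover_measure_ge0 box_volume_ge0)
  (le_cover_measure setT box box_volume)
  (cover_measure_sigma_subadditive box_volume_ge0).

Let volume_om : {outer_measure set V -> \bar R} := volume.

Definition volume_measure :
  {measure set (caratheodory_type volume) -> \bar R} :=
  (volume_om : set (caratheodory_type volume_om) -> \bar R).

End LebesgueMeasure.

Section HausdorffMeasure.
Context {R : realType} {n : nat}.
Notation V := 'rV[R]_n.+1.

Definition diam (A : set V) : \bar R :=
  ereal_sup [set (enorm (xy.1 - xy.2))%:E | xy in A `*` A].

(** Volume of the unit ball of R^s. *)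
Fixpoint ball_volume (s : nat) : R :=
  match s with
  | 0 => 1
  | 1 => 2
  | (s'.+1 as s1).+1 => 2 * pi / (s1.+1)%:R * ball_volume s'
  end.

Definition hausdorff_weight (s : nat) (A : set V) : \bar R :=
  if A == set0 then 0%E else (ball_volume s * (fine (diam A) / 2) ^+ s)%:E.

Definition hausdorff_pre (s : nat) (delta : R) : set V -> \bar R :=
  cover_measure [set A | (diam A <= delta%:E)%E] id (hausdorff_weight s).

(** s-dimensional Hausdorff (outer) measure. *)
Definition hausdorff (s : nat) (A : set V) : \bar R :=
  ereal_sup [set hausdorff_pre s delta A | delta in [set e : R | 0 < e]].

Let ball_volume_ge0 s : 0 <= ball_volume s.
Proof.
suff : 0 <= ball_volume s /\ 0 <= ball_volume s.+1 by case.
elim: s => [|s [h1 h2]]; first by split => //=; rewrite ler0n.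
by split => //; rewrite /= mulr_ge0// divr_ge0// mulr_ge0// pi_ge0.
Qed.

Let hausdorff_weight_ge0 s A : (0 <= hausdorff_weight s A)%E.
Proof.
rewrite /hausdorff_weight; case: ifPn => // /set0P[x Ax]; rewrite lee_fin.
rewrite mulr_ge0// exprn_ge0// divr_ge0// fine_ge0//.
apply: ereal_sup_ubound; exists (x, x) => //=.
rewrite subrr /enorm (_ : dotv _ _ = 0) ?sqrtr0//.
by rewrite /dotv big1// => i _; rewrite mxE mul0r.
Qed.

Let hausdorff_weight0 s (delta : R) : exists2 A : set V,
  [set A | (diam A <= delta%:E)%E] A & hausdorff_weight s A = 0%E.
Proof.
exists set0; last by rewrite /hausdorff_weight eqxx.
by rewrite /= /diam setX0 image_set0 ereal_sup0 leNye.
Qed.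

Let hausdorff0 s : hausdorff s set0 = 0%E.
Proof.
rewrite /hausdorff (_ : image _ _ = [set 0%E]) ?ereal_sup1//.
apply/seteqP; split => [x [e _ <-]|x ->].
  exact: (cover_measure0 (hausdorff_weight_ge0 s) (hausdorff_weight0 s e)).
exists 1; first exact: ltr01.
exact: (cover_measure0 (hausdorff_weight_ge0 s) (hausdorff_weight0 s 1)).
Qed.

Let hausdorff_ge0 s A : (0 <= hausdorff s A)%E.
Proof.
apply: (@le_trans _ _ (hausdorff_pre s 1 A)).
  exact: cover_measure_ge0 (hausdorff_weight_ge0 s) _.
by apply: ereal_sup_ubound; exists 1 => //; exact: ltr01.
Qed.

Let le_hausdorff s : {homo hausdorff s : A B / A `<=` B >-> (A <= B)%E}.
Proof.
move=> A B AB; apply: ge_ereal_sup => x [e e0 <-].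
apply: (@le_trans _ _ (hausdorff_pre s e B)); first exact: le_cover_measure.
by apply: ereal_sup_ubound; exists e.
Qed.

Let hausdorff_sigma_subadditive s : sigma_subadditive (hausdorff s).
Proof.
move=> F; apply: ge_ereal_sup => x [e e0 <-].
apply: (le_trans (cover_measure_sigma_subadditive (hausdorff_weight_ge0 s) F)).
apply: lee_nneseries => k _; first by move=> ?; exact: cover_measure_ge0 (hausdorff_weight_ge0 s) _.
by apply: ereal_sup_ubound; exists e.
Qed.

HB.instance Definition _ s := isOuterMeasure.Build R V (hausdorff s)
  (hausdorff0 s) (hausdorff_ge0 s) (le_hausdorff s)
  (hausdorff_sigma_subadditive s).

Let hausdorff_om s : {outer_measure set V -> \bar R} := hausdorff s.

Definition hausdorff_measure s :
  {measure set (caratheodory_type (hausdorff s)) -> \bar R} :=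
  (hausdorff_om s : set (caratheodory_type (hausdorff_om s)) -> \bar R).

End HausdorffMeasure.

Section Simplices.
Context {R : realType} {d k : nat}.
Notation V := 'rV[R]_d.+1.
Implicit Type p : 'I_k.+1 -> V.

(** The relatively open k-simplex with vertices [p]. *)
Definition simplex p : set V :=
  [set x | exists c : 'I_k.+1 -> R,
    [/\ forall i, 0 < c i, \sum_i c i = 1 & x = \sum_i c i *: p i]].

(** The closed face spanned by the vertices with index in [A]. *)
Definition face p (A : {set 'I_k.+1}) : set V :=
  [set x | exists c : 'I_k.+1 -> R,
    [/\ forall i, 0 <= c i, forall i, i \notin A -> c i = 0,
        \sum_i c i = 1 & x = \sum_i c i *: p i]].

Definition edges p : 'M[R]_(k, d.+1) :=
  \matrix_(i < k) (p (lift ord0 i) - p ord0).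

Definition nondegenerate p : Prop := row_free (edges p).

Definition affine_on (S : set V) (f : V -> R) : Prop :=
  exists (a : V) (b : R), forall x, S x -> f x = dotv a x + b.

Definition simplicial_complex (N : nat) (p : 'I_N -> 'I_k.+1 -> V) : Prop :=
  [/\ forall j, nondegenerate (p j),
      forall i j, i != j -> simplex (p i) `&` simplex (p j) = set0 &
      forall i j, i != j ->
        let I := closure (simplex (p i)) `&` closure (simplex (p j)) in
        I = set0 \/ exists A B : {set 'I_k.+1},
          [/\ A != finset.set0, B != finset.set0,
              I = face (p i) A & I = face (p j) B]].

End Simplices.

Section Bulk.
Context {R : realType} {n : nat}.
Notation V := 'rV[R]_n.+1.
Implicit Types (Omega : set V) (u v : V -> R).

Definition polyhedral_domain Omega : Prop :=
  [/\ Omega !=set0, open Omega, connected Omega, bounded_set Omega &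
      exists (N : nat) (p : 'I_N -> 'I_n.+2 -> V),
        (forall j, nondegenerate (p j)) /\
        closure Omega = \bigcup_j closure (simplex (p j))].

(** Regular (i.e. conforming) partitioning of [Omega] into open simplices. *)
Definition triangulation Omega (N : nat) (o : 'I_N -> 'I_n.+2 -> V) : Prop :=
  [/\ simplicial_complex o, forall i, simplex (o i) `<=` Omega &
      closure Omega = \bigcup_i closure (simplex (o i))].

(** S^m *)
Definition bulk_fe Omega (N : nat) (o : 'I_N -> 'I_n.+2 -> V) u : Prop :=
  {within closure Omega, continuous u} /\
  forall i, affine_on (simplex (o i)) u.

(** (grad u, grad v) over [Omega] *)
Definition dirichlet Omega u v : R :=
  \int[volume_measure]_(x in Omega)
    \sum_(i < n.+1) 'D_(delta_mx 0 i) u x * 'D_(delta_mx 0 i) v x.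

End Bulk.

(** A polyhedral surface with J elements is described by the vertices
    [p j : 'I_n.+1 -> 'rV_n.+1] of its elements. *)
Section Surface.
Context {R : realType} {n J : nat}.
Notation V := 'rV[R]_n.+1.
Variable p : 'I_J -> 'I_n.+1 -> V.

Definition surface : set V := \bigcup_j closure (simplex (p j)).

Definition unit_normal (j : 'I_J) : V :=
  (enorm (wedgev (edges (p j))))^-1 *: wedgev (edges (p j)).

(** The surface is a closed polyhedral hypersurface, with interior [D] and with
    [unit_normal] as outer unit normal to [D]. As the elements meet only along
    their boundaries, these conditions determine [D]. *)
Definition closed_polyhedral_hypersurface (D : set V) : Prop :=
  [/\ simplicial_complex p,
      open D, bounded_set D, closure D `\` D = surface &
      forall j x, simplex (p j) x -> \forall e \near 0^'+,
        D (x - e *: unit_normal j) /\ ~ D (x + e *: unit_normal j)].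

(** The field equal to [c j] on the j-th element. *)
Definition pw_const (c : 'I_J -> V) (x : V) : V :=
  \sum_j \1_(simplex (p j)) x *: c j.

Definition normal_field : V -> V := pw_const unit_normal.

Definition surf_integral (f : V -> R) : R :=
  \int[hausdorff_measure n]_(x in surface) f x.

Definition area (j : 'I_J) : R := fine (hausdorff n (simplex (p j))).

Definition lumped_integral (f : V -> R) : R :=
  (n.+1)%:R^-1 * \sum_j area j *
    \sum_k lim (f x @[x --> within (simplex (p j)) (nbhs (p j k))]).

Definition surf_ip (u v : V -> R) : R := surf_integral (fun x => u x * v x).

Definition surf_ipv (u v : V -> V) : R :=
  surf_integral (fun x => dotv (u x) (v x)).

Definition lumped_ip (u v : V -> R) : R :=
  lumped_integral (fun x => u x * v x).

Definition lumped_ipv (u v : V -> V) : R :=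
  lumped_integral (fun x => dotv (u x) (v x)).

(** <., .>^(h) : mass lumping if [h], true integration otherwise *)
Definition surf_ip_opt (h : bool) : (V -> R) -> (V -> R) -> R :=
  if h then lumped_ip else surf_ip.

(** V(Gamma) and [V(Gamma)]^d; only the values on the surface matter. *)
Definition surf_fe (f : V -> R) : Prop :=
  {within surface, continuous f} /\
  forall j, affine_on (simplex (p j)) f.

Definition surf_fev (f : V -> V) : Prop :=
  forall i, surf_fe (fun x => f x 0 i).

Definition nodal_interp (f : V -> R) : V -> R :=
  xget (fun=> 0) [set g | surf_fe g /\ forall j k, g (p j k) = f (p j k)].

(** The rows form a basis of the tangent space of the j-th element that is
    orthonormal with respect to [bform H]. *)
Definition tangent_onb (H : 'M[R]_n.+1) (j : 'I_J) : 'M[R]_(n, n.+1) :=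
  xget 0 [set tau | (tau <= edges (p j))%MS /\ tau *m H *m tau^T = 1%:M].

(** (nabla_s^H X, nabla_s^H Y)_H *)
Definition surf_grad_ip (H : 'M[R]_n.+1) (X Y : V -> V) (x : V) : R :=
  \sum_j \1_(simplex (p j)) x *
    \sum_i bform H ('D_(row i (tangent_onb H j)) X x)
                   ('D_(row i (tangent_onb H j)) Y x).

End Surface.

Section Anisotropy.
Context {R : realType} {n L : nat}.
Notation V := 'rV[R]_n.+1.
Variables (r : R) (G : 'I_L -> 'M[R]_n.+1).

Definition gamma_l (l : 'I_L) (v : V) : R := Num.sqrt (bform (G l) v v).

Definition gamma (v : V) : R :=
  (\sum_l bform (G l) v v `^ (r / 2)) `^ r^-1.

Definition Gtilde (l : 'I_L) : 'M[R]_n.+1 :=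
  (\det (G l) `^ n%:R^-1) *: invmx (G l).

Definition aniso_energy (J : nat) (p : 'I_J -> 'I_n.+1 -> V) : R :=
  surf_integral p (fun x => gamma (normal_field p x)).

(** [p] and [p1] describe the old and the new surface. *)
Definition aniso_form (J : nat) (p p1 : 'I_J -> 'I_n.+1 -> V)
    (X eta : V -> V) : R :=
  \sum_l surf_integral p (fun x =>
    (gamma_l l (normal_field p1 (X x)) / gamma (normal_field p1 (X x)))
      `^ (r - 1)
    * surf_grad_ip p (Gtilde l) X eta x * gamma_l l (normal_field p x)).

End Anisotropy.

(** The polyhedral surface with vertices [q] and connectivity [conn]. *)
Definition with_conn {V : Type} {J K n : nat}
    (conn : 'I_J -> 'I_n.+1 -> 'I_K) (q : 'I_K -> V) (j : 'I_J) (k : 'I_n.+1) :=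
  q (conn j k).

Section Evolution.
Context {R : realType} {n J K : nat}.
Notation V := 'rV[R]_n.+1.
Variables (conn : 'I_J -> 'I_n.+1 -> 'I_K) (t0 t1 : R) (q0 q1 : 'I_K -> V).

Definition interp_vertices (t : R) (k : 'I_K) : V :=
  ((t1 - t) / (t1 - t0)) *: q0 k + ((t - t0) / (t1 - t0)) *: q1 k.

Definition interp_surface (t : R) : 'I_J -> 'I_n.+1 -> V :=
  with_conn conn (interp_vertices t).

(** nu^{m+1/2} *)
Definition averaged_normal : V -> V :=
  pw_const (with_conn conn q0) (fun j => \row_i
    (((t1 - t0) * area (with_conn conn q0) j)^-1 *
     \int[lebesgue_measure]_(t in `[t0, t1])
       (unit_normal (interp_surface t) j 0 i * area (interp_surface t) j))).

(** omega^{m+1/2} *)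
Definition averaged_vertex_normal (omega : V -> V) : Prop :=
  surf_fev (with_conn conn q0) omega /\
  forall phi, surf_fev (with_conn conn q0) phi ->
    lumped_ipv (with_conn conn q0) omega phi =
    surf_ipv (with_conn conn q0) averaged_normal phi.

End Evolution.

(* Main.v *)
Require Import Defs.
From HB Require Import structures.
From mathcomp Require Import all_boot all_order all_algebra.
From mathcomp Require Import fingroup perm.
From mathcomp Require Import all_classical all_reals all_analysis.
From mathcomp Require Import measurable_realfun.
From mathcomp Require Import ring lra.

Set Implicit Arguments.
Unset Strict Implicit.
Unset Printing Implicit Defensive.

Import Order.TTheory GRing.Theory Num.Theory.
Import numFieldNormedType.Exports.

Local Open Scope classical_set_scope.
Local Open Scope ring_scope.

(** Volume. The jumps of the indicator of the interior along a ray from a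
    generic point are the signed crossings of the ray with the surface, so the
    enclosed volume is a constant times the sum over the elements of the
    determinants of their vertices. For vertices moving linearly in time this
    is a polynomial, whose derivative is the sum of [w . b] over the elements
    and their vertices, where [w] is the wedge product of the edges and [b] the
    velocity of the vertex, up to terms that are indexed by the facets of the
    elements. The latter cancel, because a small loop around a facet leaves the
    interior as often as it enters it. As [w] is the unit normal times the area,
    up to a constant, the time integral of the derivative is the integral of
    [(X - id) . nu^{m+1/2}], which vanishes by the first equation with the test
    function 1.

    Stability. The three equations tested with [U], the interpolant of the
    normal velocity and [X - id] give
    [dt (grad U, grad U) + <grad X, grad (X - id)> = 0]. On each element
    and for each [G_l], the integrand of the second term is at least
    [gamma_l (w1) - gamma_l (w0)], by convexity and the inequality between
    arithmetic and geometric means for at most two eigenvalues; summation over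
    [l] uses Young's inequality. *)

(** * Scalar products and the wedge product *)

(** [volume] and [hausdorff] are bare infima over covers, so their values on simplices have to be
    derived. Both are translation-invariant outer measures; such measures agree on open sets up to a
    factor, and this forces the factor [|det A|] under a linear map [A]. The contents of the
    standard simplex stay unevaluated, being common factors.

    For an element, [w . b] replaces every row of the vertex determinant in turn by the same
    velocity, whereas the time derivative replaces each row by the velocity of its own vertex. The
    surplus terms pair the facet opposite to a vertex with the velocity of a vertex of that facet,
    so elements sharing the facet produce the same number up to sign. That these signs add up to
    zero is a fact about the connectivity: it is extracted from the geometry of the initial surface
    and then holds for arbitrary vertex positions, hence at all times.

    In the stability part, the weights [[gamma_l / gamma]^(r-1)] are the partial derivatives of the
    l^r norm at the new normal, so that the form is the tangent bound of a convex function. *)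

Section DotProduct.
Context {R : realType} {d : nat}.
Implicit Types u v w : 'rV[R]_d.

Lemma dotvE u v : dotv u v = (u *m v^T) 0 0.
Proof. by rewrite mxE; apply: eq_bigr => i _; rewrite mxE. Qed.

Lemma dotvC u v : dotv u v = dotv v u.
Proof. by apply: eq_bigr => i _; rewrite mulrC. Qed.

Lemma dotvDl u v w : dotv (u + v) w = dotv u w + dotv v w.
Proof. by rewrite /dotv -big_split; apply: eq_bigr => i _; rewrite mxE mulrDl. Qed.

Lemma dotvZl a u v : dotv (a *: u) v = a * dotv u v.
Proof. by rewrite /dotv mulr_sumr; apply: eq_bigr => i _; rewrite mxE mulrA. Qed.

Lemma dotvDr u v w : dotv u (v + w) = dotv u v + dotv u w.
Proof. by rewrite dotvC dotvDl !(dotvC u). Qed.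

Lemma dotvZr a u v : dotv u (a *: v) = a * dotv u v.
Proof. by rewrite dotvC dotvZl dotvC. Qed.

Lemma dotvNl u v : dotv (- u) v = - dotv u v.
Proof. by rewrite -scaleN1r dotvZl mulN1r. Qed.

Lemma dotvNr u v : dotv u (- v) = - dotv u v.
Proof. by rewrite -scaleN1r dotvZr mulN1r. Qed.

Lemma dotvBl u v w : dotv (u - v) w = dotv u w - dotv v w.
Proof. by rewrite dotvDl dotvNl. Qed.

Lemma dotvBr u v w : dotv u (v - w) = dotv u v - dotv u w.
Proof. by rewrite dotvDr dotvNr. Qed.

Lemma dot0v u : dotv 0 u = 0.
Proof. by rewrite -(scale0r 0) dotvZl mul0r. Qed.

Lemma dotv0 u : dotv u 0 = 0.
Proof. by rewrite dotvC dot0v. Qed.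

Lemma dotv_suml (I : Type) (s : seq I) (P : pred I) (F : I -> 'rV[R]_d) v :
  dotv (\sum_(i <- s | P i) F i) v = \sum_(i <- s | P i) dotv (F i) v.
Proof.
elim/big_rec2: _ => [|i x y _ <-]; first exact: dot0v.
exact: dotvDl.
Qed.

Lemma dotv_sumr (I : Type) (s : seq I) (P : pred I) (F : I -> 'rV[R]_d) v :
  dotv v (\sum_(i <- s | P i) F i) = \sum_(i <- s | P i) dotv v (F i).
Proof. by rewrite dotvC dotv_suml; apply: eq_bigr => i _; rewrite dotvC. Qed.

Lemma dotv_ge0 u : 0 <= dotv u u.
Proof. by apply: sumr_ge0 => i _; rewrite -expr2 sqr_ge0. Qed.

Lemma dotv_eq0 u : (dotv u u == 0) = (u == 0).
Proof.
apply/eqP/eqP => [h|->]; last exact: dot0v.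
apply/rowP => i; rewrite mxE; apply/eqP; rewrite -sqrf_eq0 expr2.
move/eqP: h; rewrite psumr_eq0 => [/allP/(_ i)|j _]; last by rewrite -expr2 sqr_ge0.
by rewrite mem_index_enum => /(_ isT).
Qed.

Lemma dotv_gt0 u : (0 < dotv u u) = (u != 0).
Proof. by rewrite lt_def dotv_ge0 andbT dotv_eq0. Qed.

Lemma enorm_ge0 u : 0 <= enorm u.
Proof. exact: sqrtr_ge0. Qed.

Lemma enorm_gt0 u : (0 < enorm u) = (u != 0).
Proof. by rewrite /enorm sqrtr_gt0 dotv_gt0. Qed.

Lemma enorm_sqr u : enorm u ^+ 2 = dotv u u.
Proof. by rewrite sqr_sqrtr// dotv_ge0. Qed.

Lemma bform1 u v : bform 1%:M u v = dotv u v.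
Proof. by rewrite /bform mulmx1 dotvE. Qed.

Lemma spd1 : spd (1%:M : 'M[R]_d).
Proof. by split=> [|v v0]; [rewrite trmx1|rewrite bform1 dotv_gt0]. Qed.

Lemma spd_unit (G : 'M[R]_d) : spd G -> G \in unitmx.
Proof.
move=> [_ Gp]; rewrite -row_free_unit -kermx_eq0; apply/eqP/row_matrixP => i.
apply/eqP; rewrite row0; apply/negP => /negP k0; have := Gp _ k0.
have : (row i (kermx G) <= kermx G)%MS by exact: row_sub.
by move/sub_kermxP; rewrite /bform => ->; rewrite mul0mx mxE ltxx.
Qed.

Lemma bformZ (G : 'M[R]_d) a u : bform G (a *: u) (a *: u) = a ^+ 2 * bform G u u.
Proof.
rewrite /bform linearZ /= -!scalemxAl -scalemxAr !mxE mulrA; congr (_ * _).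
Qed.

Lemma bform_ge0 (G : 'M[R]_d) u : spd G -> 0 <= bform G u u.
Proof.
move=> [_ Gp]; have [->|u0] := eqVneq u 0; last exact/ltW/Gp.
by rewrite /bform mul0mx mul0mx mxE.
Qed.

Lemma spd_inv (G : 'M[R]_d) : spd G -> spd (invmx G).
Proof.
move=> sG; have uG := spd_unit sG; case: (sG) => [Gs Gp]; split.
  by rewrite trmx_inv Gs.
move=> v v0; have := Gp (v *m invmx G); rewrite /bform mulmxKV// trmx_mul trmx_inv Gs.
rewrite mulmxA; apply; apply: contra_neq v0 => h.
by rewrite -(mulmxKV uG v) h mul0mx.
Qed.

Lemma spdZ (G : 'M[R]_d) a : 0 < a -> spd G -> spd (a *: G).
Proof.
move=> a0 [Gs Gp]; split=> [|v v0]; first by rewrite linearZ /= Gs.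
by rewrite /bform -scalemxAr -scalemxAl mxE mulr_gt0//; exact: Gp.
Qed.

Lemma spd_congr (m : nat) (G : 'M[R]_d) (E : 'M[R]_(m, d)) :
  spd G -> row_free E -> spd (E *m G *m E^T).
Proof.
move=> [Gs Gp] fE; split; first by rewrite !trmx_mul trmxK Gs mulmxA.
move=> v v0; have := Gp (v *m E); rewrite /bform trmx_mul !mulmxA; apply.
by apply: contra_neq v0; move=> h; apply: (row_free_inj fE); rewrite h mul0mx.
Qed.

End DotProduct.

Section Orthonormalization.
Context {R : realType}.

(** Elimination by [T] leaves the Schur complement [S] of the first entry. It is again positive
    definite, since [v S v^T] is the value of [P] at [row_mx 0 v *m T], and induction applies.
    Invertibility of [B] is read off [B (P B^T) = 1]. *)
Lemma spd_onb (k : nat) (P : 'M[R]_k) : spd P ->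
  exists2 B : 'M[R]_k, B \in unitmx & B *m P *m B^T = 1%:M.
Proof.
suff : spd P -> exists B : 'M[R]_k, B *m P *m B^T = 1%:M.
  move=> h /h[B BP]; exists B => //; move: BP; rewrite -mulmxA => /mulmx1_unit.
  by case.
elim: k P => [|k IH] P sP; first by exists 0; apply/matrixP => [[]].
case: (sP) => Ps Pp.
move: P Ps Pp sP; rewrite -[k.+1]/(1 + k)%N => P Ps Pp sP.
pose a := P 0 0.
have a0 : 0 < a.
  have := Pp (delta_mx 0 0); rewrite /bform -rowE trmx_delta -colE !mxE; apply.
  apply/negP => /eqP/matrixP/(_ 0 0); rewrite !mxE !eqxx => /eqP.
  by rewrite oner_eq0.
have ulE : ulsubmx P = a%:M.
  apply/matrixP => i j; rewrite !ord1 !mxE eqxx mulr1n /a; congr (P _ _); exact/val_inj.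
have dlE : dlsubmx P = (ursubmx P)^T by rewrite trmx_ursub Ps.
pose u := ursubmx P.
pose T : 'M[R]_(1 + k) := block_mx 1%:M 0 (- a^-1 *: u^T) 1%:M.
pose S := drsubmx P - a^-1 *: (u^T *m u).
have TPT : T *m P *m T^T = block_mx a%:M 0 0 S.
  rewrite -{1}(submxK P) ulE dlE -/u /T tr_block_mx !mulmx_block.
  rewrite !(trmx1, trmx0, mul1mx, mul0mx, mulmx1, mulmx0, addr0, add0r).
  have a1 : a^-1 * a = 1 by rewrite mulVf// gt_eqF.
  rewrite linearZ /= trmxK -!scalemxAl !scaleNr !mulmxN.
  have a2 : a * a^-1 = 1 by rewrite mulfV// gt_eqF.
  rewrite !mul_scalar_mx !mul_mx_scalar !scalerA a1 a2 !scale1r !addNr mul0mx.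
  by rewrite oppr0 add0r addrC.
have [B BSB] : exists B : 'M[R]_k, B *m S *m B^T = 1%:M.
  apply: IH; split.
    rewrite /S linearB /= linearZ /= trmx_mul trmxK; congr (_ - _).
    by rewrite trmx_drsub Ps.
  move=> v v0; have := Pp (row_mx 0 v *m T).
  rewrite /bform trmx_mul !mulmxA -(mulmxA _ T) -(mulmxA _ _ T^T) TPT.
  rewrite /T !mul_row_block tr_row_mx.
  rewrite !(mul0mx, mulmx0, add0r, addr0, trmx0, mulmx1).
  rewrite mul_row_col !(mul0mx, mulmx0, add0r); apply.
  by apply: contra_neq v0 => /(congr1 rsubmx); rewrite row_mxKr linear0.
have sa : (Num.sqrt a)^-1 * a * (Num.sqrt a)^-1 = 1.
  have s0 : Num.sqrt a != 0 by rewrite gt_eqF// sqrtr_gt0.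
  by rewrite -{2}(sqr_sqrtr (ltW a0)); field.
exists (block_mx (Num.sqrt a)^-1%:M 0 0 B *m T).
rewrite trmx_mul !mulmxA -(mulmxA _ T) -(mulmxA _ _ T^T) TPT.
rewrite tr_block_mx !mulmx_block !mulmx0 !mul0mx !addr0 !add0r !trmx0 !mulmx0 BSB.
rewrite !mul0mx -!scalar_mxM tr_scalar_mx -scalar_mxM sa.
by rewrite !addr0 !add0r -scalar_mx_block.
Qed.

Lemma row_free_onb (m d : nat) (H : 'M[R]_d) (E : 'M[R]_(m, d)) :
  spd H -> row_free E ->
  exists2 B : 'M[R]_m, B \in unitmx & (B *m E) *m H *m (B *m E)^T = 1%:M.
Proof.
move=> sH fE; have [B uB BP] := spd_onb (spd_congr sH fE).
by exists B => //; rewrite trmx_mul !mulmxA in BP *.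
Qed.

End Orthonormalization.

Section WedgeTheory.
Context {R : realType} {n : nat}.
Implicit Types (E : 'M[R]_(n, n.+1)) (b : 'rV[R]_n.+1).

(** Moving the last row to the top passes it across [n] rows. The right-hand side has the block form
    to which the product and block rules for determinants apply. *)
Lemma det_rcons E b :
  \det (rcons_row E b) = (-1) ^+ n * \det (col_mx b E : 'M[R]_(1 + n)).
Proof.
rewrite (expand_det_row _ ord_max) (expand_det_row (col_mx b E) 0) mulr_sumr.
apply: eq_bigr => i _; rewrite mxE unlift_none /=.
have -> : col_mx b E 0 i = b 0 i.
  by rewrite mxE; case: splitP => [k _|//]; rewrite ord1.
rewrite /cofactor [in RHS]exprD mul1r /= exprD -mulrA mulrCA; congr (_ * (_ * (_ * \det _))).
apply/matrixP => j k; rewrite !mxE.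
have -> : unlift ord_max (lift ord_max j) = Some j by rewrite liftK.
have -> : lift 0 j = rshift 1 j :> 'I_(1 + n) by exact/val_inj.
by rewrite (unsplitK (inr j : 'I_1 + 'I_n)%type) /= mxE.
Qed.

Lemma dotv_wedge b E : dotv b (wedgev E) = (-1) ^+ n * \det (col_mx b E : 'M[R]_(1 + n)).
Proof. by rewrite (wedgevP E (wedgev E)).2// det_rcons. Qed.

Lemma det_col_mx_wedge b E : \det (col_mx b E : 'M[R]_(1 + n)) = (-1) ^+ n * dotv b (wedgev E).
Proof. by rewrite dotv_wedge mulrA -expr2 sqrr_sign mul1r. Qed.

Lemma wedge_unique E w : (forall b, dotv b w = dotv b (wedgev E)) -> w = wedgev E.
Proof. by move=> h; apply/wedgevP => b; rewrite h (wedgevP E (wedgev E)).2. Qed.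

Lemma wedge_mull (A : 'M[R]_n) E : wedgev (A *m E) = \det A *: wedgev E.
Proof.
apply/esym/wedge_unique => b; rewrite dotvZr !dotv_wedge mulrCA; congr (_ * _).
have -> : col_mx b (A *m E) = block_mx 1%:M 0 0 A *m col_mx b E :> 'M[R]_(1 + n, n.+1).
  by rewrite mul_block_col !mul0mx mul1mx addr0 add0r.
by rewrite -[n.+1]/(1 + n)%N det_mulmx det_ublock det1 mul1r.
Qed.

Lemma wedgeZ a E : wedgev (a *: E) = a ^+ n *: wedgev E.
Proof. by rewrite -mul_scalar_mx wedge_mull det_scalar. Qed.

Lemma dotv_row_wedge E i : dotv (row i E) (wedgev E) = 0.
Proof.
rewrite dotv_wedge [X in _ * X](_ : _ = 0) ?mulr0//.
apply: (@determinant_alternate _ _ _ (lshift n 0) (rshift 1 i)) => // j.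
by rewrite col_mxEu col_mxEd mxE.
Qed.

Lemma mul_wedge E : E *m (wedgev E)^T = 0.
Proof.
apply/matrixP => i j; rewrite ord1 [RHS]mxE -(dotv_row_wedge E i).
by rewrite dotvE -row_mul [RHS]mxE.
Qed.

Lemma dotv_wedge_submx (k : nat) (M : 'M[R]_(k, n.+1)) E i :
  (M <= E)%MS -> dotv (row i M) (wedgev E) = 0.
Proof. by move=> /submxP[Q ->]; rewrite dotvE -row_mul -mulmxA mul_wedge mulmx0 !mxE. Qed.

(** Some basis vector [b] lies outside the row space of [E], whose rank is only [n]; then
    [det (b, E)], which is [b . wedgev E] up to sign, is nonzero. *)
Lemma wedge_neq0 E : row_free E -> wedgev E != 0.
Proof.
move=> fE; have /row_subPn[i hi] : ~~ ((1%:M : 'M[R]_n.+1) <= E)%MS.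
  apply/negP => /mxrankS; rewrite mxrank1 (eqP fE) ltnn //.
apply: contraNneq hi => w0; set b := row i 1%:M.
have : ~~ row_free (col_mx b E : 'M[R]_(1 + n)).
  by rewrite row_free_unit unitmxE det_col_mx_wedge w0 dotv0 mulr0 unitr0.
rewrite /row_free eqn_leq rank_leq_row /= -ltnNge => hr.
have EbE : (E <= b + E)%MS by exact: addsmxSr.
apply: contraTT hr => nb; rewrite -leqNgt -addsmxE.
have : (E < b + E)%MS by rewrite ltmxE EbE /= addsmx_sub negb_and nb.
by move=> /rank_ltmx; rewrite (eqP fE).
Qed.

(** Put the row [w G] on top of [E], with [w] the wedge product. As [E w^T = 0], the Gram matrix of
    this square matrix with respect to [G^-1] is block diagonal, with blocks [s = w G w^T] and the
    Gram matrix of [E]; its own determinant is [s] up to sign. Comparing determinants and cancelling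
    one [s] gives the formula. *)
Lemma bform_wedge (G : 'M[R]_n.+1) E : spd G -> row_free E ->
  bform G (wedgev E) (wedgev E) = \det G * \det (E *m invmx G *m E^T).
Proof.
move=> sG fE; have uG := spd_unit sG; case: (sG) => Gs Gp.
set w := wedgev E; set s := bform G w w.
have s0 : s != 0 by rewrite gt_eqF// Gp// wedge_neq0.
pose B : 'M[R]_(1 + n) := col_mx (w *m G) E.
have sM : w *m G *m w^T = s%:M by rewrite [LHS]mx11_scalar.
have dB : \det B = (-1) ^+ n * s.
  by rewrite /B det_col_mx_wedge dotvE /s /bform sM.
have : B *m invmx G *m B^T = block_mx s%:M 0 0 (E *m invmx G *m E^T).
  rewrite /B mul_col_mx tr_col_mx mul_col_row mulmxK// trmx_mul Gs mulmxA sM.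
  rewrite -(mulmxA E _ (G *m _)) mulKmx// mul_wedge.
  by rewrite -[w *m E^T]trmxK trmx_mul trmxK mul_wedge trmx0.
move/(congr1 (fun M : 'M[R]_(1 + n) => \det M)); rewrite det_ublock det_scalar1 /=.
rewrite -[n.+1]/(1 + n)%N !det_mulmx det_tr dB det_inv => h.
have dG : \det G != 0 by rewrite -unitfE -unitmxE.
apply: (mulfI s0); rewrite mulrCA -h.
rewrite mulrACA -expr2 -signr_odd; case: (odd n); rewrite /= ?expr0 ?expr1; by field.
Qed.

End WedgeTheory.

(** * Topology of row vectors and transported outer measures *)

Section CoordinateTopology.
Context {R : realType} {d : nat}.
Implicit Types (x y : 'rV[R]_d).

Lemma near_rV x (P : 'rV[R]_d -> Prop) :
  (\forall y \near x, P y) <->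
  exists2 e, 0 < e & forall y, (forall i, `|y 0 i - x 0 i| < e) -> P y.
Proof.
split=> [/nbhs_ballP[e /= e0 he]|[e e0 he]].
  exists e => // y hy; apply: he; split=> // i j; rewrite ord1.
  by rewrite -ball_normE /= distrC.
apply/nbhs_ballP; exists e => //= y hy; apply: he => i; have := hy.2 0 i.
by rewrite -ball_normE /= distrC.
Qed.

(* Instance inference does not find the filter structure of neighborhoods of row vectors. *)
Lemma nbhs_rVS x (P Q : set 'rV[R]_d) : P `<=` Q -> nbhs x P -> nbhs x Q.
Proof. exact: (@filterS _ _ (nbhs_filter x)). Qed.

Lemma nbhs_rVI x (P Q : set 'rV[R]_d) : nbhs x P -> nbhs x Q -> nbhs x (P `&` Q).
Proof. exact: (@filterI _ _ (nbhs_filter x)). Qed.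

Lemma nbhs_rV_forall (I : finType) x (P : I -> set 'rV[R]_d) :
  (forall i, nbhs x (P i)) -> nbhs x [set y | forall i, P i y].
Proof. exact: (@filter_forall _ _ _ _ (nbhs_filter x)). Qed.

Lemma ler_norm_dotv a x e : (forall i, `|x 0 i| <= e) ->
  `|dotv a x| <= (\sum_i `|a 0 i|) * e.
Proof.
move=> h; rewrite (le_trans (ler_norm_sum _ _ _))// mulr_suml ler_sum// => i _.
by rewrite normrM ler_wpM2l.
Qed.

Lemma dotv_continuous a : continuous (fun x => dotv a x).
Proof.
move=> x P /nbhs_ballP[e /= e0 he]; apply/near_rV.
have s1 : 0 < \sum_i `|a 0 i| + 1 by rewrite ltr_wpDl// sumr_ge0.
exists (e / (\sum_i `|a 0 i| + 1)); first by rewrite divr_gt0.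
move=> y hy; apply: he; rewrite -ball_normE /= -dotvBr.
apply: (@le_lt_trans _ _ ((\sum_i `|a 0 i|) * (e / (\sum_i `|a 0 i| + 1)))).
  apply: ler_norm_dotv => i; rewrite !mxE distrC; exact/ltW.
rewrite mulrCA -[ltRHS]mulr1 ltr_pM2l// ltr_pdivrMr// mul1r ltrDl; exact: ltr01.
Qed.

End CoordinateTopology.

Section LinearTopology.
Context {R : realType} {d k : nat}.

Lemma mulmx_continuous (A : 'M[R]_(d, k)) : continuous (fun x : 'rV[R]_d => x *m A).
Proof.
move=> x P /near_rV[e e0 he].
have : \forall y \near x, forall j, `|(y *m A) 0 j - (x *m A) 0 j| < e.
  apply: nbhs_rV_forall => j.
  have : nbhs (dotv (col j A)^T x) (ball (dotv (col j A)^T x) e).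
    exact: nbhsx_ballx.
  move/(@dotv_continuous R d (col j A)^T x); apply: nbhs_rVS => y.
  suff E (z : 'rV_d) : dotv (col j A)^T z = (z *m A) 0 j.
    by rewrite -ball_normE /= !E distrC.
  rewrite dotvC dotvE trmxK [LHS]mxE [RHS]mxE; apply: eq_bigr => i _.
  by rewrite mxE.
by apply: nbhs_rVS => y hy; exact: he.
Qed.

End LinearTopology.

Lemma open_mulmx (R : realType) (d : nat) (A : 'M[R]_d) (S : set 'rV[R]_d) :
  A \in unitmx -> open S -> open [set x *m A | x in S].
Proof.
move=> uA oS.
have -> : [set x *m A | x in S] = (fun x => x *m invmx A) @^-1` S.
  apply/seteqP; split=> [_ [x Sx <-]|x Sx] /=; first by rewrite mulmxK.
  by exists (x *m invmx A) => //; rewrite mulmxKV.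
by apply: open_comp => // x _; exact: mulmx_continuous.
Qed.

Section ImageOuter.
Context {R : realType} {T T' : Type}.
Variables (mu : {outer_measure set T' -> \bar R}) (f : T -> T').

Definition image_outer (A : set T) : \bar R := mu (f @` A).

Let image_outer0 : image_outer set0 = 0%E.
Proof. by rewrite /image_outer image_set0 outer_measure0. Qed.

Let image_outer_ge0 A : (0 <= image_outer A)%E.
Proof. exact: outer_measure_ge0. Qed.

Let le_image_outer : {homo image_outer : A B / A `<=` B >-> (A <= B)%E}.
Proof. by move=> A B AB; apply: le_outer_measure; exact: image_subset. Qed.

Let image_outer_sigma_subadditive : sigma_subadditive image_outer.
Proof. by move=> F; rewrite /image_outer image_bigcup; exact: outer_measure_sigma_subadditive. Qed.

HB.instance Definition _ := isOuterMeasure.Build R T image_outer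
  image_outer0 image_outer_ge0 le_image_outer image_outer_sigma_subadditive.

Lemma image_outer_caratheodory (A : set T) : injective f ->
  mu.-caratheodory (f @` A) -> image_outer.-caratheodory A.
Proof.
move=> fI mA X; rewrite /image_outer (mA (f @` X)); congr (mu _ + mu _)%E.
  apply/seteqP; split=> [_ [[x Xx <-] [y Ay /fI yx]]|_ [x [Xx Ax] <-]].
    by exists x => //; split => //; rewrite -yx.
  by split; exists x.
apply/seteqP; split=> [_ [[x Xx <-] nAx]|_ [x [Xx Ax] <-]].
  by exists x => //; split => // Ax; apply: nAx; exists x.
by split; [exists x|move=> [y Ay /fI yx]; apply: Ax; rewrite -yx].
Qed.

End ImageOuter.

(** Cauchy's functional equation: additivity yields integer multiples, nonnegativity yields
    monotonicity. Squeezing [q a] between consecutive integers bounds [|g a - a g 1|] by [g 1 / q],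
    and [q] is taken large enough for this to be at most [e]. *)
Lemma ge0_additive_linear (R : realType) (phi : R -> \bar R) (a : R) :
  (forall a, (0 <= phi a)%E) ->
  (forall a b, 0 <= a -> 0 <= b -> phi (a + b) = (phi a + phi b)%E) ->
  (phi 1%R < +oo)%E -> 0 <= a -> phi a = (a%:E * phi 1%R)%E.
Proof.
move=> phi0 phiD phi1.
have f1 : phi 1 \is a fin_num by rewrite ge0_fin_numE.
have le_phi b c : 0 <= b -> b <= c -> (phi b <= phi c)%E.
  move=> b0 bc; rewrite -(subrK b c) phiD ?subr_ge0//.
  by rewrite -[leLHS]add0e leeD2r.
have fphi b : 0 <= b -> phi b \is a fin_num.
  move=> b0; rewrite ge0_fin_numE//; apply: (@le_lt_trans _ _ (phi (Num.truncn b).+1%:R)).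
    by apply: le_phi => //; exact/ltW/truncnS_gt.
  elim: (Num.truncn b) => [//|m IH]; rewrite -natr1 phiD// ?ler0n//.
  exact: lte_add_pinfty.
pose g b := fine (phi b).
have gn m b : 0 <= b -> g (b *+ m) = g b *+ m.
  move=> b0; elim: m => [|m IH]; last first.
    by rewrite !mulrS /g phiD ?mulrn_wge0// fineD ?fphi ?mulrn_wge0// -IH.
  have := phiD 0 0 (lexx _) (lexx _); rewrite addr0 => /(congr1 fine).
  rewrite fineD ?fphi// -[fine (phi 0)]/(g 0) -[LHS]addr0 => /addrI <- //.
move=> a0.
suff : g a = a * g 1 by move=> ga; rewrite -(fineK (fphi _ a0)) -/(g a) ga EFinM /g fineK.
apply/eqP; rewrite -subr_eq0 -normr_le0; apply/ler_addgt0Pr => e e0; rewrite add0r.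
have g1 : 0 <= g 1 by exact: fine_ge0.
pose q := (Num.truncn (g 1 / e)).+1.
have qe : g 1 <= q%:R * e.
  by rewrite -ler_pdivrMr// ltW// truncnS_gt.
have q0 : 0 < q%:R :> R by rewrite ltr0n.
rewrite -(ler_pM2l q0) -[q%:R in leLHS]ger0_norm ?ler0n// -normrM.
apply: le_trans qe.
have gmono b c : 0 <= b -> b <= c -> g b <= g c.
  by move=> b0 bc; rewrite fine_le ?fphi ?le_phi// (le_trans b0).
have qa0 : 0 <= a *+ q by rewrite mulrn_wge0.
have /andP[m1 m2] := truncn_itv qa0; set m := Num.truncn _ in m1 m2.
have h1 : g 1 *+ m <= g a *+ q.
  by rewrite -!gn// gmono// ?ler0n// -natr1 ?mulrn_wge0.
have h2 : g a *+ q <= g 1 *+ m.+1.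
  by rewrite -!gn// gmono// ltW.
rewrite mulrBr ler_norml; rewrite -(mulr_natl a) in m1 m2.
rewrite -!(mulr_natl (g _)) in h1 h2.
have h3 := ler_wpM2r g1 m1; have h4 := ler_wpM2r g1 (ltW m2).
move: h2 h4; rewrite -natr1 !mulrDl !mul1r => h2 h4.
by rewrite !mulrA; apply/andP; split; lra.
Qed.

(** * Volume and Hausdorff measure under linear maps *)

Section Boxes.
Context {R : realType} {n : nat}.
Notation V := 'rV[R]_n.+1.

Definition origin_box (l : 'I_n.+1 -> R) : set V :=
  [set x | forall i, 0 <= x 0 i < l i].

Definition unit_cube : set V := origin_box (fun=> 1).

Definition dyadic_index (m : nat) (x : V) : 'rV[int]_n.+1 :=
  \row_i Num.floor (x 0 i * 2 ^+ m).

Definition dyadic_cell (m : nat) (z : 'rV[int]_n.+1) : set V :=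
  [set x | dyadic_index m x = z].

Lemma dyadic_index_half m x y :
  dyadic_index m.+1 x = dyadic_index m.+1 y -> dyadic_index m x = dyadic_index m y.
Proof.
move=> h; apply/rowP => i; move/rowP/(_ i): h; rewrite !mxE !exprSr !mulrA.
set a := x 0 i * _; set b := y 0 i * _ => ab.
suff hf (c : R) : Num.floor c = (Num.floor (c * 2) %/ 2)%Z by rewrite (hf a) (hf b) ab.
apply: floor_def; have := floor_itv (c * 2); set k := Num.floor _ => /andP[k1 k2].
have k3 : (k%:~R : R) = (k %/ 2)%Z%:~R * 2 + (k %% 2)%Z%:~R.
  by rewrite {1}(divz_eq k 2) intrD intrM.
have m0 : (0 <= (k %% 2)%Z%:~R :> R) by rewrite ler0z modz_ge0.
have m1 : ((k %% 2)%Z%:~R <= 1 :> R).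
  by rewrite -[1]/(1%:~R) ler_int -ltzD1 ltz_pmod.
by move: k1 k2; rewrite !intrD k3 => k1 k2; apply/andP; split; lra.
Qed.

Lemma dyadic_index_close m (x y : V) i :
  dyadic_index m x = dyadic_index m y -> `|x 0 i - y 0 i| * 2 ^+ m < 1.
Proof.
move=> /rowP/(_ i); rewrite !mxE => h.
have := floor_itv (x 0 i * 2 ^+ m); have := floor_itv (y 0 i * 2 ^+ m).
rewrite h intrD => /andP[a b] /andP[c d].
have p0 : 0 < (2 ^+ m : R) by rewrite exprn_gt0.
rewrite -[X in _ * X](gtr0_norm p0) -normrM mulrBl ltr_norml.
by apply/andP; split; lra.
Qed.

Definition dyadic_inner (S : set V) (m : nat) : set V :=
  [set x | dyadic_cell m (dyadic_index m x) `<=` S].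

(** Cells are enumerated by [nat] through their codes, so that countable additivity applies; numbers
    that code no cell inside [S] contribute the empty set. *)
Definition dyadic_piece (S : set V) (m k : nat) : set V :=
  if pickle_inv k is Some z then
    if `[< dyadic_cell m z `<=` S >] then dyadic_cell m z else set0
  else set0.

Lemma dyadic_inner_bigcup S m : dyadic_inner S m = \bigcup_k dyadic_piece S m k.
Proof.
apply/seteqP; split=> [x Sx|x [k _]].
  exists (pickle (dyadic_index m x)) => //; rewrite /dyadic_piece pickleK_inv.
  by rewrite asboolT.
rewrite /dyadic_piece; case: pickle_inv => [z|//]; case: ifPn => [/asboolP zS|//].
by move=> xz; rewrite /dyadic_inner /= -xz in zS *.
Qed.

Lemma trivIset_dyadic_piece S m : trivIset setT (dyadic_piece S m).
Proof.
move=> j k _ _ [x []]; rewrite /dyadic_piece.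
have := @pickle_invK 'rV[int]_n.+1 j; have := @pickle_invK 'rV[int]_n.+1 k.
case: pickle_inv => [z|//]; case: pickle_inv => [z'|//] /= <- <-.
by case: ifPn => // _ + ; case: ifPn => // _ <- <-.
Qed.

Lemma dyadic_inner_mono S : {homo dyadic_inner S : m m' / (m <= m')%N >-> m `<=` m'}.
Proof.
move=> m m' /subnKC <-; elim: (m' - m)%N => [|k IH]; first by rewrite addn0.
apply: (subset_trans IH) => x Sx y yx; apply: Sx.
by apply: dyadic_index_half; rewrite addnS in yx.
Qed.

Lemma bigcup_dyadic_inner S : open S -> S = \bigcup_m dyadic_inner S m.
Proof.
move=> oS; apply/seteqP; split=> [x Sx|x [m _ Sx]]; last exact: Sx.
have [e e0 he] := (near_rV x S).1 (open_nbhs_nbhs (conj oS Sx)).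
pose m := Num.truncn (e^-1); exists m => // y yx; apply: he => i.
have := dyadic_index_close i yx; apply: contraTT; rewrite -!leNgt => h.
rewrite (le_trans _ (ler_wpM2r _ h)) ?exprn_ge0//.
rewrite mulrC -ler_pdivrMr// div1r (le_trans (ltW (truncnS_gt _)))// -/m.
by rewrite -natrX ler_nat ltn_expl.
Qed.

End Boxes.

Section CaratheodoryMeasure.
Context {R : realType} {T : pointedType}.
Variable mu : {outer_measure set T -> \bar R}.

Lemma caratheodory_measure_bigcup (F : nat -> set T) :
  (forall k, mu.-caratheodory (F k)) -> trivIset setT F ->
  mu (\bigcup_k F k) = (\sum_(k <oo) mu (F k))%E.
Proof.
move=> mF tF.
apply: (@measure_semi_bigcup _ R (caratheodory_type mu)
  (mu : set (caratheodory_type mu) -> \bar R)) => //.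
exact: caratheodory_measurable_bigcup.
Qed.

Lemma caratheodory_measure_cvg (F : nat -> set T) :
  (forall k, mu.-caratheodory (F k)) ->
  {homo F : m m' / (m <= m')%N >-> m `<=` m'} ->
  (mu (F k) @[k --> \oo] --> mu (\bigcup_k F k))%E.
Proof.
move=> mF nF.
apply: (@nondecreasing_cvg_mu _ (caratheodory_type mu) R
  (mu : set (caratheodory_type mu) -> \bar R)) => //.
  exact: caratheodory_measurable_bigcup.
by move=> m m' mm'; apply/subsetPset; exact: nF.
Qed.

End CaratheodoryMeasure.

Section HalfSpaceCaratheodory.
Context {R : realType} {n : nat}.
Notation V := 'rV[R]_n.+1.
Variable mu : {outer_measure set V -> \bar R}.
Hypothesis mu_half : forall i b, mu.-caratheodory [set x : V | x 0 i < b].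

Lemma caratheodory_box (a b : 'I_n.+1 -> R) :
  mu.-caratheodory [set x : V | forall i, a i <= x 0 i < b i].
Proof.
have : forall s : seq 'I_n.+1,
    mu.-caratheodory [set x : V | forall i, i \in s -> a i <= x 0 i < b i].
  elim=> [|i s IH].
    rewrite (_ : [set x : V | _] = ~` set0).
      exact/caratheodory_measurable_setC/caratheodory_measurable_set0.
    by apply/seteqP; split=> // x _.
  rewrite (_ : [set x : V | _] = (~` [set x : V | x 0 i < a i] `&` [set x : V | x 0 i < b i]) `&`
    [set x : V | forall i, i \in s -> a i <= x 0 i < b i]).
    apply: caratheodory_measurable_setI => //.
    apply: caratheodory_measurable_setI; last exact: mu_half.
    by apply: caratheodory_measurable_setC; exact: mu_half.
  apply/seteqP; split=> [x h|x [[/= /negP h1 h2] h3] j].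
    split; last by move=> j js; apply: h; rewrite inE js orbT.
    by have /andP[h1 h2] := h i (mem_head _ _); split => //=; apply/negP; rewrite -leNgt.
  by rewrite inE => /predU1P[->|/h3//]; rewrite leNgt h1.
move/(_ (enum 'I_n.+1)); congr (mu.-caratheodory _).
by apply/seteqP; split=> x h i; [apply: h; rewrite mem_enum|move=> _; exact: h].
Qed.

Lemma caratheodory_dyadic_cell m z : mu.-caratheodory (dyadic_cell m z).
Proof.
have p0 : 0 < (2 ^+ m : R) by rewrite exprn_gt0.
have -> : dyadic_cell m z = [set x : V | forall i,
    (z 0 i)%:~R / 2 ^+ m <= x 0 i < (z 0 i + 1)%:~R / 2 ^+ m].
  apply/seteqP; split=> x; last first.
    move=> h; apply/rowP => i; rewrite mxE; apply/eqP; rewrite floor_eq.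
    by have := h i; rewrite ler_pdivrMr// ltr_pdivlMr.
  move=> /rowP h i; have := h i; rewrite mxE => /eqP; rewrite floor_eq.
  by rewrite ler_pdivrMr// ltr_pdivlMr.
exact: caratheodory_box.
Qed.

Lemma caratheodory_dyadic_piece S m k : mu.-caratheodory (dyadic_piece S m k).
Proof.
rewrite /dyadic_piece; case: pickle_inv => [z|]; last exact: caratheodory_measurable_set0.
case: ifPn => _; first exact: caratheodory_dyadic_cell.
exact: caratheodory_measurable_set0.
Qed.

Lemma caratheodory_dyadic_inner S m : mu.-caratheodory (dyadic_inner S m).
Proof.
rewrite dyadic_inner_bigcup; apply: caratheodory_measurable_bigcup => k.
exact: caratheodory_dyadic_piece.
Qed.

Lemma caratheodory_open S : open S -> mu.-caratheodory S.
Proof.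
move=> /bigcup_dyadic_inner ->; apply: caratheodory_measurable_bigcup => m.
exact: caratheodory_dyadic_inner.
Qed.

Lemma caratheodory_closed S : closed S -> mu.-caratheodory S.
Proof.
rewrite -openC -{2}(setCK S) => oS.
by apply: caratheodory_measurable_setC; exact: caratheodory_open.
Qed.

End HalfSpaceCaratheodory.

(** * Translation-invariant outer measures *)

Section InvariantOuter.
Context {R : realType} {n : nat}.
Notation V := 'rV[R]_n.+1.

(** Shared by Lebesgue measure, the Hausdorff measure of full dimension and their images under
    invertible linear maps. The inequality for shifts is one-sided because the shift by [- v]
    supplies the converse. *)
Record invariant_outer (mu : {outer_measure set V -> \bar R}) : Prop := {
  invariant_shift_le : forall v A, (mu [set (x + v)%R | x in A] <= mu A)%E;
  invariant_half : forall i b, mu.-caratheodory [set x : V | x 0 i < b];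
  invariant_lty : (mu unit_cube < +oo)%E }.

Variable mu : {outer_measure set V -> \bar R}.
Hypothesis imu : invariant_outer mu.

Lemma invariant_shift v A : mu [set x + v | x in A] = mu A.
Proof.
apply/eqP; rewrite eq_le invariant_shift_le//=.
have := invariant_shift_le imu (- v) [set x + v | x in A].
rewrite (_ : [set (x - v)%R | x in _] = A)//; apply/seteqP; split=> [_ [_ [x Ax <-] <-]|x Ax].
  by rewrite addrK.
by exists (x + v); rewrite ?addrK//; exists x.
Qed.

(** Cutting along a half-space and translating one of the pieces shows that the content is additive
    in a single side length, hence linear in it. The sides are changed from 1 to [l i] one
    coordinate at a time, the list [s] recording those already changed. *)
Lemma invariant_origin_box (l : 'I_n.+1 -> R) : (forall i, 0 <= l i) ->
  mu (origin_box l) = ((\prod_i l i)%:E * mu unit_cube)%E.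
Proof.
move=> l0.
pose lr (s : seq 'I_n.+1) j := if j \in s then l j else 1.
suff H (s : seq 'I_n.+1) : uniq s ->
    mu (origin_box (lr s)) = ((\prod_(i <- s) l i)%:E * mu unit_cube)%E.
  have := H _ (enum_uniq 'I_n.+1); rewrite big_enum/= => <-; congr (mu (origin_box _)).
  by apply/funext => j; rewrite /lr mem_enum.
elim: s => [_|i s IH /= /andP[si us]].
  by rewrite big_nil mul1e; congr (mu _).
pose bx a : set V := origin_box (fun j => if j == i then a else lr s j).
have e1 : bx 1 = origin_box (lr s).
  by congr origin_box; apply/funext => j; case: eqP => // ->; rewrite /lr (negbTE si).
have -> : origin_box (lr (i :: s)) = bx (l i).
  by congr origin_box; apply/funext => j; rewrite /lr inE; case: eqP => // ->.
rewrite (@ge0_additive_linear _ (fun a => mu (bx a)) (l i))//.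
- by rewrite big_cons e1 IH// muleA -EFinM.
- move=> a b a0 b0; rewrite (invariant_half imu i a (bx (a + b))).
  congr (mu _ + _)%E.
    apply/seteqP; split=> [x [h /= xa] j|x h].
      by have := h j; case: eqP => // ->; rewrite xa => /andP[->].
    split=> [j|]; last by have := h i; rewrite /= eqxx => /andP[].
    have := h j; case: eqP => // _ /andP[-> /= xa].
    by rewrite (lt_le_trans xa)// lerDl.
  rewrite -(invariant_shift (a *: delta_mx 0 i) (bx b)); congr (mu _).
  apply/seteqP; split=> [x [h /= /negP]|_ [x h <-]].
    rewrite -leNgt => ax; exists (x - a *: delta_mx 0 i); last by rewrite subrK.
    move=> j; have := h j; rewrite !mxE eqxx /=; case: eqP => [->|_].
      by rewrite mulr1 subr_ge0 ax ltrBlDl => /andP[].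
    by rewrite mulr0 subr0.
  split=> [j|/=].
    have := h j; rewrite !mxE eqxx /=; case: eqP => [->|_].
      by rewrite mulr1 => /andP[x0 xb]; rewrite addr_ge0//= addrC ltrD2l.
    by rewrite mulr0 addr0.
  apply/negP; rewrite -leNgt !mxE !eqxx mulr1 lerDr.
  by have := h i; rewrite eqxx => /andP[].
- rewrite e1 IH//; apply: lte_mul_pinfty => //; last exact: invariant_lty.
  by rewrite lee_fin prodr_ge0.
Qed.

Lemma invariant_dyadic_cell m z :
  mu (dyadic_cell m z) = ((\prod_(i < n.+1) 2 ^- m)%:E * mu unit_cube)%E.
Proof.
rewrite -invariant_origin_box => [|_]; last by rewrite invr_ge0 exprn_ge0.
rewrite -(invariant_shift (\row_i ((z 0 i)%:~R / 2 ^+ m)) (origin_box _)); congr (mu _).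
have p0 : 0 < (2 ^+ m : R) by rewrite exprn_gt0.
have key (x : V) i (k : int) : (Num.floor (x 0 i * 2 ^+ m) == k) =
    (0 <= x 0 i - k%:~R / 2 ^+ m < 2 ^- m).
  rewrite floor_eq subr_ge0 ler_pdivrMr//; congr (_ && _).
  by rewrite ltrBlDl -[X in _ < _ + X]mul1r -mulrDl ltr_pdivlMr// intrD addrC.
apply/seteqP; split=> [x /= <-|_ [x h <-]].
  exists (x - \row_i ((dyadic_index m x 0 i)%:~R / 2 ^+ m)); last by rewrite subrK.
  by move=> i; rewrite !mxE -key.
by apply/rowP => i; rewrite mxE; apply/eqP; rewrite key !mxE addrK; exact: h.
Qed.

Definition dyadic_weight (S : set V) m k : R :=
  if pickle_inv k is Some z then
    if `[< dyadic_cell m z `<=` S >] then \prod_(i < n.+1) 2 ^- m else 0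
  else 0.

Lemma invariant_dyadic_inner S m :
  mu (dyadic_inner S m) = (mu unit_cube * \sum_(k <oo) (dyadic_weight S m k)%:E)%E.
Proof.
have fc : mu unit_cube \is a fin_num by rewrite ge0_fin_numE ?(invariant_lty imu).
rewrite dyadic_inner_bigcup caratheodory_measure_bigcup; last 2 first.
- by move=> k; apply: caratheodory_dyadic_piece; exact: invariant_half.
- exact: trivIset_dyadic_piece.
rewrite -(fineK fc) -nneseriesZl; last first.
  move=> k _; rewrite lee_fin /dyadic_weight; case: pickle_inv => // z.
  by case: ifPn => // _; apply: prodr_ge0 => i _; rewrite invr_ge0 exprn_ge0.
apply: eq_eseriesr => k _; rewrite (fineK fc) muleC /dyadic_piece /dyadic_weight.
case: pickle_inv => [z|]; last by rewrite outer_measure0 mul0e.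
by case: ifPn => _; [exact: invariant_dyadic_cell|rewrite outer_measure0 mul0e].
Qed.

End InvariantOuter.

(** Dyadic cells of one level are translates of one box, so both measures weigh them in the ratio of
    their unit cubes; an open set is the increasing union of its inner dyadic approximations. The
    identity is cross-multiplied to allow for a unit cube of content zero. *)
Lemma invariant_unique (R : realType) (n : nat)
    (mu nu : {outer_measure set 'rV[R]_n.+1 -> \bar R}) (S : set 'rV[R]_n.+1) :
  invariant_outer mu -> invariant_outer nu -> open S ->
  (nu unit_cube * mu S = mu unit_cube * nu S)%E.
Proof.
move=> imu inu oS.
have fm : mu unit_cube \is a fin_num by rewrite ge0_fin_numE ?(invariant_lty imu).
have fn : nu unit_cube \is a fin_num by rewrite ge0_fin_numE ?(invariant_lty inu).
have cvgS (rho : {outer_measure set 'rV[R]_n.+1 -> \bar R}) : invariant_outer rho ->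
    (rho (dyadic_inner S m) @[m --> \oo] --> rho S)%E.
  move=> irho; rewrite [in X in _ --> X](bigcup_dyadic_inner oS).
  apply: caratheodory_measure_cvg => [k|].
    by apply: caratheodory_dyadic_inner; exact: invariant_half.
  exact: dyadic_inner_mono.
have h1 := cvgeZl fn (cvgS _ imu); have h2 := cvgeZl fm (cvgS _ inu).
suff E : (fun m => nu unit_cube * mu (dyadic_inner S m))%E =
    (fun m => mu unit_cube * nu (dyadic_inner S m))%E.
  by rewrite -(cvg_lim _ h1)// -(cvg_lim _ h2)// E.
by apply/funext => m; rewrite !invariant_dyadic_inner// muleCA.
Qed.

(** The right-hand side is the chord of the convex function on the left between [d = 0] and
    [d = 1]. *)
Lemma expr1D_le (R : realType) (m : nat) (d : R) : 0 <= d <= 1 ->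
  (1 + d) ^+ m <= 1 + (2 ^+ m - 1) * d.
Proof.
move=> /andP[d0 d1]; elim: m => [|m IH]; first by rewrite !expr0 subrr mul0r addr0.
rewrite exprSr (le_trans (ler_wpM2r _ IH)) ?addr_ge0//.
have p1 : 1 <= (2 ^+ m : R) by rewrite exprn_ege1// ler1n.
rewrite exprSr; set p := (2 ^+ m : R) in p1 *.
have : (p - 1) * d * d <= (p - 1) * d * 1 by rewrite ler_wpM2l// mulr_ge0// subr_ge0.
by nra.
Qed.

Lemma ler_expr1D_lim (R : realType) (m : nat) (k p : R) : 0 <= p ->
  (forall d, 0 < d -> k <= (1 + d) ^+ m * p) -> k <= p.
Proof.
move=> p0 h; apply/ler_addgt0Pr => e e0.
have p1 : 0 < p * 2 ^+ m + 1 by rewrite ltr_wpDl// mulr_ge0// exprn_ge0.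
pose d := Num.min 1 (e / (p * 2 ^+ m + 1)).
have d0 : 0 < d by rewrite lt_min ltr01 divr_gt0.
have d1 : d <= 1 by rewrite ge_min lexx.
have d2 : d * (p * 2 ^+ m + 1) <= e by rewrite -ler_pdivlMr// ge_min lexx orbT.
have := expr1D_le m (_ : 0 <= d <= 1); rewrite (ltW d0) d1 => /(_ isT) h1.
apply: le_trans (h _ d0) _; apply: le_trans (ler_wpM2r p0 h1) _.
have := mulr_ge0 p0 (ltW d0); nra.
Qed.

(** * The absolute determinant as the scaling factor of a linear map *)

Section DeterminantCharacter.
Context {R : realType} {n : nat}.
Variable k : 'M[R]_n.+1 -> R.
Hypothesis k1 : k 1 = 1.
Hypothesis k_ge0 : forall A, 0 <= k A.
Hypothesis kM : forall A B, A \in unitmx -> B \in unitmx -> k (A * B) = k A * k B.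
Hypothesis k_box : forall A (a l : 'I_n.+1 -> R), A \in unitmx -> (forall i, 0 <= l i) ->
  (forall x, unit_cube x -> forall i, a i <= (x *m A) 0 i < a i + l i) ->
  k A <= \prod_i l i.

Let k_perm s : k (perm_mx s) <= 1.
Proof.
have := @k_box (perm_mx s) (fun=> 0) (fun=> 1) (unitmx_perm _ _).
rewrite big1// => h; apply: h => // x cx i.
rewrite -(invgK s) -col_permE mxE add0r; exact: cx.
Qed.

(** A negative entry maps the half-open unit interval to an interval that is closed on the wrong
    side. Boxes enlarged by the factor [1 + e] contain the image, and [e] tends to 0. *)
Let k_diag (d : 'rV[R]_n.+1) : (forall i, d 0 i != 0) -> k (diag_mx d) <= \prod_i `|d 0 i|.
Proof.
move=> d0; apply: (@ler_expr1D_lim _ n.+1); first exact: prodr_ge0.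
move=> e e0; rewrite -[X in _ ^+ X](card_ord n.+1) -prodr_const -big_split /=.
apply: (@k_box _ (fun i => Num.min 0 (d 0 i))).
- rewrite unitmxE det_diag unitfE; apply/prodf_neq0 => i _; exact: d0.
- by move=> i; rewrite mulr_ge0// addr_ge0 // ltW.
- move=> x cx i; rewrite mul_mx_diag mxE.
  have /andP[x0 x1] := cx i; have := d0 i; rewrite neq_lt => /orP[di|di].
    rewrite (min_r (ltW di)) ltr0_norm//; have h : d 0 i * e < 0 by rewrite nmulr_rlt0.
    by apply/andP; split; nra.
  rewrite (min_l (ltW di)) gtr0_norm//; have h := mulr_gt0 di e0.
  by apply/andP; split; nra.
Qed.

(** Conjugation by the diagonal matrix with entries [t ^+ e i] leaves [k] unchanged, by
    multiplicativity, and multiplies the off-diagonal entry [(i, j)] by [t ^ (e i - e j)], at most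
    [t] in size where the entry is nonzero. For small [t] the cube is mapped into a box of sides
    [1 + d]. The weight [e] treats lower and upper triangular matrices alike. *)
Let k_unitriangular (M : 'M[R]_n.+1) (e : 'I_n.+1 -> nat) : M \in unitmx ->
  (forall i, M i i = 1) -> (forall i j, i != j -> M i j != 0 -> (e j < e i)%N) -> k M <= 1.
Proof.
move=> uM M1 Me; apply: (@ler_expr1D_lim _ n.+1) => // d d0; rewrite mulr1.
pose B := \sum_i \sum_j `|M i j|.
have B0 : 0 <= B by apply: sumr_ge0 => i _; exact: sumr_ge0.
pose t := Num.min 1 (d / 2 / (B + 1)).
have B1 : 0 < B + 1 by rewrite ltr_wpDl.
have t0 : 0 < t by rewrite lt_min ltr01 !divr_gt0.
have t1 : t <= 1 by rewrite ge_min lexx.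
have tB : t * B <= d / 2.
  have : t * (B + 1) <= d / 2 by rewrite -ler_pdivlMr// ge_min lexx orbT.
  by rewrite mulrDr mulr1; lra.
pose D := diag_mx (\row_i t ^+ e i : 'rV[R]_n.+1).
have uD : D \in unitmx.
  rewrite unitmxE det_diag unitfE; apply/prodf_neq0 => i _.
  by rewrite mxE expf_neq0// gt_eqF.
have DM (N : 'M[R]_n.+1) i j : (D *m N) i j = t ^+ e i * N i j by rewrite mul_diag_mx !mxE.
pose E := diag_mx (\row_i t ^- e i : 'rV[R]_n.+1).
have DE : D *m E = 1%:M.
  rewrite /D /E mulmx_diag; apply/matrixP => i j; rewrite !mxE.
  by case: eqP => [->|//]; rewrite mulr1n divff// expf_neq0// gt_eqF.
have uE : E \in unitmx by have [] := mulmx1_unit DE.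
have -> : k M = k (D * M * E).
  have kDE : k D * k E = 1 by rewrite -kM// -[D * E]/(D *m E) DE k1.
  by rewrite !kM ?unitmx_mul ?uD// mulrAC kDE mul1r.
have -> : (1 + d) ^+ n.+1 = \prod_(i < n.+1) (1 + d) by rewrite prodr_const card_ord.
apply: (@k_box _ (fun=> - (d / 2))).
- by rewrite !unitmx_mul uD uM.
- by move=> i; rewrite addr_ge0// ltW.
move=> x cx j; set N := D * M * E.
have NE i : N i j = t ^+ e i * M i j / t ^+ e j.
  by rewrite /N -[_ * E]/(_ *m E) mul_mx_diag mxE -[D * M]/(D *m M) DM !mxE.
have Njj : N j j = 1 by rewrite NE M1 mulr1 divff// expf_neq0// gt_eqF.
have -> : (x *m N) 0 j = x 0 j + \sum_(i | i != j) x 0 i * N i j.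
  by rewrite mxE (bigD1 j)//= Njj mulr1.
have : `|\sum_(i | i != j) x 0 i * N i j| <= d / 2.
  apply: le_trans tB; rewrite (le_trans (ler_norm_sum _ _ _))//.
  rewrite /B mulr_sumr; apply: (@le_trans _ _ (\sum_(i | i != j) t * `|M i j|)).
    apply: ler_sum => i ij; have /andP[x0 x1] := cx i.
    rewrite normrM (ger0_norm x0).
    apply: (@le_trans _ _ `|N i j|); first by rewrite ler_piMl// ltW.
    rewrite NE; have [->|Mij] := eqVneq (M i j) 0; first by rewrite mulr0 mul0r normr0 mulr0.
    have eij := Me _ _ ij Mij; rewrite mulrAC normrM ler_wpM2r//.
    rewrite -(subnK (ltnW eij)) exprD -mulrA divff ?expf_neq0 ?gt_eqF// mulr1.
    rewrite ger0_norm ?exprn_ge0 ?(ltW t0)//.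
    have -> : (e i - e j = (e i - e j).-1.+1)%N by rewrite prednK// subn_gt0.
    by rewrite exprS -[leRHS]mulr1 ler_wpM2l ?exprn_ile1 ?(ltW t0).
  rewrite big_mkcond; apply: ler_sum => i _; case: ifPn => _.
    by rewrite ler_wpM2l ?(ltW t0)// (bigD1 j)//= lerDl sumr_ge0.
  by rewrite mulr_ge0 ?(ltW t0)// sumr_ge0.
rewrite ler_norml => /andP[s1 s2]; have /andP[x0 x1] := cx j.
by apply/andP; split; lra.
Qed.

Let k_le_det A : A \in unitmx -> k A <= `|\det A|.
Proof.
move=> uA; have := cormen_lup_correct A; have := cormen_lup_perm A.
have := cormen_lup_detL A; have := @cormen_lup_lower _ n A; have := @cormen_lup_upper _ n A.
case: (cormen_lup A) => [[P L] U] /= hU hL dL /is_perm_mxP[s ->] eq.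
have AE : A = perm_mx (s^-1)%g * (L * U).
  by rewrite -eq mulrA -[_ * perm_mx s]/(_ *m _) -perm_mxM mulVg perm_mx1 mul1r.
have uL : L \in unitmx by rewrite unitmxE dL unitr1.
have dU : \det U = \prod_i U i i.
  rewrite -det_tr det_trig; first by apply: eq_bigr => i _; rewrite mxE.
  by apply/is_trig_mxP => i j ij; rewrite mxE hU.
have uU : U \in unitmx.
  move: uA; rewrite AE !unitmx_mul; case/and3P => //.
have U0 i : U i i != 0.
  by move: uU; rewrite unitmxE dU unitfE => /prodf_neq0; exact.
pose D := diag_mx (\row_i U i i : 'rV[R]_n.+1).
pose U' := \matrix_(i, j) (U i j / U i i) : 'M[R]_n.+1.
have UE : U = D * U'.
  apply/matrixP => i j; rewrite -[D * U']/(D *m U') mul_diag_mx !mxE mulrC.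
  by rewrite divfK.
have dD : \det D = \prod_i U i i by rewrite det_diag; apply: eq_bigr => i _; rewrite mxE.
have uD : D \in unitmx by rewrite unitmxE dD -dU -unitmxE.
have uU' : U' \in unitmx by move: uU; rewrite UE unitmx_mul uD.
have kU' : k U' <= 1.
  apply: (k_unitriangular (e := fun i => (n.+1 - i)%N)) => // [i|i j ij].
    by rewrite mxE divff.
  rewrite mxE => h; rewrite ltn_sub2l//.
  rewrite ltn_neqAle (inj_eq val_inj) ij /= leqNgt; apply: contraNN h => ji.
  by rewrite hU// mul0r.
have kL : k L <= 1.
  apply: (k_unitriangular (e := fun i => i : nat)) => // [i|i j ij].
    by rewrite hL// eqxx.
  move=> h; rewrite ltnNge.
  by apply: contraNN h => ji; rewrite hL// (negbTE ij).
have kD : k D <= \prod_i `|U i i|.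
  rewrite (le_trans (k_diag _))//; first by move=> i; rewrite mxE.
  by under eq_bigr do rewrite mxE.
have -> : `|\det A| = \prod_i `|U i i|.
  have dM (B C : 'M[R]_n.+1) : \det (B * C) = \det B * \det C by exact: det_mulmx.
  rewrite AE !dM dL mul1r det_perm normrM normrX.
  by rewrite normrN1 expr1n mul1r dU normr_prod.
have kU : k U <= \prod_i `|U i i| by rewrite [in leLHS]UE kM// -[leRHS]mulr1 ler_pM.
rewrite AE !kM ?unitmx_mul ?uL ?unitmx_perm//.
rewrite -[leRHS]mul1r ler_pM// ?mulr_ge0// -[leRHS]mul1r ler_pM// ?mulr_ge0//.
Qed.

(** The LUP decomposition gives only the upper bound; the lower one is the upper bound for the
    inverse, because [k (invmx A) * k A = 1]. *)
Lemma character_normr_det A : A \in unitmx -> k A = `|\det A|.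
Proof.
move=> uA; apply/eqP; rewrite eq_le k_le_det//=.
have uA' : invmx A \in unitmx by rewrite unitmx_inv.
have kk : k (invmx A) * k A = 1 by rewrite -kM// -[_ * A]/(_ *m A) mulVmx// k1.
have d0 : 0 < `|\det A| by rewrite normr_gt0 -unitfE -unitmxE.
have := ler_wpM2r (k_ge0 A) (k_le_det uA'); rewrite kk det_inv normfV.
by rewrite mulrC ler_pdivlMr// mul1r.
Qed.

End DeterminantCharacter.

Section InvariantScaling.
Context {R : realType} {n : nat}.
Notation V := 'rV[R]_n.+1.
Variable mu : {outer_measure set V -> \bar R}.
Hypothesis imu : invariant_outer mu.

Lemma mulmx_unit_inj (A : 'M[R]_n.+1) : A \in unitmx ->
  injective (fun x : V => x *m A).
Proof. by move=> uA x y /(congr1 (mulmx^~ (invmx A))); rewrite !mulmxK. Qed.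

Lemma invariant_lty_bounded (A : set V) (B : R) :
  (forall x, A x -> forall i, `|x 0 i| < B) -> (mu A < +oo)%E.
Proof.
have [B0|B0] := ltP 0 B; last first.
  move=> h; rewrite (_ : A = set0) ?outer_measure0//.
  apply/seteqP; split => // x /h/(_ 0) xB.
  by have := lt_le_trans xB B0; rewrite normr_lt0.
move=> h; apply: (@le_lt_trans _ _ (mu [set x + const_mx (- B) | x in origin_box (fun=> 2 * B)])).
  apply: le_outer_measure => x Ax; exists (x + const_mx B); last first.
    by apply/rowP => i; rewrite !mxE addrK.
  move=> i; rewrite !mxE; have := h _ Ax i; rewrite ltr_norml => /andP[h1 h2].
  by apply/andP; split; lra.
rewrite invariant_shift// invariant_origin_box//; last by move=> _; rewrite mulr_ge0// ltW.
apply: lte_mul_pinfty => //; last exact: invariant_lty.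
by rewrite lee_fin prodr_ge0// => _ _; rewrite mulr_ge0// ltW.
Qed.

Lemma invariant_image (A : 'M[R]_n.+1) : A \in unitmx ->
  invariant_outer (image_outer mu (fun x => x *m A)).
Proof.
move=> uA; split=> [v S|i b|].
- rewrite /image_outer /=.
  apply: (@le_trans _ _ (mu [set y + v *m A | y in [set x *m A | x in S]])); last first.
    by rewrite invariant_shift.
  apply: le_outer_measure => _ [_ [x Sx <-] <-]; exists (x *m A); first by exists x.
  by rewrite mulmxDl.
- apply: image_outer_caratheodory; first exact: mulmx_unit_inj.
  apply: caratheodory_open; first exact: invariant_half.
  apply: open_mulmx => //.
  apply: (@open_comp _ _ (fun x : V => x 0 i) [set y | y < b]); last exact: open_lt.
  by move=> x _; exact: coord_continuous.
- rewrite /image_outer; apply: (@invariant_lty_bounded _ (\sum_i \sum_j `|A i j| + 1)).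
  move=> _ [x cx <-] j; rewrite mxE (le_lt_trans (ler_norm_sum _ _ _))// ltr_pwDr//.
  apply: ler_sum => i _; have /andP[x0 x1] := cx i.
  rewrite normrM ger0_norm// (bigD1 j)//= (le_trans (ler_piMl _ (ltW x1)))//.
  by rewrite lerDl sumr_ge0.
Qed.

Hypothesis mu_gt0 : (0 < mu unit_cube)%E.

Let c := fine (mu unit_cube).

Let muc : mu unit_cube = c%:E.
Proof. by rewrite fineK// ge0_fin_numE ?(invariant_lty imu). Qed.

Let c_gt0 : 0 < c.
Proof. by rewrite -lte_fin -muc. Qed.

Let k (A : 'M[R]_n.+1) := fine (mu [set x *m A | x in unit_cube]) / c.

Let kE (A : 'M[R]_n.+1) (S : set V) : A \in unitmx -> open S -> mu [set x *m A | x in S] = ((k A)%:E * mu S)%E.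
Proof.
move=> uA oS; have iA := invariant_image uA.
have := invariant_unique imu iA oS; rewrite muc /image_outer => h.
have fA : mu [set x *m A | x in unit_cube] \is a fin_num.
  by rewrite ge0_fin_numE//; exact: invariant_lty iA.
rewrite /k mulrC EFinM fineK// -muleA h muleA -EFinM mulVf ?mul1e//.
by rewrite gt_eqF.
Qed.

(** [kE] is available for open sets only, and the half-open [unit_cube] is not one. The set [O] is
    open with finite positive content, so multiplicativity of [k] is obtained by evaluating both
    sides on it and cancelling. *)
Let O : set V := [set x | forall i, `|x 0 i| < 1].

Let open_O : open O.
Proof.
rewrite openE => x Ox; apply: nbhs_rV_forall => i.
suff : nbhs (x 0 i) [set y | `|y| < 1] by move=> /(@coord_continuous R 1 n.+1 0 i x).
apply: open_nbhs_nbhs; split; last exact: Ox.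
apply: (@open_comp _ _ (fun y : R => `|y|) [set y | y < 1]); last exact: open_lt.
by move=> y _; exact: norm_continuous.
Qed.

Let muO : exists2 b, 0 < b & mu O = b%:E.
Proof.
have fO : mu O \is a fin_num.
  by rewrite ge0_fin_numE//; apply: (@invariant_lty_bounded _ 1).
exists (fine (mu O)); last by rewrite fineK.
rewrite -lte_fin fineK//; apply: (lt_le_trans mu_gt0); apply: le_outer_measure => x cx i.
by have /andP[x0 x1] := cx i; rewrite ger0_norm.
Qed.

Lemma invariant_det (A : 'M[R]_n.+1) (S : set V) : A \in unitmx -> open S ->
  mu [set x *m A | x in S] = (`|\det A|%:E * mu S)%E.
Proof.
move=> uA oS; rewrite kE//; congr (_%:E * _)%E; apply: (character_normr_det (k := k)) => //.
- rewrite /k (_ : [set x *m 1 | x in unit_cube] = unit_cube).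
    by rewrite -/c divff// gt_eqF.
  by apply/seteqP; split=> [_ [x cx <-]|x cx]; [rewrite mulmx1|exists x; rewrite ?mulmx1].
- by move=> B; rewrite /k divr_ge0 ?fine_ge0 ?outer_measure_ge0 ?(ltW c_gt0).
- move=> B C uB uC; have [b b0 mb] := muO.
  have : mu [set x *m (B * C) | x in O] = (k C * k B * b)%:E.
    have -> : [set x *m (B * C) | x in O] = [set y *m C | y in [set x *m B | x in O]].
      by rewrite image_comp; congr image; apply/funext => x /=; rewrite mulmxA.
    rewrite kE//; last exact: open_mulmx.
    by rewrite kE// mb -!EFinM mulrA.
  rewrite kE ?unitmx_mul ?uB// mb -EFinM => -[]; move/mulIf => ->; first exact: mulrC.
  by rewrite gt_eqF.
- move=> B a l uB l0 h; rewrite /k ler_pdivrMr// -lee_fin fineK; last first.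
    by rewrite ge0_fin_numE//; exact: (invariant_lty (invariant_image uB)).
  rewrite EFinM -muc -invariant_origin_box// -(invariant_shift imu (\row_i a i) (origin_box _)).
  apply: le_outer_measure => _ [x cx <-]; exists (x *m B - \row_i a i); last by rewrite subrK.
  by move=> i; have := h x cx i; rewrite !mxE subr_ge0 ltrBlDl.
Qed.

End InvariantScaling.

Section InvariantHyperplane.
Context {R : realType} {n : nat}.
Notation V := 'rV[R]_n.+1.

(** The part of the hyperplane within distance [N%:R] of the coordinate axes' origin, in each
    coordinate, lies in a slab of thickness [d] and content [d * B]; the choice [d = e / (B + 1)]
    makes this at most [e]. Countably many such parts exhaust the hyperplane. *)
Let coordinate_hyperplane (mu : {outer_measure set V -> \bar R}) b :
  invariant_outer mu -> mu [set x : V | x 0 0 = b] = 0%E.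
Proof.
move=> imu; pose P N : set V := [set x | x 0 0 = b /\ forall i, `|x 0 i| < N%:R].
have fc : mu unit_cube \is a fin_num by rewrite ge0_fin_numE ?(invariant_lty imu).
have P0 N : mu (P N) = 0%E.
  apply/eqP; rewrite eq_le outer_measure_ge0 andbT; apply/lee_addgt0Pr => e e0.
  rewrite add0e; pose B : R := (2 * N%:R) ^+ n * fine (mu unit_cube).
  have B0 : 0 <= B by rewrite mulr_ge0 ?fine_ge0// exprn_ge0// mulr_ge0.
  have B1 : 0 < B + 1 by rewrite ltr_wpDl.
  pose d := e / (B + 1); have d0 : 0 < d by rewrite divr_gt0.
  pose l (i : 'I_n.+1) := if i == 0 then d else 2 * N%:R.
  have l0 i : 0 <= l i by rewrite /l; case: ifP => _; [exact: ltW|exact: mulr_ge0].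
  apply: (@le_trans _ _ (mu [set x + \row_i (if i == 0 then b else - N%:R) | x in origin_box l])).
    apply: le_outer_measure => x [xb xN].
    exists (x - \row_i (if i == 0 then b else - N%:R)); last by rewrite subrK.
    move=> i; rewrite !mxE /l; case: eqP => [->|_]; first by rewrite xb subrr lexx.
    by have := xN i; rewrite ltr_norml => /andP[h1 h2]; apply/andP; split; lra.
  rewrite invariant_shift// invariant_origin_box// -(fineK fc) -EFinM lee_fin.
  rewrite (bigD1 0)//= {1}/l eqxx (eq_bigr (fun=> 2 * N%:R)); last first.
    by move=> i /negbTE i0; rewrite /l i0.
  rewrite prodr_const (_ : #|_| = n); last by rewrite cardC1 card_ord.
  rewrite -mulrA -/B /d mulrAC ler_pdivrMr// ler_pM2l// lerDl; exact: ler01.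
apply/eqP; rewrite eq_le outer_measure_ge0 andbT.
apply: (@le_trans _ _ (mu (\bigcup_N P N))).
  apply: le_outer_measure => x xb.
  exists (Num.truncn (\sum_i `|x 0 i|)).+1 => //; split=> // i.
  apply: le_lt_trans (truncnS_gt _); rewrite (bigD1 i)//= lerDl; exact: sumr_ge0.
rewrite (le_trans (outer_measure_sigma_subadditive mu P))// eseries0//.
Qed.

(** [row_ebase h] is an invertible matrix whose first row is proportional to [h]. In the coordinates
    it defines, the hyperplane fixes the first coordinate, and the transported measure is again
    invariant. *)
Lemma invariant_hyperplane (mu : {outer_measure set V -> \bar R}) (h : V) b :
  invariant_outer mu -> h != 0 -> mu [set x | dotv h x = b] = 0%E.
Proof.
move=> imu h0; have rh : \rank h = 1%N by apply/eqP; rewrite rank_rV h0.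
have uE := row_ebase_unit h; have uC := col_ebase_unit h.
pose E := row_ebase h; pose c := col_ebase h 0 0.
have c0 : c != 0.
  by move: uC; rewrite unitmxE det_mx11 unitfE.
have hE : h = c *: row 0 E.
  rewrite -{1}(mulmx_ebase h) rh (mx11_scalar (col_ebase h)) -/c mul_scalar_mx -scalemxAl.
  congr (_ *: _); rewrite rowE; congr (_ *m _); apply/matrixP => i j.
  by rewrite !ord1 !mxE /=; case: j => -[|j] hj.
pose A := (invmx E)^T; have uA : A \in unitmx by rewrite unitmx_tr unitmx_inv.
have -> : [set x | dotv h x = b] = [set y *m A | y in [set y : V | y 0 0 = b / c]].
  have hA (y : V) : dotv h (y *m A) = c * y 0 0.
    rewrite dotvE hE -scalemxAl mxE trmx_mul trmxK mulmxA -row_mul mulmxV//.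
    by rewrite row1 -rowE !mxE.
  apply/seteqP; split=> [x <-|_ [y yb <-]] /=; last by rewrite hA yb mulrC divfK.
  exists (x *m invmx A); last by rewrite mulmxKV.
  by rewrite /= -{2}(mulmxKV uA x) hA mulrC mulKf.
exact: (coordinate_hyperplane _ (invariant_image imu uA)).
Qed.

End InvariantHyperplane.

(** * Lebesgue measure as an invariant outer measure *)

Section BoxCover.
Context {R : realType}.

Definition in_box (d : nat) (a b x : 'I_d -> R) : bool := [forall i, a i <= x i < b i].

Definition box_side (a b : R) : R := Num.max 0 (b - a).

Lemma box_side_ge0 a b : 0 <= box_side a b.
Proof. by rewrite le_max lexx. Qed.

Lemma lebesgue_measure_box_side (a b : R) : lebesgue_measure `[a, b[ = (box_side a b)%:E.
Proof.
rewrite lebesgue_measure_itv /= lte_fin /box_side; case: ltP => ab.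
  by rewrite max_r// subr_ge0 ltW.
by rewrite max_l// subr_le0.
Qed.

Lemma box_side_split u v b :
  box_side u v = box_side u (Num.min v b) + box_side (Num.max u b) v.
Proof.
by rewrite /box_side; case: (leP v b) => h1; case: (leP u b) => h2;
  case: (leP 0 (v - u)) => h3; do 2? case: (leP 0 _) => ?; lra.
Qed.

(* By induction on [d], integrating the first coordinate out; the weights [w] record
   which boxes are still met once the preceding coordinates have been fixed. *)
Lemma box_cover_ge1 (d : nat) (a b : nat -> 'I_d -> R) (w : nat -> R) :
  (forall k, 0 <= w k) ->
  (forall x : 'I_d -> R, (forall i, 0 <= x i < 1) ->
    (1%:E <= \sum_(k <oo) (w k * (in_box (a k) (b k) x)%:R)%:E)%E) ->
  (1%:E <= \sum_(k <oo) (w k * \prod_i box_side (a k i) (b k i))%:E)%E.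
Proof.
elim: d a b w => [|d IH] a b w w0 h.
  have := h (fun=> 0) (fun i => False_ind _ (match i with Ordinal _ p => elimF idP (ltn0 _) p end)).
  congr (_ <= _)%E; apply: eq_eseriesr => k _; rewrite big_ord0.
  by rewrite (_ : in_box _ _ _ = true)//; apply/forallP => -[].
pose p k := \prod_(i < d) box_side (a k (lift ord0 i)) (b k (lift ord0 i)).
have p0 k : 0 <= p k by apply: prodr_ge0 => i _; exact: box_side_ge0.
pose g k (s : R) : \bar R := ((w k * p k) * \1_(`[a k ord0, b k ord0[) s)%:E.
have g0 k s : (0 <= g k s)%E by rewrite lee_fin mulr_ge0// mulr_ge0.
have mg k D : measurable_fun D (g k).
  apply/measurable_EFinP; exact: measurable_funM.
have slice s : 0 <= s < 1 -> (1%:E <= \sum_(k <oo) g k s)%E.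
  move=> s01; pose w' k := w k * (a k ord0 <= s < b k ord0)%R%:R.
  have := IH (fun k i => a k (lift ord0 i)) (fun k i => b k (lift ord0 i)) w'.
  have -> : (\sum_(k <oo) (w' k * \prod_i box_side (a k (lift ord0 i)) (b k (lift ord0 i)))%:E =
      \sum_(k <oo) g k s)%E.
    apply: eq_eseriesr => k _; rewrite /g /w' -/(p k) mulrAC; congr (_ * _ * _)%:E.
    by rewrite indicE; congr (_%:R); rewrite mem_setE in_itv.
  apply=> [k|x x01]; first by rewrite mulr_ge0.
  pose x' (i : 'I_d.+1) := oapp x s (unlift ord0 i).
  have := h x' (fun i => _); rewrite /x'.
  have x'01 i : 0 <= oapp x s (unlift ord0 i) < 1 by case: unliftP => [j|] _ /=.
  move=> /(_ x'01); congr (_ <= _)%E; apply: eq_eseriesr => k _; rewrite /w' -mulrA.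
  congr (_ * _)%:E; rewrite -natrM mulnb; congr (nat_of_bool _)%:R.
  apply/forallP/andP => [hx|[h1 /forallP h2] i].
    split; first by have := hx ord0; rewrite unlift_none.
    by apply/forallP => i; have := hx (lift ord0 i); rewrite liftK.
  by case: unliftP => [j ->|->] //=; exact: h2.
have mI : measurable (`[0, 1[%classic : set R) by exact: measurable_itv.
have : (\int[lebesgue_measure]_(s in `[0%R, 1%R[) 1 <=
    \int[lebesgue_measure]_(s in `[0%R, 1%R[) \sum_(k <oo) g k s)%E.
  apply: ge0_le_integral => //.
  - by apply: (@ge0_emeasurable_sum _ _ _ _ g xpredT).
rewrite integral_cst// mul1e [X in (X <= _)%E -> _](_ : _ = 1%E); last first.
  by rewrite [LHS]lebesgue_measure_box_side /box_side subr0 max_r.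
move=> h1; apply: (le_trans h1).
have h2 := integral_nneseries lebesgue_measure mI (fun k => mg k _) (fun k s _ => g0 k s).
rewrite [leLHS]h2.
apply: lee_nneseries => k _; first by move=> _; apply: integral_ge0.
apply: (@le_trans _ _ (\int[lebesgue_measure]_(s in setT) g k s)%E).
  have h3 := @ge0_subset_integral _ _ R lebesgue_measure _ _ mI measurableT _ (mg k _).
  by apply: h3.
have -> : (\int[lebesgue_measure]_(s in setT) g k s =
    (w k * p k)%:E * \int[lebesgue_measure]_(s in setT) (\1_(`[a k ord0, b k ord0[) s)%:E)%E.
  rewrite -ge0_integralZl ?lee_fin ?mulr_ge0//.
  exact/measurable_EFinP/measurable_indic.
rewrite integral_indic// setIT [X in (_ * X <= _)%E]lebesgue_measure_box_side -EFinM lee_fin.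
by rewrite big_ord_recl -mulrA (mulrC (p k)).
Qed.

End BoxCover.

Section VolumeInvariant.
Context {R : realType} {n : nat}.
Notation V := 'rV[R]_n.+1.

Let box_volume_ge0 (ab : V * V) : (0 <= box_volume ab)%E.
Proof. by rewrite lee_fin; apply: prodr_ge0 => i _; exact: box_side_ge0. Qed.

Lemma volume_unit_cube_ge1 : (1%:E <= volume (unit_cube : set V))%E.
Proof.
apply: le_ereal_inf_tmp => _ [F [_ cF] <-].
have := @box_cover_ge1 R n.+1 (fun k i => (F k).1 0 i) (fun k i => (F k).2 0 i) (fun=> 1).
under eq_eseriesr do rewrite mul1r.
apply=> // x x01; pose y : V := \row_i x i.
have [k _ Fky] : (\bigcup_k box (F k)) y by apply: cF => i; rewrite mxE.
apply: le_trans (nneseries_lim_ge k.+1 _); last by move=> j _ _; rewrite lee_fin mulr_ge0.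
rewrite big_nat_recr//= -[leLHS]add0e leeD//.
  by apply: sume_ge0 => j _; rewrite lee_fin mulr_ge0.
rewrite mul1r (_ : in_box _ _ _ = true)//; apply/forallP => i.
by have := Fky i; rewrite mxE.
Qed.

Lemma volume_invariant : invariant_outer (volume : {outer_measure set V -> \bar R}).
Proof.
split=> [v A|i b|].
- apply: le_ereal_inf_tmp => _ [F [_ AF] <-].
  apply: ereal_inf_lbound; exists (fun k => ((F k).1 + v, (F k).2 + v)).
    split=> // _ [x /AF[k _ Fkx] <-]; exists k => // i.
    by rewrite /= !mxE lerD2r ltrD2r.
  apply: eq_eseriesr => k _; congr (_%:E); apply: eq_bigr => i _.
  by rewrite !mxE opprD addrACA subrr addr0.
- apply: le_caratheodory_measurable => X.
  apply: le_ereal_inf_tmp => _ [F [_ XF] <-].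
  (* Each box of the cover is cut at [x 0 i = b]. The volumes of the two halves add up exactly, so
     they cover the two parts of [X] at no extra cost. *)
  pose F1 k : V * V := ((F k).1, \row_j if j == i then Num.min ((F k).2 0 j) b else (F k).2 0 j).
  pose F2 k : V * V := (\row_j (if j == i then Num.max ((F k).1 0 j) b else (F k).1 0 j), (F k).2).
  have -> : (\sum_(k <oo) box_volume (F k) =
      \sum_(k <oo) box_volume (F1 k) + \sum_(k <oo) box_volume (F2 k))%E.
    rewrite -nneseriesD//; apply: eq_eseriesr => k _; rewrite -EFinD; congr _%:E.
    rewrite !(bigD1 i (P := predT))//= !mxE eqxx.
    set p := \prod_(_ < _ | _) _; set p1 := \prod_(_ < _ | _) _; set p2 := \prod_(_ < _ | _) _.
    have -> : p1 = p by apply: eq_bigr => j /negbTE ji; rewrite mxE ji.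
    have -> : p2 = p by apply: eq_bigr => j /negbTE ji; rewrite mxE ji.
    rewrite -mulrDl; congr (_ * _); set u := (F k).1 0 i; set v := (F k).2 0 i.
    exact: box_side_split.
  apply: leeD; apply: ereal_inf_lbound.
    exists F1 => //; split => // x [/XF[k _ Fkx] xb]; exists k => // j.
    by rewrite mxE /=; case: eqP => [->|_]; [rewrite lt_min andbA Fkx xb|exact: Fkx].
  exists F2 => //; split => // x [/XF[k _ Fkx] /= /negP xb]; exists k => // j.
  rewrite mxE /=; case: eqP => [->|_]; last exact: Fkx.
  by rewrite ge_max (leNgt b) xb andbT; exact: Fkx.
- apply: (@le_lt_trans _ _ 1%:E); last exact: ltry.
  apply: ereal_inf_lbound.
  exists (fun k => if k == 0%N then (0, const_mx 1) else (0, 0)) => /=.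
    by split=> // x cx; exists 0%N => // i; rewrite /= !mxE; exact: cx.
  rewrite (nneseries_split 0 1); last by move=> k _; exact: box_volume_ge0.
  rewrite big_nat1 /= eseries0; last first.
    by case=> //= k _ _; rewrite /box_volume /= (bigD1 0)//= mxE subrr maxxx mul0r.
  rewrite adde0.
  rewrite /box_volume big1// => i _ /=; rewrite !mxE subr0 max_r//.
Qed.

Lemma volume_gt0 : (0 < volume (unit_cube : set V))%E.
Proof. exact: lt_le_trans (volume_unit_cube_ge1). Qed.

End VolumeInvariant.

(** * Hausdorff measure: isometries, measurability of half-spaces, nontriviality *)

Section HausdorffBasics.
Context {R : realType} {p : nat}.
Notation V := 'rV[R]_p.+1.
Implicit Types (A B : set V).

Lemma ball_volume_gt0 s : 0 < ball_volume (R:=R) s.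
Proof.
suff : 0 < ball_volume (R:=R) s /\ 0 < ball_volume (R:=R) s.+1 by case.
elim: s => [|s [h1 h2]]; first by split => //=; rewrite ltr0n.
by split => //; rewrite /= mulr_gt0// divr_gt0// mulr_gt0// pi_gt0.
Qed.

Lemma ler_abs_enorm (x : V) i : `|x 0 i| <= enorm x.
Proof.
rewrite -sqrtr_sqr ler_wsqrtr// /dotv (bigD1 i)//= -expr2 lerDl.
by apply: sumr_ge0 => j _; rewrite -expr2 sqr_ge0.
Qed.

Lemma ler_diam A x y : A x -> A y -> ((enorm (x - y))%:E <= diam A)%E.
Proof. by move=> Ax Ay; apply: ereal_sup_ubound; exists (x, y). Qed.

Lemma diam_le A (d : \bar R) : (forall x y, A x -> A y -> ((enorm (x - y))%:E <= d)%E) ->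
  (diam A <= d)%E.
Proof. by move=> h; apply: ge_ereal_sup => _ [[x y] [/= Ax Ay] <-]; exact: h. Qed.

Lemma diam_ge0 A : A !=set0 -> (0 <= diam A)%E.
Proof.
move=> [x Ax]; apply: le_trans (ler_diam Ax Ax).
by rewrite lee_fin enorm_ge0.
Qed.

Lemma hausdorff_weight_ge0 s A : (0 <= hausdorff_weight s A)%E.
Proof.
rewrite /hausdorff_weight; case: ifPn => // /set0P A0; rewrite lee_fin.
by rewrite mulr_ge0 ?(ltW (ball_volume_gt0 _))// exprn_ge0// divr_ge0// fine_ge0// diam_ge0.
Qed.

Lemma hausdorff_weight_le s A (d : R) : (diam A <= d%:E)%E -> 0 <= d ->
  (hausdorff_weight s A <= (ball_volume s * (d / 2) ^+ s)%:E)%E.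
Proof.
move=> Ad d0; rewrite /hausdorff_weight; case: ifPn => [_|/set0P A0].
  by rewrite lee_fin mulr_ge0 ?(ltW (ball_volume_gt0 _))// exprn_ge0// divr_ge0.
have dA := diam_ge0 A0.
have fA : diam A \is a fin_num by rewrite ge0_fin_numE//; exact: le_lt_trans Ad (ltry _).
rewrite lee_fin ler_wpM2l ?(ltW (ball_volume_gt0 _))// lerXn2r ?nnegrE ?divr_ge0//.
  by rewrite fine_ge0.
by rewrite ler_wpM2r// -lee_fin fineK.
Qed.

Lemma hausdorff_pre_le s d A : 0 < d -> (hausdorff_pre s d A <= hausdorff s A)%E.
Proof. by move=> d0; apply: ereal_sup_ubound; exists d. Qed.

Lemma le_hausdorff_pre s d d' A : d <= d' -> (hausdorff_pre s d' A <= hausdorff_pre s d A)%E.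
Proof.
move=> dd'; apply/ereal_inf_le_tmp => x [F [Fd AF] <-]; exists F => //; split => // k.
by apply: le_trans (Fd k) _; rewrite lee_fin.
Qed.

End HausdorffBasics.

(** The bound [d] keeps both diameters finite; as [fine] sends [+oo] to 0, the weight would not be
    monotone otherwise. *)
Lemma hausdorff_weight_mono (R : realType) (p q s : nat) (A : set 'rV[R]_p.+1)
    (B : set 'rV[R]_q.+1) (d : R) :
  (A !=set0 -> B !=set0) -> (diam A <= diam B)%E -> (diam B <= d%:E)%E ->
  (hausdorff_weight s A <= hausdorff_weight s B)%E.
Proof.
move=> AB dAB Bd; rewrite {1}/hausdorff_weight; case: ifPn => [_|/set0P A0].
  exact: hausdorff_weight_ge0.
have B0 := AB A0; rewrite /hausdorff_weight ifF; last by apply/negbTE/set0P.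
have dA := diam_ge0 A0; have dB := diam_ge0 B0.
have fB : diam B \is a fin_num by rewrite ge0_fin_numE//; exact: le_lt_trans Bd (ltry _).
have fA : diam A \is a fin_num.
  by rewrite ge0_fin_numE//; apply: le_lt_trans dAB _; rewrite -ge0_fin_numE.
rewrite lee_fin ler_wpM2l ?(ltW (ball_volume_gt0 _))// lerXn2r ?nnegrE ?divr_ge0 ?fine_ge0//.
by rewrite ler_wpM2r// fine_le.
Qed.

Lemma hausdorff_lipschitz (R : realType) (p q s : nat) (A : set 'rV[R]_p.+1)
    (f : 'rV[R]_p.+1 -> 'rV[R]_q.+1) :
  (forall x y, A x -> A y -> enorm (f x - f y) <= enorm (x - y)) ->
  (hausdorff s [set f x | x in A] <= hausdorff s A)%E.
Proof.
move=> fL; apply: ge_ereal_sup => _ [d d0 <-].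
apply: le_trans (hausdorff_pre_le s A d0).
apply: le_ereal_inf_tmp => _ [F [Fd AF] <-].
pose F' k := [set f x | x in F k `&` A].
have dF k : (diam (F' k) <= diam (F k))%E.
  apply: diam_le => _ _ [x [Fx Ax] <-] [y [Fy Ay] <-].
  by apply: le_trans (ler_diam Fx Fy); rewrite lee_fin fL.
apply: (@le_trans _ _ (\sum_(k <oo) hausdorff_weight s (F' k))%E).
  apply: ereal_inf_lbound; exists F' => //; split=> [k|_ [x Ax <-]].
    exact: le_trans (dF k) (Fd k).
  by have [k _ Fkx] := AF _ Ax; exists k => //; exists x.
apply: lee_nneseries => k _; first by move=> _; exact: hausdorff_weight_ge0.
apply: (@hausdorff_weight_mono _ _ _ _ _ _ d) => //; last exact: Fd.
by move=> [_ [x [Fx _] _]]; exists x.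
Qed.

Lemma hausdorff_isometry (R : realType) (p q s : nat) (A : set 'rV[R]_p.+1)
    (f : 'rV[R]_p.+1 -> 'rV[R]_q.+1) :
  (forall x y, A x -> A y -> enorm (f x - f y) = enorm (x - y)) ->
  hausdorff s [set f x | x in A] = hausdorff s A.
Proof.
move=> fI; apply/eqP; rewrite eq_le; apply/andP; split.
  by apply: hausdorff_lipschitz => x y Ax Ay; rewrite fI.
have [->|/set0P[x0 Ax0]] := eqVneq A set0; first by rewrite [leLHS]outer_measure0 outer_measure_ge0.
pose g y := xget x0 [set x | A x /\ f x = y].
have gK y : [set f x | x in A] y -> A (g y) /\ f (g y) = y.
  move=> [x Ax fx]; rewrite /g; case: xgetP => [z -> //|h].
  by have := h x; case.
have {1}-> : A = [set g y | y in [set f x | x in A]].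
  apply/seteqP; split=> [x Ax|_ [y fAy <-]]; last by have [] := gK y fAy.
  exists (f x); first by exists x.
  have [Ag fg] := gK (f x) (ex_intro2 _ _ x Ax erefl).
  apply/eqP; rewrite -subr_eq0 -dotv_eq0 -enorm_sqr -(fI _ _ Ag Ax) fg subrr.
  by rewrite enorm_sqr dotv0.
apply: hausdorff_lipschitz => y y' fy fy'.
have [Ag fg] := gK y fy; have [Ag' fg'] := gK y' fy'.
by rewrite -(fI _ _ Ag Ag') fg fg'.
Qed.

Section HausdorffMetric.
Context {R : realType} {p : nat}.
Notation V := 'rV[R]_p.+1.
Implicit Types (A B X : set V).

(** A set of diameter at most [d < rho] meets at most one of [A] and [B]. Intersecting a cover of
    the union with [A] and with [B] thus gives two covers whose weights together do not exceed the
    original one. *)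
Let hausdorff_pre_separated s d rho A B : d < rho ->
  (forall x y, A x -> B y -> rho <= enorm (x - y)) ->
  (hausdorff_pre s d A + hausdorff_pre s d B <= hausdorff_pre s d (A `|` B))%E.
Proof.
move=> drho sep; apply: le_ereal_inf_tmp => _ [F [Fd ABF] <-].
have sub (C : set V) k : (diam (F k `&` C) <= diam (F k))%E.
  by apply: diam_le => x y [Fx _] [Fy _]; exact: ler_diam.
have cov (C : set V) : C `<=` A `|` B ->
    (hausdorff_pre s d C <= \sum_(k <oo) hausdorff_weight s (F k `&` C))%E.
  move=> CAB; apply: ereal_inf_lbound; exists (fun k => F k `&` C) => //; split=> [k|x Cx].
    exact: le_trans (sub _ _) (Fd k).
  by have [k _ Fx] := ABF x (CAB x Cx); exists k.
apply: le_trans (leeD (cov A _) (cov B _)) _; [by left|by right|].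
rewrite -nneseriesD; try by move=> *; exact: hausdorff_weight_ge0.
apply: lee_nneseries => k _.
  by move=> _; rewrite adde_ge0// hausdorff_weight_ge0.
have mono C : (hausdorff_weight s (F k `&` C) <= hausdorff_weight s (F k))%E.
  apply: (@hausdorff_weight_mono _ _ _ _ _ _ d); [|exact: sub|exact: Fd].
  by move=> [x [Fx _]]; exists x.
have w0 : hausdorff_weight s (set0 : set V) = 0%E by rewrite /hausdorff_weight eqxx.
have [->|/set0P[x [Fx Ax]]] := eqVneq (F k `&` A) set0; first by rewrite w0 add0e.
have [->|/set0P[y [Fy By]]] := eqVneq (F k `&` B) set0; first by rewrite w0 adde0.
have := le_trans (ler_diam Fx Fy) (Fd k); rewrite lee_fin => xyd.
by have := le_lt_trans (le_trans (sep _ _ Ax By) xyd) drho; rewrite ltxx.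
Qed.

Lemma hausdorff_separated s rho A B : 0 < rho ->
  (forall x y, A x -> B y -> rho <= enorm (x - y)) ->
  (hausdorff s A + hausdorff s B <= hausdorff s (A `|` B))%E.
Proof.
move=> rho0 sep; have [->|ABoo] := eqVneq (hausdorff s (A `|` B)) +oo%E; first exact: leey.
have fin (C : set V) : C `<=` A `|` B -> hausdorff s C \is a fin_num.
  move=> CAB; rewrite ge0_fin_numE ?outer_measure_ge0//.
  by apply: (@le_lt_trans _ _ (hausdorff s (A `|` B))); [exact: le_outer_measure|rewrite ltey].
have fA : hausdorff s A \is a fin_num by apply: fin; left.
have fB : hausdorff s B \is a fin_num by apply: fin; right.
apply/lee_addgt0Pr => e e0; have e20 : 0 < e / 2 by rewrite divr_gt0.
have [_ [d1 d10 <-] h1] := ub_ereal_sup_adherent e20 fA.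
have [_ [d2 d20 <-] h2] := ub_ereal_sup_adherent e20 fB.
pose d := Num.min (Num.min d1 d2) (rho / 2).
have d0 : 0 < d by rewrite !lt_min d10 d20 divr_gt0.
have dd1 : d <= d1 by rewrite !ge_min lexx.
have dd2 : d <= d2 by rewrite !ge_min lexx orbT.
have drho : d < rho.
  apply: (@le_lt_trans _ _ (rho / 2)); first by rewrite ge_min lexx orbT.
  by rewrite ltr_pdivrMr// ltr_pMr// ltr1n.
apply: (@le_trans _ _ ((hausdorff_pre s d A + (e / 2)%:E) + (hausdorff_pre s d B + (e / 2)%:E))%E).
  apply: leeD; rewrite -leeBlDr//.
    exact: le_trans (ltW h1) (le_hausdorff_pre _ _ dd1).
  exact: le_trans (ltW h2) (le_hausdorff_pre _ _ dd2).
rewrite addeACA -EFinD -splitr leeD2r// (le_trans (hausdorff_pre_separated _ drho sep))//.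
exact: hausdorff_pre_le.
Qed.

(* Caratheodory's criterion for a metric outer measure: the distances between consecutive
   members of the increasing sequence of half-spaces [dotv h x <= b - k.+1^-1] are positive. *)
Lemma hausdorff_half s (h : V) b : (hausdorff s).-caratheodory [set x | dotv h x < b].
Proof.
apply: le_caratheodory_measurable => X.
pose B := [set x : V | dotv h x < b].
suff : (hausdorff s (X `&` B) + hausdorff s (X `&` ~` B) <= hausdorff s X)%E by [].
have [->|Xoo] := eqVneq (hausdorff s X) +oo%E; first exact: leey.
have fX : hausdorff s X \is a fin_num by rewrite ge0_fin_numE ?outer_measure_ge0// ltey.
pose c k : R := b - k.+1%:R^-1.
have c_lt k : c k < c k.+1 by rewrite ltrD2l ltrN2 ltf_pV2 ?posrE ?ltr0n// ltr_nat.
have c_mono : {homo c : i j / (i <= j)%N >-> i <= j}.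
  by apply: homo_leq => [|? ? ?|k]; [exact: lexx|exact: le_trans|exact: ltW].
have cb k : c k < b by rewrite ltrBlDr ltrDl invr_gt0 ltr0n.
pose S k := X `&` [set x | dotv h x <= c k].
pose T k := X `&` [set x | c k.+1 < dotv h x <= c k.+2].
pose M := \sum_i `|h 0 i| + 1.
have M0 : 0 < M by rewrite ltr_wpDl// sumr_ge0.
have sep (a a' : R) (A A' : set V) : a < a' -> (forall x, A x -> dotv h x <= a) ->
    (forall x, A' x -> a' <= dotv h x) ->
    (hausdorff s A + hausdorff s A' <= hausdorff s (A `|` A'))%E.
  move=> aa' Aa Aa'; apply: (@hausdorff_separated s ((a' - a) / M)).
    by rewrite divr_gt0// subr_gt0.
  move=> x y /Aa xa /Aa' ya; rewrite ler_pdivrMr//.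
  have := @ler_norm_dotv _ _ h (x - y) (enorm (x - y)) (ler_abs_enorm _).
  rewrite dotvBr ler_norml => /andP[h1 _].
  have := enorm_ge0 (x - y); rewrite /M => h2; nra.
have leX (A : set V) : A `<=` X -> (hausdorff s A <= hausdorff s X)%E by exact: le_outer_measure.
(* Adjacent layers may touch, but [T N] is separated from [S N], and both lie in [S N.+2]. Keeping
   two consecutive [S] terms makes the induction advance by two, so that layers of equal parity are
   added up. *)
have sT N : (\sum_(0 <= j < N) hausdorff s (T j) <= hausdorff s (S N) + hausdorff s (S N.+1))%E.
  elim: N => [|N IH]; first by rewrite big_geq// adde_ge0// outer_measure_ge0.
  rewrite big_nat_recr//= (le_trans (leeD2r _ IH))// addeAC addeC leeD2l//.
  apply: (le_trans (sep (c N) (c N.+1) _ _ (c_lt N) _ _)); first by move=> x [].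
    by move=> x [_ /andP[/ltW]].
  apply: le_outer_measure => x [[Xx /= xc]|[Xx /andP[_ xc]]]; split=> //.
  exact: le_trans xc (c_mono _ _ (leq_trans (leqnSn _) (leqnSn _))).
have Tfin : (\sum_(j <oo) hausdorff s (T j) < +oo)%E.
  apply: (@le_lt_trans _ _ (hausdorff s X + hausdorff s X)%E); last first.
    by rewrite lte_add_pinfty// -ge0_fin_numE ?outer_measure_ge0.
  apply: lime_le; first by apply: is_cvg_nneseries => *; exact: outer_measure_ge0.
  by apply: nearW => N; rewrite (le_trans (sT N))// leeD// leX// => x [].
have main k : (hausdorff s (X `&` B) + hausdorff s (X `&` ~` B) <=
    hausdorff s X + \sum_(k <= j <oo) hausdorff s (T j))%E.
  (* The set [S k.+1] is separated from the complement of [B], and the layers beyond it have small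
     total measure, being the tail of a convergent series. *)
  have XB : X `&` B `<=` S k.+1 `|` \bigcup_(j in ~` `I_k) T j.
    move=> x [Xx /= xb].
    have ex : exists m, dotv h x <= c m.
      have bx : 0 < b - dotv h x by rewrite subr_gt0.
      exists (Num.truncn (b - dotv h x)^-1); rewrite lerBrDr -lerBrDl.
      rewrite invf_ple ?posrE//; exact/ltW/truncnS_gt.
    case: (ex_minnP ex) => m xm mmin.
    have [mk|km] := leqP m k.+1; first by left; split=> //=; exact: le_trans xm (c_mono _ _ mk).
    right; move: km xm mmin; case: m => [//|[//|m]] km xm mmin; exists m.
      by apply/negP; rewrite -leqNgt; exact: km.
    split=> //=; rewrite xm andbT ltNge; apply/negP => /mmin; rewrite ltnn//.
  apply: (@le_trans _ _ ((hausdorff s (S k.+1) + \sum_(k <= j <oo) hausdorff s (T j)) +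
      hausdorff s (X `&` ~` B))%E).
    rewrite leeD2r// (le_trans (le_outer_measure _ _ _ XB))//.
    rewrite (le_trans (outer_measureU2 _ _ _))// leeD2l//.
    exact: outer_measure_sigma_subadditive_tail.
  rewrite addeAC leeD2r// (le_trans (sep (c k.+1) b _ _ (cb _) _ _))//.
  - by move=> x [].
  - by move=> x [_ /= /negP]; rewrite -leNgt.
  - by apply: leX => x [[]|[]].
have cv : (hausdorff s X + \sum_(k <= j <oo) hausdorff s (T j))%E @[k --> \oo] -->
    (hausdorff s X + 0)%E.
  apply: cvgeD; [by rewrite fin_num_adde_defr|exact: cvg_cst|].
  by apply: nneseries_tail_cvg => // *; exact: outer_measure_ge0.
rewrite -[leRHS]adde0 -(cvg_lim _ cv)//; apply: lime_ge; first by apply/cvg_ex; eexists; exact: cv.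
exact: nearW.
Qed.

End HausdorffMetric.

Section HausdorffInvariant.
Context {R : realType} {p : nat}.
Notation V := 'rV[R]_p.+1.
Notation s := p.+1.

Lemma diam_cube_le (x y : V) (d : R) : 0 <= d -> (forall i, `|x 0 i - y 0 i| <= d) ->
  enorm (x - y) <= Num.sqrt p.+1%:R * d.
Proof.
move=> d0 h; rewrite /enorm -[d in leRHS]ger0_norm// -sqrtr_sqr -sqrtrM ?ler0n//.
rewrite ler_wsqrtr// /dotv; apply: (@le_trans _ _ (\sum_(i < s) d ^+ 2)).
  apply: ler_sum => i _; rewrite !mxE -expr2 -real_normK ?num_real// lerXn2r ?nnegrE//.
by rewrite sumr_const card_ord -[leLHS]mulr_natl.
Qed.

Let dyadic_cover (m : nat) (k : nat) : set V :=
  if insub k is Some i then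
    [set x | forall j, Num.floor (x 0 j * 2 ^+ m) =
      Posz (enum_val (i : 'I_#|{ffun 'I_p.+1 -> 'I_(2 ^ m)}|) j)]
  else set0.

Let dyadic_cover_cube m : (unit_cube : set V) `<=` \bigcup_k dyadic_cover m k.
Proof.
move=> x cx; have p0 : 0 < (2 ^+ m : R) by rewrite exprn_gt0.
have flo j : exists i : 'I_(2 ^ m), Num.floor (x 0 j * 2 ^+ m) = Posz i.
  have /andP[x0 x1] := cx j.
  have f0 : (0 <= Num.floor (x 0 j * 2 ^+ m))%R by rewrite floor_ge0 mulr_ge0// ltW.
  have f1 : (absz (Num.floor (x 0%R j * 2 ^+ m)%R) < 2 ^ m)%N.
    rewrite -ltz_nat gez0_abs// -(ltr_int R); apply: (@le_lt_trans _ _ (x 0 j * 2 ^+ m)).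
      by have /andP[] := floor_itv (x 0 j * 2 ^+ m).
    by rewrite -pmulrn natrX -[ltRHS]mul1r ltr_pM2r.
  by exists (Ordinal f1); rewrite /= gez0_abs.
have [g gP] := choice flo.
exists (enum_rank (finfun g)) => //; rewrite /dyadic_cover.
have -> : insub (enum_rank (finfun g) : nat) = Some (enum_rank (finfun g)) := valK _.
by move=> j; rewrite enum_rankK ffunE.
Qed.

Let dyadic_cover_diam m k : (diam (dyadic_cover m k) <= (Num.sqrt p.+1%:R * 2 ^- m)%:E)%E.
Proof.
have p0 : 0 < (2 ^+ m : R) by rewrite exprn_gt0.
apply: diam_le => x y; rewrite /dyadic_cover; case: insubP => // i _ _ xi yi.
rewrite lee_fin diam_cube_le ?invr_ge0 ?(ltW p0)// => j.
rewrite -[leRHS]div1r ler_pdivlMr// -[X in _ * X](gtr0_norm p0) -normrM mulrBl.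
have := floor_itv (x 0 j * 2 ^+ m); have := floor_itv (y 0 j * 2 ^+ m).
rewrite xi yi intrD => /andP[a b] /andP[c e].
by rewrite ler_norml; apply/andP; split; lra.
Qed.

(** The [(2 ^ m) ^ s] dyadic cubes of level [m] have diameter at most [D * 2 ^- m], so the total
    weight has a bound independent of [m]. *)
Lemma hausdorff_unit_cube_lty : (hausdorff s (unit_cube : set V) < +oo)%E.
Proof.
pose D : R := Num.sqrt p.+1%:R; have D0 : 0 <= D by exact: sqrtr_ge0.
apply: (@le_lt_trans _ _ (ball_volume s * (D / 2) ^+ s)%:E); last exact: ltry.
apply: ge_ereal_sup => _ [d /= d0 <-].
have [m md] : exists m, D * 2 ^- m <= d.
  exists (Num.truncn (D / d)); set m := Num.truncn _.
  rewrite ler_pdivrMr ?exprn_gt0// -ler_pdivrMl// mulrC.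
  by rewrite (le_trans (ltW (truncnS_gt _)))// -/m -natrX ler_nat ltn_expl.
apply: (@le_trans _ _ (\sum_(k <oo) hausdorff_weight s (dyadic_cover m k))%E).
  apply: ereal_inf_lbound; exists (dyadic_cover m) => //; split; last exact: dyadic_cover_cube.
  by move=> k; apply: le_trans (dyadic_cover_diam m k) _; rewrite lee_fin.
pose N := #|{ffun 'I_p.+1 -> 'I_(2 ^ m)}|.
rewrite (nneseries_split 0 N); last by move=> *; exact: hausdorff_weight_ge0.
rewrite add0n eseries0 ?adde0; last first.
  move=> k Nk _; rewrite /dyadic_cover insubF; last by rewrite ltnNge Nk.
  by rewrite /hausdorff_weight eqxx.
pose w : R := ball_volume s * (D * 2 ^- m / 2) ^+ s.
apply: (@le_trans _ _ (\sum_(0 <= k < N) w%:E)%E).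
  apply: lee_sum => k _; apply: hausdorff_weight_le; first exact: dyadic_cover_diam.
  by rewrite mulr_ge0// invr_ge0 exprn_ge0.
rewrite sumEFin lee_fin sumr_const_nat subn0 /w /N card_ffun !card_ord -[leLHS]mulr_natl.
set b := ball_volume _; rewrite mulrCA ler_wpM2l ?(ltW (ball_volume_gt0 _))//.
rewrite !natrX -exprMn.
have -> : 2 ^+ m * (D * 2 ^- m / 2) = D / 2 by field; rewrite expf_neq0.
by [].
Qed.

(** A box with half-sides [2 d] around a point of the set contains it. For [d = 0] that half-open
    box is empty, whereas the set is a single point, which lies in a null hyperplane. *)
Let volume_le_diam (A : set V) (d : R) : A !=set0 -> diam A = d%:E ->
  (volume A <= ((4 * d) ^+ s)%:E)%E.
Proof.
move=> [y Ay] dA; have h x i : A x -> `|x 0 i - y 0 i| <= d.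
  move=> Ax; have := ler_diam Ax Ay; rewrite dA lee_fin; apply: le_trans.
  by rewrite (le_trans _ (ler_abs_enorm _ i))// !mxE.
have [d0|d0] := ltP 0 d.
  pose ab : V * V := (y - const_mx (2 * d), y + const_mx (2 * d)).
  apply: (@le_trans _ _ (box_volume ab)); last first.
    rewrite lee_fin (eq_bigr (fun=> 4 * d)) ?prodr_const ?card_ord// => i _.
    by rewrite !mxE max_r; lra.
  apply: ereal_inf_lbound; exists (fun k => if k == 0%N then ab else (0, 0)).
    split=> // x Ax; exists 0%N => // i /=; rewrite !mxE.
    have := h _ i Ax; rewrite ler_norml => /andP[h1 h2].
    by apply/andP; split; lra.
  rewrite (nneseries_split 0 1); last first.
    by move=> k _; rewrite lee_fin; apply: prodr_ge0 => i _; exact: box_side_ge0.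
  rewrite big_nat1 /= eseries0 ?adde0// => -[|k]// _ _.
  by rewrite /box_volume /= (bigD1 0)//= mxE subrr maxxx mul0r.
have -> : d = 0.
  by apply/eqP; rewrite eq_le d0 (le_trans _ (h _ 0 Ay)).
rewrite mulr0 expr0n /=.
have e0 : (delta_mx 0 0 : V) != 0.
  by apply/negP => /eqP/matrixP/(_ 0 0)/eqP; rewrite !mxE !eqxx oner_eq0.
have h0 := invariant_hyperplane (y 0 0) volume_invariant e0.
apply: (@le_trans _ _ (volume [set x | dotv (delta_mx 0 0) x = y 0 0])); last by rewrite [leLHS]h0.
apply: le_outer_measure => x Ax; rewrite /= dotvC dotvE trmx_delta -colE mxE.
apply/eqP; rewrite -subr_eq0 -normr_le0.
exact: le_trans (h _ _ Ax) d0.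
Qed.

(** By the choice of [K], [(4 d) ^ s] is [K] times the weight of a set of diameter [d]. Any cover of
    the cube has total volume at least 1 and hence total weight at least [K^-1]. *)
Lemma hausdorff_unit_cube_gt0 : (0 < hausdorff s (unit_cube : set V))%E.
Proof.
pose K : R := 8 ^+ s / ball_volume s.
have b0 := @ball_volume_gt0 R s.
have K0 : 0 < K by rewrite divr_gt0// exprn_gt0.
apply: (@lt_le_trans _ _ (K^-1)%:E); first by rewrite lte_fin invr_gt0.
apply: le_trans (hausdorff_pre_le _ _ ltr01).
apply: le_ereal_inf_tmp => _ [F [Fd cF] <-].
rewrite -[leLHS]mule1 -lee_pdivlMl ?invr_gt0// invrK -nneseriesZl; last first.
  by move=> *; exact: hausdorff_weight_ge0.
apply: le_trans volume_unit_cube_ge1 _; apply: le_trans (le_outer_measure _ _ _ cF) _.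
apply: le_trans (outer_measure_sigma_subadditive _ F) _.
apply: lee_nneseries => k _; first by move=> _; exact: outer_measure_ge0.
have [->|/set0P F0] := eqVneq (F k) set0.
  by rewrite outer_measure0 mule_ge0 ?lee_fin ?(ltW K0)// hausdorff_weight_ge0.
have fF : diam (F k) \is a fin_num.
  by rewrite ge0_fin_numE ?diam_ge0//; exact: le_lt_trans (Fd k) (ltry _).
apply: le_trans (volume_le_diam F0 (esym (fineK fF))) _.
rewrite /hausdorff_weight ifF; last by apply/negbTE/set0P.
rewrite -EFinM lee_fin /K -mulrA mulKf ?gt_eqF// -exprMn.
by have -> : 8 * (fine (diam (F k)) / 2) = 4 * fine (diam (F k)) by field.
Qed.

Lemma hausdorff_invariant : invariant_outer (hausdorff s : {outer_measure set V -> \bar R}).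
Proof.
split=> [v A|i b|]; last exact: hausdorff_unit_cube_lty.
- apply: hausdorff_lipschitz => x y _ _.
  by rewrite opprD addrACA subrr addr0.
- have -> : [set x : V | x 0 i < b] = [set x | dotv (delta_mx 0 i) x < b].
    by apply/funext => x /=; rewrite dotvC dotvE trmx_delta -colE mxE.
  exact: hausdorff_half.
Qed.

End HausdorffInvariant.

(** * Simplices and barycentric coordinates *)

Lemma closed_dotv_eq (R : realType) (d : nat) (a : 'rV[R]_d) (b : R) :
  closed [set x | dotv a x = b].
Proof.
apply: (@preimage_closed _ _ (fun x => dotv a x) [set y | y = b]); last exact: closed_eq.
by move=> x _; exact: dotv_continuous.
Qed.

Section Barycentric.
Context {R : realType} {d k : nat}.
Notation V := 'rV[R]_d.+1.
Variable p : 'I_k.+1 -> V.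

Lemma sum_scale_edges (c : 'I_k.+1 -> R) : \sum_i c i = 1 ->
  \sum_i c i *: p i = (\row_j c (lift ord0 j)) *m edges p + p ord0.
Proof.
move=> c1; have -> : \sum_i c i *: p i = \sum_i c i *: (p i - p ord0) + p ord0.
  under [in RHS]eq_bigr do rewrite scalerBr.
  by rewrite sumrB -scaler_suml c1 scale1r subrK.
rewrite big_ord_recl subrr scaler0 add0r; congr (_ + _).
by rewrite mulmx_sum_row; apply: eq_bigr => j _; rewrite mxE rowK.
Qed.

Definition edge_coord (x : V) : 'rV[R]_k := (x - p ord0) *m pinvmx (edges p).

(** Barycentric coordinates; off the affine hull the values are those of a projection. *)
Definition bary (i : 'I_k.+1) (x : V) : R :=
  oapp (fun j => edge_coord x 0 j) (1 - \sum_j edge_coord x 0 j) (unlift ord0 i).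

Lemma bary_lift j x : bary (lift ord0 j) x = edge_coord x 0 j.
Proof. by rewrite /bary liftK. Qed.

Lemma bary0 x : bary ord0 x = 1 - \sum_j edge_coord x 0 j.
Proof. by rewrite /bary unlift_none. Qed.

Lemma sum_bary x : \sum_i bary i x = 1.
Proof. by rewrite big_ord_recl bary0 (eq_bigr _ (fun j _ => bary_lift j x)) subrK. Qed.

Lemma bary_affine i : exists (a : V) (b : R), forall x, bary i x = dotv a x + b.
Proof.
have ec j : exists a : V, forall x, edge_coord x 0 j = dotv a x - dotv a (p ord0).
  exists (col j (pinvmx (edges p)))^T => x; rewrite -dotvBr dotvC dotvE trmxK /edge_coord.
  by rewrite !mxE; apply: eq_bigr => l _; rewrite !mxE.
have [a aP] := choice ec.
case: (unliftP ord0 i) => [j|] ->.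
  by exists (a j), (- dotv (a j) (p ord0)) => x; rewrite bary_lift aP.
exists (- \sum_j a j), (1 + dotv (\sum_j a j) (p ord0)) => x.
rewrite bary0 (eq_bigr _ (fun j _ => aP j x)) sumrB dotvNl !dotv_suml.
by rewrite opprB; ring.
Qed.

Lemma bary_continuous i : continuous (bary i).
Proof.
have [a [b ab]] := bary_affine i.
have -> : bary i = (fun x => dotv a x + b) by apply/funext.
move=> x; apply: (@continuous_comp _ _ _ (fun x => dotv a x) (fun y => y + b)).
  exact: dotv_continuous.
by apply: cvgD; [exact: cvg_id|exact: cvg_cst].
Qed.

Lemma bary_comb i (I : finType) (c : I -> R) (y : I -> V) : \sum_l c l = 1 ->
  bary i (\sum_l c l *: y l) = \sum_l c l * bary i (y l).
Proof.
move=> c1; have [a [b ab]] := bary_affine i; rewrite ab dotv_sumr.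
under eq_bigr do rewrite dotvZr; under [RHS]eq_bigr do rewrite ab mulrDr.
by rewrite big_split /= -mulr_suml c1 mul1r.
Qed.

Hypothesis p_nd : Defs.nondegenerate p.

Lemma edges_pinv : edges p *m pinvmx (edges p) = 1%:M.
Proof. exact: mulmxVp. Qed.

Lemma edge_coordE (y : 'rV[R]_k) : edge_coord (y *m edges p + p ord0) = y.
Proof. by rewrite /edge_coord addrK -mulmxA edges_pinv mulmx1. Qed.

Lemma baryE c i : \sum_i c i = 1 -> bary i (\sum_i c i *: p i) = c i.
Proof.
move=> c1; rewrite sum_scale_edges//; case: (unliftP ord0 i) => [j|] ->.
  by rewrite bary_lift edge_coordE mxE.
rewrite bary0 edge_coordE; under eq_bigr do rewrite mxE.
by rewrite -c1 big_ord_recl addrK.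
Qed.

Lemma bary_vertex i l : bary i (p l) = (i == l)%:R.
Proof.
have s1 : \sum_j ((j == l)%:R : R) = 1.
  by rewrite (bigD1 l)//= eqxx big1 ?addr0// => j /negbTE ->.
rewrite -(baryE i s1); congr bary; rewrite (bigD1 l)//= eqxx scale1r.
by rewrite big1 ?addr0// => j /negbTE ->; rewrite scale0r.
Qed.

Definition affine_hull : set V := [set x | (x - p ord0 <= edges p)%MS].

Lemma affine_hull_comb c : \sum_i c i = 1 -> affine_hull (\sum_i c i *: p i).
Proof. by move=> c1; rewrite /affine_hull /= sum_scale_edges// addrK submxMl. Qed.

Lemma affine_hull_bary x : affine_hull x -> x = \sum_i bary i x *: p i.
Proof.
move=> /submxP[y xy]; have xE : x = y *m edges p + p ord0 by rewrite -xy subrK.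
rewrite sum_scale_edges ?sum_bary// [LHS]xE; congr (_ *m _ + _).
by apply/rowP => j; rewrite mxE bary_lift xE edge_coordE.
Qed.

Lemma simplexP x : simplex p x <-> affine_hull x /\ forall i, 0 < bary i x.
Proof.
split=> [[c [c0 c1 ->]]|[hx x0]].
  by split; [exact: affine_hull_comb|move=> i; rewrite baryE].
by exists (bary^~ x); split=> //; [exact: sum_bary|exact: affine_hull_bary].
Qed.

Lemma closed_simplex_closed :
  closed [set x | affine_hull x /\ forall i, 0 <= bary i x].
Proof.
have -> : [set x | affine_hull x /\ forall i, 0 <= bary i x] =
    (\bigcap_(j in setT) [set x | dotv (col j (cokermx (edges p)))^T x =
        dotv (col j (cokermx (edges p)))^T (p ord0)]) `&`
    \bigcap_(i in setT) (bary i @^-1` [set y | 0 <= y]).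
  have hullE x : affine_hull x <-> forall j, dotv (col j (cokermx (edges p)))^T x =
        dotv (col j (cokermx (edges p)))^T (p ord0).
    have E (y : V) j : dotv (col j (cokermx (edges p)))^T y = (y *m cokermx (edges p)) 0 j.
      by rewrite dotvC dotvE trmxK !mxE; apply: eq_bigr => l _; rewrite !mxE.
    rewrite /affine_hull /= submxE mulmxBl subr_eq0; split=> [/eqP h j|h].
      by rewrite !E h.
    by apply/eqP/rowP => j; rewrite -!E.
  apply/seteqP; split=> x /=.
    by move=> [/hullE hx x0]; split=> [j _|i _]; [exact: hx|exact: x0].
  by move=> [hx x0]; split=> [|i]; [apply/hullE => j; exact: hx|exact: x0].
apply: closedI; apply: closed_bigI => i _; first exact: closed_dotv_eq.
apply: preimage_closed; last exact: closed_ge.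
by move=> x _; exact: bary_continuous.
Qed.

(** For the converse inclusion, a point with nonnegative coordinates is pushed by a small fraction
    [t] towards the barycenter [z], which makes all of its coordinates positive. *)
Lemma closure_simplexP x :
  closure (simplex p) x <-> affine_hull x /\ forall i, 0 <= bary i x.
Proof.
split=> [|[hx x0]].
  have : simplex p `<=` [set x | affine_hull x /\ forall i, 0 <= bary i x].
    by move=> y /simplexP[hy y0]; split=> // i; exact/ltW.
  by move=> sub cx; apply: closed_simplex_closed; exact: (closureS sub).
move=> A /near_rV[e e0 he].
pose z := \sum_i (k.+1%:R^-1 : R) *: p i.
have k0 : 0 < (k.+1%:R^-1 : R) by rewrite invr_gt0 ltr0n.
have s1 : \sum_(i < k.+1) (k.+1%:R^-1 : R) = 1.
  by rewrite sumr_const card_ord -[LHS]mulr_natl mulfV// pnatr_eq0.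
pose M := \sum_i `|(z - x) 0 i| + 1.
have M0 : 0 < M by rewrite ltr_wpDl// sumr_ge0.
pose t := Num.min 1 (e / 2 / M).
have t0 : 0 < t by rewrite lt_min ltr01 !divr_gt0.
have t1 : t <= 1 by rewrite ge_min lexx.
have tM : t * M <= e / 2 by rewrite -ler_pdivlMr// ge_min lexx orbT.
pose c i := (1 - t) * bary i x + t * k.+1%:R^-1.
have c1 : \sum_i c i = 1.
  by rewrite big_split /= -!mulr_sumr sum_bary s1 !mulr1 subrK.
exists (\sum_i c i *: p i); split.
  exists c; split=> // i; rewrite ltr_wpDl ?mulr_gt0//.
  by rewrite mulr_ge0 ?x0// subr_ge0.
apply: he => i; have -> : \sum_i c i *: p i = x + t *: (z - x).
  rewrite /c; under eq_bigr do rewrite scalerDl -!scalerA.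
  rewrite big_split /= -!scaler_sumr -affine_hull_bary// -/z.
  have -> : k.+1%:R^-1 *: \sum_(i0 < k.+1) p i0 = z by rewrite /z scaler_sumr.
  by rewrite scalerBl scale1r scalerBr -addrA (addrC (- _)).
rewrite 2!mxE addrAC subrr add0r normrM gtr0_norm//.
apply: (@le_lt_trans _ _ (t * M)); last by rewrite (le_lt_trans tM)// ltr_pdivrMr// ltr_pMr// ltr1n.
rewrite ler_wpM2l ?(ltW t0)// /M (bigD1 i)//= -addrA lerDl addr_ge0 ?ler01// sumr_ge0//.
Qed.

End Barycentric.

(** * Measures of simplices *)

Section StandardSimplex.
Context {R : realType} {k : nat}.
Notation W := 'rV[R]_k.+1.

Definition std_simplex : set W := [set y | (forall i, 0 < y 0 i) /\ \sum_i y 0 i < 1].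

Lemma std_simplex_open : open std_simplex.
Proof.
have -> : std_simplex = (\bigcap_(i in setT) [set y | 0 < dotv (delta_mx 0 i) y]) `&`
    [set y | dotv (const_mx 1) y < 1].
  have E (y : W) i : dotv (delta_mx 0 i) y = y 0 i.
    by rewrite dotvC dotvE trmx_delta -colE mxE.
  have E1 (y : W) : dotv (const_mx 1) y = \sum_i y 0 i.
    by apply: eq_bigr => i _; rewrite mxE mul1r.
  apply/seteqP; split=> y /=; rewrite E1.
    by move=> [y0 y1]; split=> // i _ /=; rewrite E.
  by move=> [y0 y1]; split=> // i; have := y0 i I; rewrite /= E.
have oh (a : W) (O : set R) : open O -> open ((fun x => dotv a x) @^-1` O).
  by move=> oO; apply: open_comp => // x _; exact: dotv_continuous.
apply: openI; last by apply: (oh (const_mx 1) [set r | r < 1]); exact: open_lt.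
rewrite openE => y hy; apply: (@nbhs_rVS _ _ _ [set z | forall i, 0 < dotv (delta_mx 0 i) z]).
  by move=> z hz i _; exact: hz.
apply: nbhs_rV_forall => i; apply: open_nbhs_nbhs; split; last exact: hy.
by apply: (oh (delta_mx 0 i) [set r | 0 < r]); exact: open_gt.
Qed.

Lemma std_simplex_cube : std_simplex `<=` unit_cube.
Proof.
move=> y [y0 y1] i; rewrite (ltW (y0 i))/=; apply: le_lt_trans y1.
by rewrite (bigD1 i)//= lerDl sumr_ge0// => j _; exact/ltW.
Qed.

Variable mu : {outer_measure set W -> \bar R}.
Hypothesis imu : invariant_outer mu.

Lemma std_simplex_lty : (mu std_simplex < +oo)%E.
Proof. exact: le_lt_trans (le_outer_measure _ _ _ std_simplex_cube) (invariant_lty imu). Qed.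

Lemma std_simplex_gt0 : (0 < mu unit_cube -> 0 < mu std_simplex)%E.
Proof.
(* The cube with coordinates in [[a, 2a)] fits into the simplex, because [k.+1] summands below [2 a]
   add up to less than 1. *)
move=> c0; pose a : R := (k.+1.*2)%:R^-1.
have a0 : 0 < a by rewrite invr_gt0 ltr0n double_gt0.
apply: (@lt_le_trans _ _ (mu [set x + const_mx a | x in origin_box (fun=> a)])).
  rewrite invariant_shift// invariant_origin_box; last by move=> _; exact/ltW.
    by rewrite mule_gt0// lte_fin prodr_gt0.
  exact: imu.
apply: le_outer_measure => _ [x hx <-]; split=> [i|].
  by rewrite !mxE ltr_wpDl//; have /andP[] := hx i.
apply: (@lt_le_trans _ _ (\sum_(i < k.+1) (a + a))).
  rewrite -subr_gt0 -sumrB (bigD1 ord0)//= ltr_pwDl//.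
    by rewrite !mxE; have /andP[] := hx ord0; lra.
  by apply: sumr_ge0 => i _; rewrite !mxE; have /andP[] := hx i; lra.
rewrite sumr_const card_ord -mulr2n -mulrnA -[leLHS]mulr_natr /a mul2n mulVf//.
Qed.

End StandardSimplex.

Section SimplexMeasure.
Context {R : realType}.

Lemma simplex_std (d k : nat) (p : 'I_k.+2 -> 'rV[R]_d.+1) :
  simplex p = [set y *m edges p + p ord0 | y in std_simplex].
Proof.
apply/seteqP; split=> [x [c [c0 c1 ->]]|_ [y [y0 y1] <-]].
  exists (\row_j c (lift ord0 j)); last by rewrite -sum_scale_edges.
  split=> [i|]; first by rewrite mxE.
  rewrite (eq_bigr (fun j => c (lift ord0 j))) => [|j _]; last by rewrite mxE.
  by rewrite -c1 [ltRHS]big_ord_recl ltrDr.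
pose c (i : 'I_k.+2) := oapp (fun j => y 0 j) (1 - \sum_j y 0 j) (unlift ord0 i).
have cl j : c (lift ord0 j) = y 0 j by rewrite /c liftK.
have c1 : \sum_i c i = 1.
  by rewrite big_ord_recl (eq_bigr _ (fun j _ => cl j)) {1}/c unlift_none subrK.
exists c; split=> // [i|]; last first.
  by rewrite sum_scale_edges//; congr (_ *m _ + _); apply/rowP => j; rewrite mxE cl.
by case: (unliftP ord0 i) => [j|] ->; rewrite ?cl// /c unlift_none subr_gt0.
Qed.

Lemma enorm_wedge_onb (n : nat) (Q : 'M[R]_(n, n.+1)) : row_free Q ->
  Q *m Q^T = 1%:M -> enorm (wedgev Q) = 1.
Proof.
move=> fQ QQ; have := bform_wedge spd1 fQ.
by rewrite bform1 invmx1 mulmx1 QQ !det1 mulr1 /enorm => ->; rewrite sqrtr1.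
Qed.

(* A row-free [E] factors through an isometry [Q] as [E = A Q]. *)
Lemma hausdorff_plane (k : nat) (E : 'M[R]_(k.+1, k.+2)) : row_free E ->
  exists A : 'M[R]_k.+1, [/\ A \in unitmx, `|\det A| = enorm (wedgev E) &
    forall (S : set 'rV[R]_k.+1) v,
      hausdorff k.+1 [set y *m E + v | y in S] = hausdorff k.+1 [set y *m A | y in S]].
Proof.
move=> fE; have [B uB BE] := row_free_onb spd1 fE.
pose Q := B *m E; pose A := invmx B.
have uA : A \in unitmx by rewrite unitmx_inv.
have EQ : E = A *m Q by rewrite mulKmx.
have QQ : Q *m Q^T = 1%:M by rewrite -BE mulmx1.
have fQ : row_free Q by rewrite /row_free mxrankMfree// mxrank_unit.
exists A; split=> // [|S v].
  rewrite EQ wedge_mull /enorm dotvZl dotvZr mulrA -expr2 sqrtrM ?sqr_ge0// sqrtr_sqr.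
  by rewrite -/(enorm _) enorm_wedge_onb// mulr1.
have -> : [set y *m E + v | y in S] = [set z *m Q + v | z in [set y *m A | y in S]].
  by rewrite image_comp; congr image; apply/funext => y /=; rewrite EQ mulmxA.
apply: hausdorff_isometry => x y _ _; rewrite opprD addrACA subrr addr0 -mulmxBl.
by rewrite /enorm !dotvE trmx_mul mulmxA -(mulmxA _ Q) QQ mulmx1.
Qed.

(** The constant that turns the length of the wedge product of the edges into the area of an
    element. *)
Definition std_content (k : nat) : R := fine (hausdorff k.+1 (@std_simplex R k)).

Lemma std_contentE k : hausdorff k.+1 (@std_simplex R k) = (std_content k)%:E.
Proof.
rewrite fineK// ge0_fin_numE ?outer_measure_ge0//.
exact: (std_simplex_lty hausdorff_invariant).
Qed.

Lemma std_content_gt0 k : 0 < std_content k.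
Proof.
rewrite -lte_fin -std_contentE.
exact: (std_simplex_gt0 hausdorff_invariant hausdorff_unit_cube_gt0).
Qed.

Lemma hausdorff_simplex (k : nat) (p : 'I_k.+2 -> 'rV[R]_k.+2) : Defs.nondegenerate p ->
  hausdorff k.+1 (simplex p) = (std_content k * enorm (wedgev (edges p)))%:E.
Proof.
move=> /hausdorff_plane[A [uA dA AE]]; rewrite simplex_std AE.
have := invariant_det hausdorff_invariant hausdorff_unit_cube_gt0 uA (@std_simplex_open R k).
by rewrite [X in (_ * X)%E]std_contentE dA mulrC => h; rewrite [LHS]h.
Qed.

Lemma hausdorff_simplex_boundary (k : nat) (p : 'I_k.+2 -> 'rV[R]_k.+2) :
  Defs.nondegenerate p -> hausdorff k.+1 (closure (simplex p) `\` simplex p) = 0%E.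
Proof.
move=> nd; have [A [uA _ AE]] := hausdorff_plane nd.
(* In edge coordinates the face where the [i]-th barycentric coordinate vanishes is the hyperplane
   [dotv (h i) y = b i]: a coordinate is 0 for [i] above [ord0], and the coordinates sum to 1 for
   [ord0]. *)
pose h (i : 'I_k.+2) : 'rV[R]_k.+1 := oapp (delta_mx 0) (const_mx 1) (unlift ord0 i).
pose b (i : 'I_k.+2) : R := oapp (fun=> 0) 1 (unlift ord0 i).
pose P i := [set y *m edges p + p ord0 | y in [set y | dotv (h i) y = b i]].
have h0 i : h i != 0.
  apply/negP => /eqP/rowP; rewrite /h; case: unliftP => [j|] _ /= => [/(_ j)|/(_ 0)];
    rewrite !mxE ?eqxx => /eqP; by rewrite oner_eq0.
have P0 i : hausdorff k.+1 (P i) = 0%E.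
  rewrite AE; exact: (invariant_hyperplane (b i) (invariant_image hausdorff_invariant uA) (h0 i)).
apply/eqP; rewrite eq_le outer_measure_ge0 andbT.
pose F m := oapp P set0 (insub m : option 'I_k.+2).
apply: (@le_trans _ _ (hausdorff k.+1 (\bigcup_m F m))).
  apply: le_outer_measure => x [/(closure_simplexP nd)[hx x0] nx].
  have [i xi] : exists i, bary p i x = 0.
    apply: contrapT => ne; apply: nx; apply/(simplexP nd); split=> // i.
    by rewrite lt_def x0 andbT; apply/eqP => xi; apply: ne; exists i.
  exists (i : nat) => //; rewrite /F valK /=; exists (edge_coord p x).
    rewrite /= /h /b; move: xi; rewrite /bary; case: unliftP => [j|] _ /=.
      by move=> ej; rewrite dotvC dotvE trmx_delta -colE mxE.
    move=> /eqP; rewrite subr_eq0 => /eqP h1; rewrite [RHS]h1.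
    by apply: eq_bigr => j _; rewrite mxE mul1r.
  rewrite [RHS](affine_hull_bary nd hx) sum_scale_edges ?sum_bary//; congr (_ *m _ + _).
  by apply/rowP => j; rewrite [RHS]mxE bary_lift.
rewrite (le_trans (outer_measure_sigma_subadditive _ F))// eseries0//.
move=> m _ _; rewrite /F; case: insub => [i|] /=; first exact: P0.
exact: outer_measure0.
Qed.

(** The singular case, where the image lies in a null hyperplane, covers the elements whose plane
    contains the origin. *)
Lemma volume_simplex (n : nat) (Y : 'M[R]_n.+1) :
  volume [set y *m Y | y in std_simplex] =
  (`|\det Y| * fine (volume (@std_simplex R n)))%:E.
Proof.
have f : volume (@std_simplex R n) \is a fin_num.
  by rewrite ge0_fin_numE ?outer_measure_ge0//; exact: (std_simplex_lty volume_invariant).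
have [uY|nuY] := boolP (Y \in unitmx).
  have := invariant_det volume_invariant volume_gt0 uY (@std_simplex_open R n).
  by rewrite EFinM fineK.
have -> : \det Y = 0 by apply/eqP; move: nuY; rewrite unitmxE unitfE negbK.
rewrite normr0 mul0r.
have [h h0 Yh] : exists2 h : 'rV[R]_n.+1, h != 0 & Y *m h^T = 0.
  move: nuY; rewrite -unitmx_tr -row_free_unit -kermx_eq0 => /rowV0Pn[h /sub_kermxP hY h0].
  by exists h => //; rewrite -[LHS]trmxK trmx_mul trmxK hY trmx0.
apply/eqP; rewrite eq_le outer_measure_ge0 andbT.
have e0 := invariant_hyperplane 0 volume_invariant h0.
apply: (@le_trans _ _ (volume [set x | dotv h x = 0])); last by rewrite [leLHS]e0.
apply: le_outer_measure => _ [y _ <-] /=.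
by rewrite dotvC dotvE -mulmxA Yh mulmx0 mxE.
Qed.

End SimplexMeasure.

(** * Integration over the surface *)

Section Equidistribution.
Context {d : measure_display} {T : measurableType d} {R : realType}.
Variable mu : {measure set T -> \bar R}.

(** The sum counts the naturals below both [N] and [z]; it is the smaller of [N] and the ceiling of
    [z]. *)
Lemma step_bounds (N : nat) (z : R) : 0 <= z ->
  (z <= N%:R -> z <= \sum_(i < N) (i%:R < z)%R%:R) /\
  \sum_(i < N) (i%:R < z)%R%:R <= z + 1.
Proof.
move=> z0.
have ub (M : nat) : \sum_(i < M) (i%:R < z)%R%:R <= M%:R :> R.
  rewrite -[leRHS]mulr1 mulr_natl -[M in leRHS]card_ord -sumr_const ler_sum// => i _.
  by rewrite -[1]/(1%:R) ler_nat leq_b1.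
suff h (M : nat) : (z <= M%:R -> z <= \sum_(i < M) (i%:R < z)%R%:R) /\
    (M%:R <= z -> M%:R <= \sum_(i < M) (i%:R < z)%R%:R :> R) /\
    \sum_(i < M) (i%:R < z)%R%:R <= z + 1.
  by have [h1 [_ h2]] := h N.
elim: M => [|M [h1 [h2 h3]]]; first by rewrite big_ord0; split=> //; split=> //; rewrite addr_ge0.
rewrite big_ord_recr /=; have [Mz|zM] := ltP.
  have := h2 (ltW Mz); have := ub M; rewrite -natr1 => h4 h5.
  have -> : (true%:R : R) = 1 by [].
  by split; [|split]; lra.
have := h1 zM; rewrite addr0 => h4; split=> //; split=> //.
by rewrite -natr1; lra.
Qed.

(* Both functions are within [1/N] of the same average of indicators of super-level sets. *)
Lemma eq_integral_levels (D : set T) (f g : T -> R) :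
  measurable D -> (mu D < +oo)%E -> measurable_fun D f -> measurable_fun D g ->
  (forall x, D x -> 0 <= f x <= 1) -> (forall x, D x -> 0 <= g x <= 1) ->
  (forall s, 0 <= s < 1 -> mu (D `&` [set x | s < f x]) = mu (D `&` [set x | s < g x])) ->
  (\int[mu]_(x in D) (f x)%:E = \int[mu]_(x in D) (g x)%:E)%E.
Proof.
move=> mD fD mf mg f01 g01 fg.
wlog : f g mf mg f01 g01 fg / True => [h|_]; first exact: h.
suff le (f' g' : T -> R) : measurable_fun D f' -> measurable_fun D g' ->
    (forall x, D x -> 0 <= f' x <= 1) -> (forall x, D x -> 0 <= g' x <= 1) ->
    (forall s, 0 <= s < 1 -> mu (D `&` [set x | s < f' x]) = mu (D `&` [set x | s < g' x])) ->
    (\int[mu]_(x in D) (f' x)%:E <= \int[mu]_(x in D) (g' x)%:E)%E.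
  apply/eqP; rewrite eq_le; apply/andP; split; apply: le => // s s01.
  by rewrite fg.
move=> {f g mf mg f01 g01 fg} mf mg f01 g01 fg.
have mDE : mu D = (fine (mu D))%:E by rewrite fineK// ge0_fin_numE.
apply/lee_addgt0Pr => e e0.
pose N := (Num.truncn (fine (mu D) / e)).+1.
have N0 : 0 < N%:R :> R by rewrite ltr0n.
have Ne : fine (mu D) / N%:R <= e.
  rewrite ler_pdivrMr// -ler_pdivrMl// mulrC; exact/ltW/truncnS_gt.
have level (h : T -> R) (s : R) : measurable_fun D h -> measurable (D `&` [set x | s < h x]).
  move=> mh; have := mh mD `]s, +oo[%classic (measurable_itv _).
  by congr (measurable (_ `&` _)); apply/seteqP; split=> x /=; rewrite in_itv/= andbT.
pose st (h : T -> R) (i : 'I_N) (x : T) : \bar R :=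
  ((N%:R^-1)%:E * (\1_(D `&` [set x | (i%:R / N%:R < h x)%R]) x)%:E)%E.
have st0 h i x : (0 <= st h i x)%E by rewrite mule_ge0// lee_fin.
have mst h i : measurable_fun D h -> measurable_fun D (st h i).
  move=> mh; apply: measurable_funeM; apply/measurable_EFinP.
  by apply: measurable_indic; exact: level.
have stE h x : D x -> (\sum_(i < N) st h i x =
    (N%:R^-1 * \sum_(i < N) (i%:R < N%:R * h x)%R%:R)%:E)%E.
  move=> Dx; rewrite mulr_sumr -sumEFin; apply: eq_bigr => i _.
  rewrite /st -EFinM; congr (_ * _)%:E; rewrite indicE; congr (_%:R).
  rewrite in_setI (mem_set Dx) /= [in RHS](mulrC N%:R) -ltr_pdivrMr//.
  by congr nat_of_bool; apply/idP/idP => [/set_mem//|?]; exact/mem_set.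
have int_st h : measurable_fun D h -> (\int[mu]_(x in D) (\sum_(i < N) st h i x) =
    \sum_(i < N) (N%:R^-1)%:E * mu (D `&` [set x | (i%:R / N%:R < h x)%R]))%E.
  move=> mh; rewrite ge0_integral_sum//; last by move=> i; exact: mst.
  apply: eq_bigr => i _; rewrite /st ge0_integralZl//.
  - rewrite integral_indic//; last exact: level.
    by congr (_ * mu _)%E; rewrite setIAC setIid.
  - by apply/measurable_EFinP/measurable_indic; exact: level.
have msum h : measurable_fun D h -> measurable_fun D (fun x => \sum_(i < N) st h i x)%E.
  by move=> mh; apply: emeasurable_sum => i; exact: mst.
have sum0 h x : (0 <= \sum_(i < N) st h i x)%E by apply: sume_ge0 => i _.
apply: (@le_trans _ _ (\int[mu]_(x in D) (\sum_(i < N) st f' i x))%E).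
  apply: ge0_le_integral => //.
  - by move=> x /f01 /andP[].
  - exact/measurable_EFinP.
  - exact: msum.
  move=> x Dx; rewrite stE// lee_fin -ler_pdivrMl ?invr_gt0// invrK.
  have /andP[h0 h1] := f01 _ Dx.
  apply: (step_bounds N _).1; first by rewrite mulr_ge0// ltW.
  by rewrite -[leRHS]mulr1 ler_wpM2l// ltW.
have -> : (\int[mu]_(x in D) (\sum_(i < N) st f' i x) =
    \int[mu]_(x in D) (\sum_(i < N) st g' i x))%E.
  rewrite !int_st//; apply: eq_bigr => i _; rewrite fg// divr_ge0//=.
  by rewrite ltr_pdivrMr// mul1r ltr_nat.
apply: (@le_trans _ _ (\int[mu]_(x in D) ((g' x)%:E + (N%:R^-1)%:E))%E).
  apply: ge0_le_integral => //.
  - exact: msum.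
  - by apply: emeasurable_funD; [exact/measurable_EFinP|exact: measurable_cst].
  move=> x Dx; rewrite stE// -EFinD lee_fin ler_pdivrMl// mulrDr divff ?gt_eqF//.
  have /andP[h0 h1] := g01 _ Dx.
  by apply: (step_bounds N _).2; rewrite mulr_ge0// ltW.
rewrite ge0_integralD//.
- rewrite integral_cst// leeD2l// mDE -EFinM lee_fin mulrC; exact: Ne.
- by move=> x /g01 /andP[].
- exact/measurable_EFinP.
Qed.

End Equidistribution.

Lemma caratheodory_null (R : realType) (T : Type)
    (mu : {outer_measure set T -> \bar R}) (A : set T) : mu A = 0%E -> mu.-caratheodory A.
Proof.
move=> A0; apply: le_caratheodory_measurable => X.
have -> : mu (X `&` A) = 0%E.
  apply/eqP; rewrite eq_le outer_measure_ge0 andbT -A0.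
  by apply: le_outer_measure => x [].
by rewrite add0e; apply: le_outer_measure => x [].
Qed.

Section SurfaceIntegral.
Context {R : realType} {k : nat}.
Notation V := 'rV[R]_k.+2.
Notation H := (@hausdorff R k.+1 k.+1).
Let T := caratheodory_type H.
Let mu : {measure set T -> \bar R} := hausdorff_measure k.+1.

Lemma hausdorff_coordinate_half i b : H.-caratheodory [set x : V | x 0 i < b].
Proof.
have -> : [set x : V | x 0 i < b] = [set x | dotv (delta_mx 0 i) x < b].
  by apply/funext => x /=; rewrite dotvC dotvE trmx_delta -colE mxE.
exact: hausdorff_half.
Qed.

Lemma simplex_measurable (p : 'I_k.+2 -> V) : Defs.nondegenerate p ->
  H.-caratheodory (simplex p).
Proof.
move=> nd.
have -> : simplex p = closure (simplex p) `\` (closure (simplex p) `\` simplex p).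
  by rewrite setDD setIidr//; exact: subset_closure.
apply: caratheodory_measurable_setD.
  apply: caratheodory_closed; [exact: hausdorff_coordinate_half|exact: closed_closure].
by apply: caratheodory_null; exact: hausdorff_simplex_boundary.
Qed.

Lemma bary_simplex (p : 'I_k.+2 -> V) i x : Defs.nondegenerate p -> simplex p x ->
  0 <= bary p i x <= 1.
Proof.
move=> nd /(simplexP nd)[_ x0]; rewrite (ltW (x0 i)) -(sum_bary p x) (bigD1 i)//=.
by rewrite lerDl sumr_ge0// => j _; exact/ltW.
Qed.

(** The superlevel set is the image [simplex p'] of the simplex under the homothety with centre
    [p i] and ratio [1 - s]. Its measure therefore does not depend on [i]. *)
Lemma simplex_level (p : 'I_k.+2 -> V) i s : Defs.nondegenerate p -> 0 <= s < 1 ->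
  H (simplex p `&` [set x | s < bary p i x]) =
  (std_content k * ((1 - s) ^+ k.+1 * enorm (wedgev (edges p))))%:E.
Proof.
move=> nd /andP[s0 s1]; pose p' j := s *: p i + (1 - s) *: p j.
have t0 : 0 < 1 - s by rewrite subr_gt0.
have Ep' : edges p' = (1 - s) *: edges p.
  apply/row_matrixP => j; rewrite linearZ /= !rowK /p' opprD addrACA subrr add0r.
  by rewrite scalerBr.
have nd' : Defs.nondegenerate p'.
  by rewrite /Defs.nondegenerate Ep' /row_free mxrank_scale_nz// gt_eqF.
have -> : simplex p `&` [set x | s < bary p i x] = simplex p'.
  apply/seteqP; split=> [x [[c [c0 c1 xE]]]|_ [c [c0 c1 ->]]].
    rewrite /= xE baryE// => sc.
    exists (fun j => (c j - (j == i)%:R * s) / (1 - s)).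
    have d1 : \sum_j (j == i)%:R * s = s.
      by rewrite (bigD1 i)//= eqxx mul1r big1 ?addr0// => j /negbTE ->; rewrite mul0r.
    have e1 : \sum_j (c j - (j == i)%:R * s) / (1 - s) = 1.
      by rewrite -mulr_suml sumrB c1 d1 divff// gt_eqF.
    split=> // [j|].
      rewrite divr_gt0//; case: eqP => [->|_]; first by rewrite mul1r subr_gt0.
      by rewrite mul0r subr0.
    rewrite /p'; under [RHS]eq_bigr do rewrite scalerDr.
    rewrite big_split /= -scaler_suml e1 scale1r.
    rewrite [X in _ = _ + X](eq_bigr (fun j => (c j - (j == i)%:R * s) *: p j)); last first.
      by move=> j _; rewrite scalerA divfK// gt_eqF.
    under [X in _ = _ + X]eq_bigr do rewrite scalerBl.
    rewrite sumrB [X in _ = _ + (_ - X)](_ : _ = s *: p i); first by rewrite addrC subrK.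
    rewrite (bigD1 i)//= eqxx mul1r big1 ?addr0// => j /negbTE ->.
    by rewrite mul0r scale0r.
  pose c' j := (j == i)%:R * s + (1 - s) * c j.
  have d1 : \sum_j (j == i)%:R * s = s.
    by rewrite (bigD1 i)//= eqxx mul1r big1 ?addr0// => j /negbTE ->; rewrite mul0r.
  have c'1 : \sum_j c' j = 1 by rewrite big_split /= d1 -mulr_sumr c1 mulr1 addrC subrK.
  have xE : \sum_j c j *: p' j = \sum_j c' j *: p j.
    rewrite /p' /c'; under eq_bigr do rewrite scalerDr.
    under [RHS]eq_bigr do rewrite scalerDl.
    rewrite !big_split /= -scaler_suml c1 scale1r; congr (_ + _).
      rewrite (bigD1 i)//= eqxx mul1r big1 ?addr0// => j /negbTE ->.
      by rewrite mul0r scale0r.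
    by apply: eq_bigr => j _; rewrite !scalerA mulrC.
  rewrite xE; split; last by rewrite /= baryE// /c' eqxx mul1r ltrDl mulr_gt0.
  exists c'; split=> // j; rewrite /c' ltr_wpDl ?mulr_gt0//.
  by rewrite mulr_ge0.
rewrite hausdorff_simplex// Ep' wedgeZ /enorm dotvZl dotvZr mulrA -expr2.
rewrite sqrtrM ?sqr_ge0// sqrtr_sqr ger0_norm//.
by rewrite exprn_ge0// ltW.
Qed.

Let mT (A : set V) : H.-caratheodory A -> measurable (A : set T).
Proof. by []. Qed.

Lemma continuous_hausdorff_measurable (f : V -> R) (D : set V) :
  continuous f -> measurable_fun (D : set T) (f : T -> R).
Proof.
move=> cf mD; apply: (measurability _ (RGenOInfty.measurableE R)) => //.
move=> _ [_ [r ->] <-]; apply: measurableI => //; apply: mT.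
apply: caratheodory_open; first exact: hausdorff_coordinate_half.
apply: open_comp; last by rewrite set_itvE; exact: open_gt.
by move=> x _; exact: cf.
Qed.

Let muE (A : set V) : mu A = H A.
Proof. by []. Qed.

Let mu_simplex_lty (p : 'I_k.+2 -> V) : Defs.nondegenerate p -> (mu (simplex p) < +oo)%E.
Proof. by move=> nd; rewrite muE hausdorff_simplex// ltry. Qed.

Lemma integrable_bary (p : 'I_k.+2 -> V) i : Defs.nondegenerate p ->
  mu.-integrable (simplex p) (EFin \o bary p i).
Proof.
move=> nd; apply: measurable_bounded_integrable.
- exact: simplex_measurable.
- exact: mu_simplex_lty.
- exact: (continuous_hausdorff_measurable (@bary_continuous _ _ _ p i)).
- exists 1; split=> // M M1 x sx; have /andP[b0 b1] := bary_simplex i nd sx.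
  by rewrite /= ger0_norm// (le_trans b1)// ltW.
Qed.

(** All barycentric coordinates have superlevel sets of equal measure, hence equal integrals; since
    they sum to 1, each integral is the area divided by the number of vertices. *)
Lemma integral_bary (p : 'I_k.+2 -> V) i : Defs.nondegenerate p ->
  (\int[mu]_(x in simplex p) (bary p i x)%:E =
   (std_content k * enorm (wedgev (edges p)) / k.+2%:R)%:E)%E.
Proof.
move=> nd; have mS := mT (simplex_measurable nd).
have mb j : measurable_fun (simplex p : set T) (bary p j : T -> R).
  exact: (continuous_hausdorff_measurable (@bary_continuous _ _ _ p j)).
have E j : (\int[mu]_(x in simplex p) (bary p j x)%:E =
    \int[mu]_(x in simplex p) (bary p i x)%:E)%E.
  apply: eq_integral_levels => //; try by move=> x sx; exact: bary_simplex.
    exact: mu_simplex_lty.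
  by move=> s s01; rewrite !muE !simplex_level.
have : (\int[mu]_(x in simplex p) (\sum_j (bary p j x)%:E) =
    \sum_(j < k.+2) \int[mu]_(x in simplex p) (bary p j x)%:E)%E.
  by apply: integral_sum => // j; exact: integrable_bary.
rewrite (eq_bigr _ (fun j _ => E j)).
rewrite (eq_integral (fun=> 1%E)); last by move=> x _; rewrite sumEFin sum_bary.
rewrite integral_cst// mul1e muE hausdorff_simplex//.
have fi : (\int[mu]_(x in simplex p) (bary p i x)%:E)%E \is a fin_num.
  by apply: integrable_fin_num => //; exact: integrable_bary.
rewrite -(fineK fi) sumEFin => -[->]; rewrite sumr_const card_ord -[X in _ = (X / _)%:E]mulr_natr.
by rewrite mulfK// pnatr_eq0.
Qed.

Lemma areaE (J : nat) (p : 'I_J -> 'I_k.+2 -> V) j : Defs.nondegenerate (p j) ->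
  area p j = std_content k * enorm (wedgev (edges (p j))).
Proof. by move=> nd; rewrite /area hausdorff_simplex. Qed.

(** [f] is prescribed on the open elements only and may be arbitrary on the rest [N] of the surface.
    As [N] is null and every subset of a null set is Caratheodory measurable, [f] is measurable and
    can be replaced by the sum [G] of its affine pieces. *)
Lemma surf_integralE (J : nat) (p : 'I_J -> 'I_k.+2 -> V) (f : V -> R)
    (g : 'I_J -> 'I_k.+2 -> R) :
  (forall j, Defs.nondegenerate (p j)) ->
  (forall i j, i != j -> simplex (p i) `&` simplex (p j) = set0) ->
  (forall j x, simplex (p j) x -> f x = \sum_i g j i * bary (p j) i x) ->
  surf_integral p f = k.+2%:R^-1 * \sum_j area p j * \sum_i g j i.
Proof.
move=> nd disj fg.
pose a j x := \sum_i g j i * bary (p j) i x.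
have ia j : mu.-integrable (simplex (p j)) (EFin \o a j).
  rewrite (_ : EFin \o a j = fun x => (\sum_i (g j i)%:E * (EFin \o bary (p j) i) x)%E).
    apply: integrable_sum; first exact: mT (simplex_measurable (nd j)).
    move=> i _; apply: integrableZl; first exact: mT (simplex_measurable (nd j)).
    exact: integrable_bary.
  by apply/funext => x; rewrite /= /a -sumEFin; apply: eq_bigr => i _; rewrite EFinM.
have inta j : (\int[mu]_(x in simplex (p j)) (a j x)%:E =
    (k.+2%:R^-1 * (area p j * \sum_i g j i))%:E)%E.
  rewrite (eq_integral (fun x : T => (\sum_i (g j i)%:E * (EFin \o bary (p j) i) x)%E)); last first.
    by move=> x _; rewrite /a -sumEFin; apply: eq_bigr => i _; rewrite EFinM.
  rewrite integral_sum; [|exact: mT (simplex_measurable (nd j))|]; last first.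
    move=> i; apply: integrableZl; first exact: mT (simplex_measurable (nd j)).
    exact: integrable_bary.
  rewrite areaE// !mulr_sumr -sumEFin; apply: eq_bigr => i _.
  rewrite integralZl; [|exact: mT (simplex_measurable (nd j))|exact: integrable_bary].
  by rewrite integral_bary// -EFinM; congr (_%:E); ring.
rewrite /surf_integral /Rintegral integral_mkcond.
have iaT j : mu.-integrable [set: T] ((EFin \o a j) \_ (simplex (p j))).
  exact: (integrable_mkcond (mu := mu) (EFin \o a j : T -> _)
    (mT (simplex_measurable (nd j)))).1 (ia j).
pose G (x : T) : \bar R := (\sum_j ((EFin \o a j) \_ (simplex (p j))) x)%E.
have iG : mu.-integrable [set: T] G.
  apply: integrable_sum => // j _; exact: iaT.
pose S0 := \bigcup_j simplex (p j).
have GS0 j x : simplex (p j) x -> G x = (f x)%:E.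
  move=> sx; rewrite /G (bigD1 j)//= big1 ?adde0.
    by rewrite patchE mem_set// (fg j).
  move=> i ij; rewrite patchE memNset// => six.
  have : (simplex (p i) `&` simplex (p j)) x by [].
  by rewrite disj.
pose N := surface p `\` S0.
have N0 : H N = 0%E.
  pose F m := oapp (fun j => closure (simplex (p j)) `\` simplex (p j)) set0
    (insub m : option 'I_J).
  apply/eqP; rewrite eq_le outer_measure_ge0 andbT.
  apply: (@le_trans _ _ (H (\bigcup_m F m))).
    apply: le_outer_measure => x [[j _ cx] nx]; exists (j : nat) => //.
    by rewrite /F valK /=; split=> // sx; apply: nx; exists j.
  rewrite (le_trans (outer_measure_sigma_subadditive _ F))// eseries0//.
  move=> m _ _; rewrite /F; case: insub => [i|] /=; first exact: hausdorff_simplex_boundary.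
  exact: outer_measure0.
have fG x : ~ N x -> ((EFin \o f) \_ (surface p)) x = G x.
  move=> nNx; rewrite patchE; case: ifPn => [/set_mem sx|/negP nsx].
    have [[j _ jx]|nS] := pselect (S0 x); first by rewrite (GS0 j).
    by exfalso; apply: nNx.
  rewrite /G big1// => j _; rewrite patchE memNset// => sx.
  by apply: nsx; apply: mem_set; exists j => //; exact: subset_closure.
have mf : measurable_fun [set: T] ((EFin \o f) \_ (surface p)).
  move=> _ Y mY; rewrite setTI.
  have -> : ((EFin \o f) \_ (surface p)) @^-1` Y =
      (G @^-1` Y `\` N) `|` (((EFin \o f) \_ (surface p)) @^-1` Y `&` N).
    apply/seteqP; split=> x /=.
      move=> Yx; have [Nx|Nx] := pselect (N x); [by right|left].
      by rewrite -fG.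
    by move=> [[Yx Nx]|[]//]; rewrite fG.
  have mN : measurable (N : set T) by exact: caratheodory_null.
  apply: measurableU.
    apply: measurableD => //.
    by have /measurable_int/(_ measurableT Y mY) := iG; rewrite setTI.
  apply: caratheodory_null; apply/eqP; rewrite eq_le outer_measure_ge0 andbT -N0.
  by apply: le_outer_measure => x [].
have aefG : ae_eq mu [set: T] ((EFin \o f) \_ (surface p)) G.
  exists N; split=> [||x /= h]; [exact: caratheodory_null|exact: N0|].
  by apply: contrapT => nN; apply: h => _; exact: fG.
have E := ae_eq_integral G ((EFin \o f) \_ (surface p)) measurableT mf (measurable_int _ iG) aefG.
rewrite [X in fine X]E /G integral_sum//.
rewrite (eq_bigr (fun j => (k.+2%:R^-1 * (area p j * \sum_i g j i))%:E)); last first.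
  by move=> j _; rewrite -integral_mkcond inta.
by rewrite sumEFin /= mulr_sumr.
Qed.

End SurfaceIntegral.

(** * Surface finite elements *)

Lemma cvgr_sum {R : realType} {T I : Type} (F : set_system T) {FF : Filter F}
    (s : seq I) (f : I -> T -> R) (l : I -> R) :
  (forall i, f i x @[x --> F] --> l i) ->
  \sum_(i <- s) f i x @[x --> F] --> \sum_(i <- s) l i.
Proof.
move=> fl; elim: s => [|i s IHs].
  rewrite big_nil (_ : (fun x => _) = fun=> 0); first exact: cvg_cst.
  by apply/funext => x; rewrite big_nil.
rewrite big_cons (_ : (fun x => _) = fun x => f i x + \sum_(j <- s) f j x).
  by apply: cvgD; [exact: fl|exact: IHs].
by apply/funext => x; rewrite big_cons.
Qed.

Section FiniteElements.
Context {R : realType} {n J : nat}.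
Notation V := 'rV[R]_n.+1.
Variable p : 'I_J -> 'I_n.+1 -> V.
Hypothesis p_nd : forall j, Defs.nondegenerate (p j).

Lemma simplex_surface j : simplex (p j) `<=` surface p.
Proof. by move=> x sx; exists j => //; exact: subset_closure. Qed.

Lemma vertex_closure j l : closure (simplex (p j)) (p j l).
Proof.
apply/(closure_simplexP (p_nd j)); split; last by move=> i; rewrite bary_vertex.
have -> : p j l = \sum_i (i == l)%:R *: p j i.
  rewrite (bigD1 l)//= eqxx scale1r big1 ?addr0// => i /negbTE ->.
  by rewrite scale0r.
apply: affine_hull_comb; rewrite (bigD1 l)//= eqxx big1 ?addr0// => i /negbTE ->//.
Qed.

Lemma within_simplex_proper j x : closure (simplex (p j)) x ->
  ProperFilter (within (simplex (p j)) (nbhs x)).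
Proof. exact: within_nbhs_proper. Qed.

Lemma within_vertex_proper j i : ProperFilter (within (simplex (p j)) (nbhs (p j i))).
Proof. exact/within_simplex_proper/vertex_closure. Qed.

Lemma surface_cvg (f : V -> R) j x : {within surface p, continuous f} ->
  closure (simplex (p j)) x ->
  f y @[y --> within (simplex (p j)) (nbhs x)] --> f x.
Proof.
move=> /subspace_continuousP cf cx P Pfx.
have := cf x (ex_intro2 _ _ j I cx) P Pfx; apply: nbhs_rVS => y h sy.
by apply: h; exact: simplex_surface sy.
Qed.

(** Affinity is given on the open element; continuity on the surface and uniqueness of limits from
    within the element carry it to the closure, in particular to the vertices. *)
Lemma surf_fe_bary (f : V -> R) j x : surf_fe p f -> closure (simplex (p j)) x ->
  f x = \sum_i f (p j i) * bary (p j) i x.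
Proof.
move=> [cf /(_ j)[a [b fab]]] cx.
have aff y : closure (simplex (p j)) y -> f y = dotv a y + b.
  move=> cy; have PF := within_simplex_proper cy.
  have h1 := surface_cvg cf cy.
  have h2 : f z @[z --> within (simplex (p j)) (nbhs y)] --> dotv a y + b.
    move=> P Py.
    have c2 : {for y, continuous (fun z => dotv a z + b)}.
      apply: (@continuous_comp _ _ _ (fun z => dotv a z) (fun r => r + b)).
        exact: dotv_continuous.
      by apply: cvgD; [exact: cvg_id|exact: cvg_cst].
    have := c2 P Py; apply: nbhs_rVS => z /= Pz sz; by rewrite fab.
  exact: (cvg_unique (@Rhausdorff R) h1 h2).
have /(closure_simplexP (p_nd j))[hx x0] := cx.
under eq_bigr do rewrite (aff _ (@vertex_closure _ _)) mulrDl.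
rewrite big_split /= -mulr_sumr sum_bary mulr1 aff//; congr (_ + _).
rewrite {1}(affine_hull_bary (p_nd j) hx) dotv_sumr.
by apply: eq_bigr => i _; rewrite dotvZr mulrC.
Qed.

Lemma lumped_integralE (f : V -> R) (l : 'I_J -> 'I_n.+1 -> R) :
  (forall j i, f y @[y --> within (simplex (p j)) (nbhs (p j i))] --> l j i) ->
  lumped_integral p f = n.+1%:R^-1 * \sum_j area p j * \sum_i l j i.
Proof.
move=> fl; rewrite /lumped_integral; congr (_ * _); apply: eq_bigr => j _.
congr (_ * _); apply: eq_bigr => i _.
have PF := @within_vertex_proper j i.
exact: (cvg_lim (@Rhausdorff R) (fl j i)).
Qed.

Lemma lumped_ipE (f g : V -> R) : surf_fe p f -> surf_fe p g ->
  lumped_ip p f g = n.+1%:R^-1 * \sum_j area p j * \sum_i f (p j i) * g (p j i).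
Proof.
move=> [cf _] [cg _]; apply: lumped_integralE => j i.
have PF := @within_vertex_proper j i.
by apply: cvgM; apply: surface_cvg => //; exact: vertex_closure.
Qed.

Lemma lumped_ipv_lim (u v : V -> V) (l : 'I_J -> 'I_n.+1 -> 'I_n.+1 -> R) :
  (forall j i c, u y 0 c @[y --> within (simplex (p j)) (nbhs (p j i))] --> l j i c) ->
  surf_fev p v ->
  lumped_ipv p u v = n.+1%:R^-1 * \sum_j area p j * \sum_i \sum_c l j i c * v (p j i) 0 c.
Proof.
move=> cu fv; apply: lumped_integralE => j i.
have PF := @within_vertex_proper j i.
apply: cvgr_sum => c; apply: cvgM; first exact: cu.
by apply: (surface_cvg (f := fun y => v y 0 c)); [case: (fv c)|exact: vertex_closure].
Qed.

Lemma lumped_ipvE (u v : V -> V) : surf_fev p u -> surf_fev p v ->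
  lumped_ipv p u v = n.+1%:R^-1 * \sum_j area p j * \sum_i dotv (u (p j i)) (v (p j i)).
Proof.
move=> fu fv; rewrite (lumped_ipv_lim (l := fun j i c => u (p j i) 0 c))// => j i c.
by apply: (surface_cvg (f := fun y => u y 0 c)); [case: (fu c)|exact: vertex_closure].
Qed.

Lemma lumped_ipv_scaleE (f : V -> R) (u v : V -> V) :
  surf_fe p f -> surf_fev p u -> surf_fev p v ->
  lumped_ipv p (fun x => f x *: u x) v =
  n.+1%:R^-1 * \sum_j area p j * \sum_i f (p j i) * dotv (u (p j i)) (v (p j i)).
Proof.
move=> [cf _] fu fv.
rewrite (lumped_ipv_lim (l := fun j i c => f (p j i) * u (p j i) 0 c))// => [|j i c].
  congr (_ * _); apply: eq_bigr => j _; congr (_ * _); apply: eq_bigr => i _.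
  by rewrite /dotv mulr_sumr; apply: eq_bigr => c _; rewrite mulrA.
have PF := @within_vertex_proper j i.
under eq_fun do rewrite mxE; apply: cvgM.
  by apply: surface_cvg => //; exact: vertex_closure.
by apply: (surface_cvg (f := fun y => u y 0 c)); [case: (fu c)|exact: vertex_closure].
Qed.

Lemma affine_surf_fe (a : V) (b : R) : surf_fe p (fun x => dotv a x + b).
Proof.
split; last by move=> j; exists a, b.
apply: continuous_subspaceT => x.
apply: (@continuous_comp _ _ _ (fun z => dotv a z) (fun r => r + b)).
  exact: dotv_continuous.
by apply: cvgD; [exact: cvg_id|exact: cvg_cst].
Qed.

Lemma surf_feB (f g : V -> R) : surf_fe p f -> surf_fe p g -> surf_fe p (fun x => f x - g x).
Proof.
move=> [cf af] [cg ag]; split; first by move=> x; apply: cvgB; [exact: cf|exact: cg].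
move=> j; have [a [b h]] := af j; have [a' [b' h']] := ag j.
by exists (a - a'), (b - b') => x sx; rewrite h// h'// dotvBl; ring.
Qed.

End FiniteElements.

Section NodalInterpolation.
Context {R : realType} {n J : nat}.
Notation V := 'rV[R]_n.+1.
Variable p : 'I_J -> 'I_n.+1 -> V.
Hypothesis p_cx : simplicial_complex p.

Let p_nd j : Defs.nondegenerate (p j). Proof. by case: p_cx. Qed.

Lemma face_baryP j (A : {set 'I_n.+1}) x : face (p j) A x ->
  [/\ x = \sum_i bary (p j) i x *: p j i, forall i, 0 <= bary (p j) i x &
      forall i, i \notin A -> bary (p j) i x = 0].
Proof.
move=> [c [c0 cA c1 ->]].
split=> [|i|i iA]; last 2 first.
- by rewrite baryE.
- by rewrite baryE// cA.
by apply: eq_bigr => i _; rewrite baryE.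
Qed.

Lemma vertex_face j (A : {set 'I_n.+1}) a : a \in A -> face (p j) A (p j a).
Proof.
move=> aA; exists (fun i => (i == a)%:R); split=> //.
- by move=> i iA; case: eqP => // ia; rewrite ia aA in iA.
- by rewrite (bigD1 a)//= eqxx big1 ?addr0// => i /negbTE ->.
- rewrite (bigD1 a)//= eqxx scale1r big1 ?addr0// => i /negbTE ->.
  by rewrite scale0r.
Qed.

(** A vertex is an extreme point of its face. Written as a convex combination of vertices of the
    other element, it coincides with each of them that has positive weight, since their barycentric
    coordinates other than the [a]-th must vanish. *)
Lemma face_vertex_match i j (A B : {set 'I_n.+1}) a :
  face (p i) A = face (p j) B -> a \in A -> exists2 b, b \in B & p j b = p i a.
Proof.
move=> AB aA; have := vertex_face i aA; rewrite AB => -[c [c0 cB c1 ac]].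
have [b bpos] : exists b, 0 < c b.
  apply: contrapT => h; have : \sum_i c i = 0.
    apply: big1 => b _; apply/eqP; rewrite eq_le c0 andbT leNgt; apply/negP => cb.
    by apply: h; exists b.
  by rewrite c1 => /eqP; rewrite oner_eq0.
have bB : b \in B by apply/negPn/negP => /cB cb; rewrite cb ltxx in bpos.
exists b => //.
have fb b' : c b' != 0 -> face (p i) A (p j b').
  move=> cb'; rewrite AB; apply: vertex_face; apply/negPn/negP => /cB h.
  by rewrite h eqxx in cb'.
have [xE _ _] := face_baryP (fb b (lt0r_neq0 bpos)).
have zero l : l != a -> bary (p i) l (p j b) = 0.
  move=> la; have : bary (p i) l (p i a) = 0 by rewrite bary_vertex// (negbTE la).
  rewrite ac bary_comb// => /eqP; rewrite psumr_eq0; last first.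
    move=> b' _; have [->|cb'] := eqVneq (c b') 0; first by rewrite mul0r.
    by rewrite mulr_ge0//; have [_ ->] := face_baryP (fb b' cb').
  move=> /allP/(_ b); rewrite mem_index_enum => /(_ isT).
  by rewrite mulf_eq0 (gt_eqF bpos) => /eqP.
have one : bary (p i) a (p j b) = 1.
  by rewrite -(sum_bary (p i) (p j b)) (bigD1 a)//= big1 ?addr0// => l /zero.
rewrite xE (bigD1 a)//= one scale1r big1 ?addr0// => l /zero ->.
by rewrite scale0r.
Qed.

Let interp (v : V -> R) j (x : V) := \sum_i v (p j i) * bary (p j) i x.

Let interp_vertex v j i : interp v j (p j i) = v (p j i).
Proof.
rewrite /interp (bigD1 i)//= bary_vertex// eqxx mulr1 big1 ?addr0// => l li.
by rewrite bary_vertex// (negbTE li) mulr0.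
Qed.

Let interp_comb v j (I : finType) (c : I -> R) (y : I -> V) : \sum_l c l = 1 ->
  interp v j (\sum_l c l *: y l) = \sum_l c l * interp v j (y l).
Proof.
move=> c1; rewrite /interp; under eq_bigr do rewrite bary_comb// mulr_sumr.
rewrite exchange_big /=; apply: eq_bigr => l _; rewrite mulr_sumr.
by apply: eq_bigr => i _; rewrite mulrCA.
Qed.

Let interp_consistent v i j x : closure (simplex (p i)) x -> closure (simplex (p j)) x ->
  interp v i x = interp v j x.
Proof.
move=> xi xj; have [->//|ij] := eqVneq i j.
have [_ _ /(_ i j ij)[I0|[A [B [_ _ IA IB]]]]] := p_cx.
  have : (closure (simplex (p i)) `&` closure (simplex (p j))) x by [].
  by rewrite I0.
have : face (p i) A x by rewrite -IA.
move=> /[dup] /face_baryP[_ _ x0] [c [c0 cA c1 xE]].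
rewrite xE !interp_comb//; apply: eq_bigr => a _.
have [aA|/cA ->] := boolP (a \in A); last by rewrite !mul0r.
have [b bB ba] := face_vertex_match (etrans (esym IA) IB) aA.
by rewrite -{2}ba !interp_vertex ba.
Qed.

Let interp_continuous v j : continuous (interp v j).
Proof.
move=> x; apply: (@cvgr_sum _ _ _ (nbhs x) (nbhs_filter x)) => i.
apply: (@cvgM _ _ _ (nbhs_filter x)); first exact: cvg_cst.
exact: bary_continuous.
Qed.

(** Ensures that [nodal_interp] is not the default value of [xget]. The affine pieces glue because
    two elements meet in a common face with matching vertices. *)
Lemma nodal_interpolant_exists (v : V -> R) :
  exists g, surf_fe p g /\ forall j k, g (p j k) = v (p j k).
Proof.
pose g x := oapp (fun j => interp v j x) 0 [pick j | `[< closure (simplex (p j)) x >]].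
have gE j x : closure (simplex (p j)) x -> g x = interp v j x.
  move=> cx; rewrite /g; case: pickP => [i /asboolP ci|/(_ j)] /=.
    exact: interp_consistent.
  by rewrite asboolT.
exists g; split; last first.
  by move=> j k; rewrite (gE j) ?interp_vertex//; exact: vertex_closure.
split=> [|j].
  apply/subspace_continuousP => x [j0 _ cx0] P /nbhs_ballP[e /= e0 he].
  (* Elements whose closure misses [x] miss a neighborhood of [x], so only the finitely many pieces
     through [x], which agree there, have to be controlled. *)
  have : \forall y \near x, forall j, closure (simplex (p j)) y -> P (g y).
    apply: nbhs_rV_forall => j; have [cx|ncx] := pselect (closure (simplex (p j)) x).
      have : nbhs (interp v j x) (ball (g x) e).
        by rewrite -(gE j x cx); exact: nbhsx_ballx.
      move/(@interp_continuous v j x); apply: nbhs_rVS => y hy cy; apply: he.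
      by rewrite (gE j y cy).
    have : nbhs x (~` closure (simplex (p j))).
      by apply: open_nbhs_nbhs; split=> //; exact/closed_openC/closed_closure.
    by apply: nbhs_rVS => y ny cy.
  by apply: nbhs_rVS => y h [j _ cy]; exact: h cy.
have [ab abP] := choice (fun i => bary_affine (p j) i).
have [b bP] := choice abP.
exists (\sum_i v (p j i) *: ab i), (\sum_i v (p j i) * b i) => x sx.
rewrite (gE j); last exact: subset_closure.
rewrite dotv_suml -big_split /=; apply: eq_bigr => i _.
by rewrite bP dotvZl mulrDr.
Qed.

Lemma nodal_interpP (v : V -> R) :
  surf_fe p (nodal_interp p v) /\ forall j k, nodal_interp p v (p j k) = v (p j k).
Proof. exact: (xgetPex (fun=> 0) (nodal_interpolant_exists v)). Qed.

End NodalInterpolation.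

(** * Crossings of a segment with a closed polyhedral hypersurface *)

(** Connectedness of the unit interval: the function [H] with values 0 and 1 is continuous, and by
    the intermediate value theorem a jump would force it to take the value 1/2. *)
Lemma locally_constant (R : realType) (T : Type) (G : R -> T) :
  (forall s : R, 0 <= s <= 1 -> \forall s' \near s, G s' = G s) -> G 0 = G 1.
Proof.
move=> Gloc; apply: contrapT => G01.
pose H (s : R) : R := if pselect (G s = G 0) then 0 else 1.
have cH : {within `[0, 1], continuous H}.
  apply/subspace_continuousP => s; rewrite /= in_itv /= => s01.
  apply: (@cvg_trans _ (H x @[x --> s])); first exact: cvg_app (cvg_within _).
  have HH : H x @[x --> s] --> H s; last exact: HH.
  by apply: cvg_near_cst; apply: filterS (Gloc s s01) => s' es; rewrite /H es.
have H0 : H 0 = 0 by rewrite /H; case: pselect.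
have H1 : H 1 = 1 by rewrite /H; case: pselect => // e; case: G01.
have [|c _ Hc] := IVT (v := 2^-1) ler01 cH.
  rewrite H0 H1 /Num.min /Num.max ltr01; apply/andP; split; lra.
move: Hc; rewrite /H; case: pselect => _ /eqP.
  by rewrite eq_sym invr_eq0 pnatr_eq0.
by move/eqP; lra.
Qed.

Lemma exists_nonroot (R : realType) (P : {poly R}) : P != 0 -> exists t, ~~ root P t.
Proof.
move=> P0; apply: contrapT => h.
have ar : all (root P) [seq k%:R | k <- iota 0 (size P)].
  by apply/allP => x _; apply/negPn/negP => nx; apply: h; exists x.
have := max_poly_roots P0 ar.
rewrite map_inj_uniq ?iota_uniq; last by move=> i j /eqP; rewrite eqr_nat => /eqP.
by rewrite size_map size_iota ltnn => /(_ isT).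
Qed.

(** The vector is taken on the moment curve [(t, t^2, ..., t^d)], where each excluded equation
    becomes a polynomial equation in [t]. Exponents start at 1, so the constant [b i] cannot cancel
    a nonzero coefficient. *)
Lemma generic_vector (R : realType) (d : nat) (I : finType) (c : I -> 'rV[R]_d)
    (b : I -> R) :
  (forall i, c i != 0) -> exists v, forall i, dotv (c i) v != b i.
Proof.
move=> c0; pose Q i : {poly R} := \sum_k (c i 0 k)%:P * 'X^(k.+1) - (b i)%:P.
have coefQ i (k : 'I_d) : (Q i)`_k.+1 = c i 0 k.
  rewrite coefB coefC /= subr0 coef_sum (bigD1 k)//= coefCM coefXn eqxx mulr1.
  rewrite big1 ?addr0// => l lk; rewrite coefCM coefXn eqSS.
  by rewrite (negbTE (_ : k != l :> nat)) ?mulr0// eq_sym.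
have Q0 : \prod_i Q i != 0.
  apply/prodf_neq0 => i _; apply/negP => /eqP Q0; move/eqP: (c0 i); apply.
  by apply/rowP => k; rewrite mxE -coefQ Q0 coef0.
have [t nr] := exists_nonroot Q0.
exists (\row_k t ^+ k.+1) => i; apply: contraNN nr => /eqP bi.
rewrite /root horner_prod; apply/prodf_eq0; exists i => //.
rewrite hornerE horner_sum hornerN hornerC -bi subr_eq0 /dotv; apply/eqP.
by apply: eq_bigr => k _; rewrite !hornerE mxE.
Qed.

Section PolyhedralInterior.
Context {R : realType} {n J : nat}.
Notation V := 'rV[R]_n.+1.
Variables (p : 'I_J -> 'I_n.+1 -> V) (D : set V).
Hypothesis pD : closed_polyhedral_hypersurface p D.

Let p_cx : simplicial_complex p. Proof. by case: pD. Qed.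

Let p_nd j : Defs.nondegenerate (p j). Proof. by case: p_cx. Qed.

Lemma interior_off_surface x : D x -> ~ surface p x.
Proof. by have [_ _ _ <- _] := pD; move=> Dx [_ /(_ Dx)]. Qed.

Lemma vertex_inj (q : 'I_n.+1 -> V) : Defs.nondegenerate q -> injective q.
Proof.
move=> nd a b qab; have := bary_vertex nd a a; rewrite qab bary_vertex// eqxx.
by case: eqP => // _ /eqP; rewrite eq_sym oner_eq0.
Qed.

(** Since all coordinates of [x] in the element [j] are positive, a face of it that contains [x] has
    all of its vertices. Matching these with vertices of the element [i] makes the two open
    simplices coincide, against their disjointness. *)
Lemma simplex_unique i j x : simplex (p j) x -> closure (simplex (p i)) x -> i = j.
Proof.
move=> sj ci; apply/eqP/negPn/negP => ij.
have [_ /(_ _ _ ij) dis /(_ _ _ ij)] := p_cx.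
have Ix : (closure (simplex (p i)) `&` closure (simplex (p j))) x.
  by split=> //; exact: subset_closure.
case=> [I0|[A [B [_ _ IA IB]]]]; first by rewrite I0 in Ix.
have /face_baryP : face (p j) B x by rewrite -IB.
move=> /(_ p_cx)[_ _ xB].
have BT b : b \in B.
  apply/negPn/negP => /xB bx; have [_ /(_ b)] := proj1 (simplexP (p_nd j) x) sj.
  by rewrite bx ltxx.
have /choice[f fP] b : exists a, p i a = p j b.
  by have [a _ ?] := face_vertex_match p_cx (etrans (esym IB) IA) (BT b); exists a.
have finj : injective f.
  by move=> b b' ff; apply: (vertex_inj (p_nd j)); rewrite -!fP ff.
have [c [c0 c1 xE]] := sj; pose g := invF finj.
have : (simplex (p i) `&` simplex (p j)) x; last by rewrite dis.
split=> //; exists (c \o g); split=> [a||]; first exact: c0.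
  rewrite -c1 (reindex f) /=; last by exists g => a _; rewrite /g ?invF_f ?f_invF.
  by apply: eq_bigr => b _; rewrite /g invF_f.
rewrite xE [RHS](reindex f) /=; last by exists g => a _; rewrite /g ?invF_f ?f_invF.
by apply: eq_bigr => b _; rewrite fP /g invF_f.
Qed.

Lemma closure_plane j x : closure (simplex (p j)) x ->
  dotv (wedgev (edges (p j))) x = dotv (wedgev (edges (p j))) (p j ord0).
Proof.
move=> /(closure_simplexP (p_nd j))[hx _]; apply/eqP; rewrite -subr_eq0 -dotvBr.
have -> : x - p j ord0 = row 0 (x - p j ord0) by rewrite row_id.
by rewrite dotvC dotv_wedge_submx.
Qed.

Lemma simplex_plane j x : simplex (p j) x ->
  dotv (wedgev (edges (p j))) x = dotv (wedgev (edges (p j))) (p j ord0).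
Proof. by move=> sx; apply: closure_plane; exact: subset_closure. Qed.

Lemma off_surface x : ~ surface p x -> \forall y \near x, D y = D x.
Proof.
have [_ oD _ DS _] := pD => nx; have [Dx|nD] := pselect (D x).
  have : nbhs x D by exact: open_nbhs_nbhs.
  by apply: nbhs_rVS => y Dy; apply/propext.
have : nbhs x (~` closure D).
  apply: open_nbhs_nbhs; split; first exact/closed_openC/closed_closure.
  by move=> cx; apply: nx; rewrite -DS.
apply: nbhs_rVS => y ny; apply/propext; split=> // Dy; case: ny.
exact: subset_closure.
Qed.

Lemma nbhs_line (a e : V) (s : R) (P : set V) : nbhs (a + s *: e) P ->
  \forall s' \near s, P (a + s' *: e).
Proof.
have c : (fun s : R => a + s *: e) s' @[s' --> s] --> a + s *: e.
  by apply: cvgD; [exact: cvg_cst|apply: cvgZr_tmp; exact: cvg_id].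
by move=> /c.
Qed.

Lemma segment_off_surface a e :
  (forall s, 0 <= s <= 1 -> ~ surface p (a + s *: e)) -> D (a + e) = D a.
Proof.
move=> h; have := @locally_constant R _ (fun s => D (a + s *: e)).
rewrite scale0r addr0 scale1r => -> // s s01.
by have := nbhs_line (off_surface (h s s01)).
Qed.

(** The definition of the interior speaks only of points on the normal through [x]. Near [x] the
    surface lies in the plane of the element, so a point strictly on one side is joined to a point
    of the normal by a segment that avoids the surface. *)
Lemma interior_local j x : simplex (p j) x -> let w := wedgev (edges (p j)) in
  \forall y \near x, (dotv w y < dotv w x -> D y) /\ (dotv w x < dotv w y -> ~ D y).
Proof.
move=> sx w; have [_ _ _ _ /(_ j x sx) nu] := pD.
have : \forall y \near x, forall i, closure (simplex (p i)) y -> dotv w y = dotv w x.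
  apply: nbhs_rV_forall => i; have [<-|ij] := eqVneq j i.
    have : nbhs x setT by exact: (@filterT _ _ (nbhs_filter x)).
    by apply: nbhs_rVS => y _ cy; rewrite closure_plane// simplex_plane.
  have : nbhs x (~` closure (simplex (p i))).
    apply: open_nbhs_nbhs; split; first exact/closed_openC/closed_closure.
    by move=> /(simplex_unique sx) e; rewrite e eqxx in ij.
  by apply: nbhs_rVS.
move=> /near_rV[e e0 eP].
have w0 : 0 < dotv w w by rewrite dotv_gt0 wedge_neq0// p_nd.
have wu : 0 < dotv w (unit_normal p j).
  by rewrite /unit_normal dotvZr mulr_gt0// invr_gt0 enorm_gt0 wedge_neq0// p_nd.
move: (unit_normal p j) nu wu => u nu wu.
have [s [s0 se [Ds nDs]]] : exists s, [/\ 0 < s, forall i, `|(s *: u) 0 i| < e &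
    D (x - s *: u) /\ ~ D (x + s *: u)].
  have sm : \forall s \near 0^'+, s * (\sum_i `|u 0 i|) < e.
    have : s * (\sum_i `|u 0 i|) @[s --> 0^'+] --> 0 * (\sum_i `|u 0 i|).
      by apply: cvgMr_tmp; apply: cvg_at_right_filter; exact: cvg_id.
    by rewrite mul0r => /cvgr_lt; exact.
  near (0 : R)^'+ => s; exists s; split.
  - by near: s; exact: nbhs_right_gt.
  - move=> i; rewrite mxE normrM; apply: le_lt_trans (_ : s * (\sum_i `|u 0 i|) < e).
      rewrite ger0_norm; last by apply: ltW; near: s; exact: nbhs_right_gt.
      have s0 : 0 <= s by apply: ltW; near: s; exact: nbhs_right_gt.
      by rewrite ler_wpM2l// (bigD1 i)//= lerDl sumr_ge0.
    by near: s.
  - by near: s.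
apply/near_rV; exists e => // y ye.
have seg (v : V) : (forall i, `|v 0 i| < e) ->
    (forall t : R, 0 <= t <= 1 -> dotv w ((1 - t) *: (y - x) + t *: v) != 0) ->
    D (x + v) = D y.
  move=> ve hv; have -> : x + v = y + (x + v - y) by rewrite [RHS]addrC subrK.
  apply: segment_off_surface => t t01 [i _] ci.
  have : dotv w (y + t *: (x + v - y)) = dotv w x.
    apply: (eP _ _ i ci) => l; rewrite !mxE.
    have -> : y 0 l + t * (x 0 l + v 0 l - y 0 l) - x 0 l =
       (1 - t) * (y 0 l - x 0 l) + t * v 0 l by ring.
    case/andP: t01 => t0 t1; have := ye l; have := ve l; rewrite !ltr_norml.
    have [->|tn0] := eqVneq t 0; first by rewrite subr0 mul1r mul0r addr0.
    have tp : 0 < t by rewrite lt_def tn0.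
    move=> /andP[a1 a2] /andP[b1 b2]; apply/andP; split; nra.
  move=> h; have /negP := hv t t01; apply; apply/eqP.
  by move: h; rewrite !(dotvDr, dotvZr, dotvNr) => h; nra.
split=> wy.
  rewrite -(seg (- (s *: u)))// => [i|t /andP[t0 t1]]; first by rewrite mxE normrN se.
  rewrite !(dotvDr, dotvZr, dotvNr) lt_eqF//.
  have := mulr_gt0 s0 wu; have [->|tn0] := eqVneq t 0 => h; first lra.
  have tp : 0 < t by rewrite lt_def tn0.
  nra.
rewrite -(seg (s *: u))// => t /andP[t0 t1].
rewrite !(dotvDr, dotvZr, dotvNr) gt_eqF//.
have := mulr_gt0 s0 wu; have [->|tn0] := eqVneq t 0 => h; first lra.
have tp : 0 < t by rewrite lt_def tn0.
nra.
Unshelve. all: by end_near. Qed.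

Definition crossing (a e : V) j : Prop :=
  exists2 s, 0 <= s <= 1 & simplex (p j) (a + s *: e).

(* The jump of the indicator of [D] along a segment is compensated by one step
   function per crossed element, which makes the sum locally constant. *)
Lemma crossing_sum (a e : V) :
  (forall s j, 0 <= s <= 1 -> closure (simplex (p j)) (a + s *: e) ->
     simplex (p j) (a + s *: e) /\ dotv (wedgev (edges (p j))) e != 0) ->
  ~ surface p a -> ~ surface p (a + e) ->
  `[< D (a + e) >]%:R - `[< D a >]%:R =
  - \sum_j Num.sg (dotv (wedgev (edges (p j))) e) * `[< crossing a e j >]%:R :> R.
Proof.
move=> trans na nae; pose w j := wedgev (edges (p j)).
pose t j := (dotv (w j) (p j ord0) - dotv (w j) a) / dotv (w j) e.
have tE j s : dotv (w j) e != 0 -> simplex (p j) (a + s *: e) -> s = t j.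
  move=> we /simplex_plane; rewrite -/(w j) dotvDr dotvZr /t => <-.
  by rewrite addrAC subrr add0r mulfK.
(* At the crossing parameter [t j] the point is on the surface, hence outside the open set [D]. When
   the segment leaves [D], the indicator has already dropped at [t j]; when it enters, the indicator
   rises only after [t j]. This is why one comparison is weak and the other strict. *)
pose c j (s : R) : R := `[< crossing a e j >]%:R *
  (if 0 < dotv (w j) e then (t j <= s)%R%:R else - (t j < s)%R%:R).
pose G s := `[< D (a + s *: e) >]%:R + \sum_j c j s.
have cE j : dotv (w j) e != 0 -> c j 1 - c j 0 =
    Num.sg (dotv (w j) e) * `[< crossing a e j >]%:R.
  move=> we; rewrite /c; case: asboolP => [[s s01 hs]|_]; last by rewrite !mul0r mulr0 subrr.
  have st := tE _ _ we hs; rewrite -{}st !mul1r mulr1.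
  have s0 : s != 0.
    apply/eqP => s0; apply: na; apply: (@simplex_surface _ _ _ p j).
    by move: hs; rewrite s0 scale0r addr0.
  have s1 : s != 1.
    apply/eqP => s1; apply: nae; apply: (@simplex_surface _ _ _ p j).
    by move: hs; rewrite s1 scale1r.
  have {}s0 : 0 < s by rewrite lt_def s0; case/andP: s01.
  have {}s1 : s < 1 by rewrite lt_def eq_sym s1; case/andP: s01.
  case: ifPn => [wp|]; first by rewrite (ltW s1) leNgt s0 gtr0_sg// subr0.
  rewrite -leNgt le_eqVlt (negbTE we) /= => wn.
  by rewrite s1 ltNge (ltW s0) ltr0_sg//= oppr0 subr0.
have cE' j : c j 1 - c j 0 = Num.sg (dotv (w j) e) * `[< crossing a e j >]%:R.
  have [we|] := eqVneq (dotv (w j) e) 0; last exact: cE.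
  rewrite we sgr0 mul0r /c; case: asboolP => [[s s01 hs]|_]; last by rewrite !mul0r subrr.
  have [_] := trans s j s01 (subset_closure hs).
  by rewrite -/(w j) we eqxx.
suff : G 0 = G 1.
  rewrite /G scale0r addr0 scale1r => /eqP; rewrite eq_sym -subr_eq => /eqP G01.
  rewrite -(eq_bigr _ (fun j _ => cE' j)) big_split /= sumrN -/(w _).
  by move: G01; rewrite -addrA => <-; ring.
apply: locally_constant => s s01.
have cloc j : s != t j -> \forall s' \near s, c j s' = c j s.
  rewrite neq_lt => /orP[] lt.
    apply: filterS (lt_nbhsl lt) => s' h; rewrite /c.
    by rewrite !leNgt h lt /= [t j < s']ltNge (ltW h) [t j < s]ltNge (ltW lt).
  apply: filterS (lt_nbhsr lt) => s' h; rewrite /c.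
  by rewrite h lt !ltW.
have [[j _ cj]|ns] := pselect (surface p (a + s *: e)); last first.
  have off : \forall s' \near s, D (a + s' *: e) = D (a + s *: e).
    by have := nbhs_line (off_surface ns).
  have call : \forall s' \near s, forall j, c j s' = c j s.
    apply: (@filter_forall R _ (fun j s' => c j s' = c j s) (nbhs s)) => j.
    have [st|] := eqVneq s (t j); last exact: cloc.
    near=> s'; rewrite /c; case: asboolP => [[s1 s101 hs]|_]; last by rewrite !mul0r.
    have [_ we] := trans _ j s101 (subset_closure hs).
    exfalso; apply: ns; apply: (@simplex_surface _ _ _ p j).
    by rewrite st -(tE _ _ we hs).
  near=> s'; rewrite /G; congr (_%:R + _).
    by congr (asbool _); near: s'.
  have ca : forall j, c j s' = c j s by near: s'.
  exact: eq_bigr.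
have [sj we] := trans s j s01 cj; have st := tE _ _ we sj.
have call : \forall s' \near s, forall i, i != j -> c i s' = c i s.
  apply: (@filter_forall R _ (fun i s' => i != j -> c i s' = c i s) (nbhs s)) => i.
  have [st'|si] := eqVneq s (t i); last first.
    by apply: filterS (cloc i si).
  near=> s'; move=> ij; rewrite /c; case: asboolP => [[s1 s101 hs]|_]; last by rewrite !mul0r.
  have [_ wi] := trans _ i s101 (subset_closure hs).
  have si : simplex (p i) (a + s *: e) by rewrite st' -(tE _ _ wi hs).
  by move: ij; rewrite (simplex_unique sj (subset_closure si)) eqxx.
have cr : crossing a e j by exists s.
have nD : ~ D (a + s *: e).
  by move=> /interior_off_surface; apply; exists j.
have loc : \forall s' \near s,
    (s' * dotv (w j) e < s * dotv (w j) e -> D (a + s' *: e)) /\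
    (s * dotv (w j) e < s' * dotv (w j) e -> ~ D (a + s' *: e)).
  have := nbhs_line (interior_local sj); apply: filterS => s'.
  by rewrite -/(w j) !dotvDr !dotvZr !ltrD2l.
near=> s'; rewrite /G (bigD1 j)//= [in RHS](bigD1 j)//= !addrA; congr (_ + _); last first.
  have ca : forall i, i != j -> c i s' = c i s by near: s'.
  exact: eq_bigr.
have [l1 l2] : (s' * dotv (w j) e < s * dotv (w j) e -> D (a + s' *: e)) /\
    (s * dotv (w j) e < s' * dotv (w j) e -> ~ D (a + s' *: e)) by near: s'.
rewrite /c (asboolT cr) !mul1r -st lexx ltxx (asboolF nD).
have [wp|wn|w0] := ltgtP 0 (dotv (w j) e); last by rewrite -w0 eqxx in we.
  rewrite !ltr_pM2r// in l1 l2; have [ss|ss|ss] := ltgtP s s'.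
  - by rewrite (asboolF (l2 ss)).
  - by rewrite (asboolT (l1 ss)) addrC.
  - by rewrite -ss (asboolF nD).
rewrite !ltr_nM2r// in l1 l2; have [ss|ss|ss] := ltgtP s s'.
- by rewrite (asboolT (l1 ss)) subrr oppr0 addr0.
- by rewrite (asboolF (l2 ss)).
- by rewrite -ss (asboolF nD).
Unshelve. all: by end_near. Qed.

End PolyhedralInterior.

(** * The enclosed volume as a sum of determinants *)

Section EnclosedVolume.
Context {R : realType} {n : nat}.
Notation V := 'rV[R]_n.+1.

Definition vertex_mx (q : 'I_n.+1 -> V) : 'M[R]_n.+1 := \matrix_i q i.

Lemma mul_vertex_mx (q : 'I_n.+1 -> V) (y : V) : y *m vertex_mx q = \sum_i y 0 i *: q i.
Proof.
by rewrite mulmx_sum_row; apply: eq_bigr => i _; rewrite rowK.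
Qed.

Lemma wedge_vertex_mx (q : 'I_n.+1 -> V) :
  dotv (wedgev (edges q)) (q ord0) = (-1) ^+ n * \det (vertex_mx q).
Proof.
rewrite dotvC dotv_wedge; congr (_ * _).
have -> : vertex_mx q = (block_mx 1%:M 0 (const_mx 1) 1%:M : 'M[R]_(1 + n)) *m
    (col_mx (q ord0) (edges q) : 'M[R]_(1 + n)).
  rewrite mul_block_col mul1mx mul0mx addr0 mul1mx.
  apply/matrixP => i j; rewrite !mxE; case: splitP => k ik.
    by rewrite (_ : i = ord0) ?ord1//; apply: val_inj; rewrite /= ik ord1.
  rewrite mxE [X in _ = X + _]mxE big_ord1 !mxE mul1r [RHS]addrC (subrK (q ord0 0 j)).
  by rewrite (_ : i = lift ord0 k)//; apply: val_inj.
have := det_mulmx (block_mx 1%:M 0 (const_mx 1) 1%:M : 'M[R]_(1 + n))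
  (col_mx (q ord0) (edges q) : 'M[R]_(1 + n)).
by rewrite det_lblock !det1 !mul1r => ->.
Qed.

(** The open cone with apex at the origin, cut off at the element by the condition that the
    coordinates sum to less than 1. *)
Definition cone (q : 'I_n.+1 -> V) : set V := [set y *m vertex_mx q | y in std_simplex].

(** A normal to a hyperplane through the origin and the facet opposite to the vertex [i]. A ray from
    the origin that leaves these hyperplanes avoids all facets. *)
Lemma facet_normal (q : 'I_n.+1 -> V) i :
  exists2 h : V, h != 0 & forall k, k != i -> dotv h (q k) = 0.
Proof.
pose F : 'M[R]_(n, n.+1) := row' i (vertex_mx q).
have /rowV0Pn[h /sub_kermxP hF h0] : kermx F^T != 0.
  by rewrite kermx_eq0 /row_free mxrank_tr neq_ltn ltnS rank_leq_row.
exists h => // k ki; have /unlift_some[l -> _] : i != k by rewrite eq_sym.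
have /rowP/(_ l) := hF; rewrite mxE [RHS]mxE => <-.
by apply: eq_bigr => c _; rewrite !mxE.
Qed.

Lemma closure_bounded (D : set V) : bounded_set D ->
  exists B : R, forall x, closure D x -> forall i, `|x 0 i| <= B.
Proof.
move=> [M [_ MD]]; exists (M + 1 + 1) => x cx i.
have [y [Dy xy]] : exists y, D y /\ `|y 0 i - x 0 i| < 1.
  have nx : nbhs x [set y : V | forall i, `|y 0 i - x 0 i| < 1].
    by apply/near_rV; exists 1.
  by have [y [Dy h]] := cx _ nx; exists y.
have yM : `|y| <= M + 1 by apply: MD => //; rewrite ltrDl.
have yi : `|y 0 i| <= `|y|.
  have -> : `|y| = mx_norm y by [].
  by rewrite mx_normrE (le_bigmax _ _ (ord0, i)).
rewrite -(subrK (y 0 i) (x 0 i)) addrC (le_trans (ler_normD _ _))// lerD//.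
  exact: le_trans yi yM.
by rewrite distrC ltW.
Qed.

Context {J : nat}.
Variables (p : 'I_J -> 'I_n.+1 -> V) (D : set V).
Hypothesis pD : closed_polyhedral_hypersurface p D.

Let p_nd j : Defs.nondegenerate (p j). Proof. by case: pD => -[]. Qed.

Let w j := wedgev (edges (p j)).

Let s j := Num.sg ((-1) ^+ n * \det (vertex_mx (p j))).

Let facet j i := sval (cid2 (facet_normal (p j) i)).

Let facet_neq0 j i : facet j i != 0.
Proof. by rewrite /facet; case: cid2. Qed.

Let facetP j i k : k != i -> dotv (facet j i) (p j k) = 0.
Proof. by move: k; rewrite /facet; case: cid2. Qed.

(** The ray through [x] is transversal to all elements, [x] is in the plane of none of them, and the
    ray meets no facet. Only finitely many hyperplanes are excluded. *)
Let generic (x : V) := (forall j, dotv (w j) x != 0) /\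
  (forall j, dotv (w j) x != dotv (w j) (p j ord0)) /\
  forall ji : 'I_J * 'I_n.+1, dotv (facet ji.1 ji.2) x != 0.

(* The ray from [x] away from the origin leaves [D]; its signed crossings
   with the surface are the cones over the elements that contain [x]. *)
Let generic_indicator (j0 : 'I_J) x : generic x ->
  `[< D x >]%:R = \sum_j s j * `[< cone (p j) x >]%:R :> R.
Proof.
move=> [wx [wpx fx]].
have x0 : x != 0 by apply/eqP => x0; have := wx j0; rewrite x0 dotv0 eqxx.
have [B Bc] : exists B : R, forall x, closure D x -> forall i, `|x 0 i| <= B.
  by apply: closure_bounded; case: pD.
have [l l1 lout] : exists2 l : R, 1 < l & forall m, l <= m -> ~ closure D (m *: x).
  have [i xi] : exists i, x 0 i != 0.
    apply: contrapT => h; move/eqP: x0; apply; apply/rowP => i; rewrite mxE.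
    by apply/eqP/negPn/negP => xi; apply: h; exists i.
  have xp : 0 < `|x 0 i| by rewrite normr_gt0.
  exists (`|B| / `|x 0 i| + 2); first by rewrite ltr_wpDl// ?divr_ge0//; lra.
  move=> m lm /Bc/(_ i); rewrite mxE normrM; apply/negP; rewrite -ltNge.
  apply: (le_lt_trans (ler_norm B)).
  have : `|B| / `|x 0 i| < `|m|.
    by rewrite (lt_le_trans _ (ler_norm m))// (lt_le_trans _ lm)// ltrDl.
  by rewrite ltr_pdivrMr.
have sc y : surface p y -> closure D y by case: pD => _ _ _ <- _ [].
have line t : x + t *: ((l - 1) *: x) = (1 + t * (l - 1)) *: x.
  by rewrite scalerA scalerDl scale1r.
have open_hit m j : 0 < m -> closure (simplex (p j)) (m *: x) -> simplex (p j) (m *: x).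
  move=> m0 /(closure_simplexP (p_nd j))[hx b0].
  apply/(simplexP (p_nd j)); split=> // i; rewrite lt_def b0 andbT.
  apply/eqP => bi; have := fx (j, i); rewrite /=.
  have -> : dotv (facet j i) x = m^-1 * dotv (facet j i) (m *: x).
    by rewrite dotvZr mulKf// gt_eqF.
  rewrite (affine_hull_bary (p_nd j) hx) dotv_sumr big1 ?mulr0 ?eqxx// => k _.
  rewrite dotvZr; have [->|ki] := eqVneq k i; first by rewrite bi mul0r.
  by rewrite facetP// mulr0.
have wm m j : closure (simplex (p j)) (m *: x) -> m * dotv (w j) x = dotv (w j) (p j ord0).
  by move=> /(closure_plane pD); rewrite dotvZr.
have nsx : ~ surface p x.
  move=> [j _ cx]; have := wpx j.
  by rewrite -(wm 1) ?scale1r// mul1r eqxx.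
have lx : x + (l - 1) *: x = l *: x by rewrite -[X in X + _]scale1r -scalerDl addrC subrK.
have := crossing_sum pD (a := x) (e := (l - 1) *: x); rewrite lx.
have lgt0 : 0 < l - 1 by rewrite subr_gt0.
have -> : `[< D (l *: x) >] = false.
  by apply: asboolF => /subset_closure; exact: lout.
rewrite sub0r => cs; apply: oppr_inj; rewrite {}cs//; last first.
- by move=> /sc; exact: lout.
- move=> t j /andP[t0 t1]; rewrite line => cx; split.
    by apply: open_hit => //; rewrite ltr_pwDl// mulr_ge0// ltW.
  by rewrite dotvZr mulf_neq0 ?(gt_eqF lgt0)//; exact: wx.
congr (- _); apply: eq_bigr => j _; rewrite dotvZr sgrM gtr0_sg// mul1r.
(* If the coordinates of [x] in the cone sum to [S < 1], then [S^-1 *: x] is on the element, beyond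
   [x] and before the endpoint [l *: x] because the latter is outside the closure of [D]; conversely
   a hit at [m *: x] has [1 < m]. *)
have -> : `[< crossing p x ((l - 1) *: x) j >] = `[< cone (p j) x >].
  apply: asbool_equiv_eq; split.
    move=> [t /andP[t0 t1]]; rewrite line => sx.
    move: sx (subset_closure sx) => [c [c0 c1 xE]].
    set m := 1 + _ in xE * => cx.
    have m1 : 1 < m.
      have tl : 0 <= t * (l - 1) by rewrite mulr_ge0// (ltW lgt0).
      rewrite lt_def /m lerDl tl andbT; apply/eqP => m1.
      by apply: nsx; exists j => //; move: cx; rewrite /m m1 scale1r.
    have m0 : 0 < m by exact: lt_trans m1.
    exists (\row_i (m^-1 * c i)).
      split=> [i|]; first by rewrite mxE mulr_gt0// invr_gt0.
      under eq_bigr do rewrite mxE.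
      by rewrite -mulr_sumr c1 mulr1 invf_lt1.
    rewrite mul_vertex_mx; under eq_bigr do rewrite mxE -scalerA.
    by rewrite -scaler_sumr -xE scalerA mulVf ?scale1r// gt_eqF.
  move=> [y [y0 y1] yx].
  have S0 : 0 < \sum_i y 0 i.
    by rewrite (bigD1 ord0)//= ltr_pwDl// sumr_ge0// => i _; exact: ltW.
  have sx : simplex (p j) ((\sum_i y 0 i)^-1 *: x).
    exists (fun i => (\sum_i y 0 i)^-1 * y 0 i); split=> [i||].
    - by rewrite mulr_gt0// invr_gt0.
    - by rewrite -mulr_sumr mulVf// gt_eqF.
    rewrite -yx mul_vertex_mx scaler_sumr; apply: eq_bigr => i _.
    by rewrite scalerA.
  set m := _^-1 in sx.
  have m1 : 1 <= m by rewrite invf_ge1// ltW.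
  have ml : m < l.
    rewrite ltNge; apply/negP => /lout; apply; apply: sc.
    exact: simplex_surface sx.
  exists ((m - 1) / (l - 1)).
    by rewrite divr_ge0 ?subr_ge0 ?(ltW l1)//= ler_pdivrMr// mul1r lerB// ltW.
  by rewrite line divfK ?gt_eqF// addrC subrK.
case: asboolP => [[y [y0 y1] yx]|_]; last by rewrite !mulr0.
have S0 : 0 < \sum_i y 0 i.
  by rewrite (bigD1 ord0)//= ltr_pwDl// sumr_ge0// => i _; exact: ltW.
congr (_ * _); rewrite /s -wedge_vertex_mx -/(w j).
have <- : (\sum_i y 0 i)^-1 * dotv (w j) x = dotv (w j) (p j ord0).
  apply: wm; apply: subset_closure.
  exists (fun i => (\sum_i y 0 i)^-1 * y 0 i); split=> [i||].
  - by rewrite mulr_gt0// invr_gt0.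
  - by rewrite -mulr_sumr mulVf// gt_eqF.
  rewrite -yx mul_vertex_mx scaler_sumr; apply: eq_bigr => i _.
  by rewrite scalerA.
by rewrite sgrM [Num.sg _^-1]gtr0_sg ?invr_gt0// mul1r.
Qed.

Let vol : {outer_measure set V -> \bar R} := volume.
Let T := caratheodory_type vol.
Let mu : {measure set T -> \bar R} := (@volume_measure R n).

Let mopen (A : set V) : open A -> measurable (A : set T).
Proof. exact: (caratheodory_open (invariant_half volume_invariant)). Qed.

Let mcone q : measurable (cone q : set T).
Proof.
have [u|nu] := boolP (vertex_mx q \in unitmx).
  by apply: mopen; exact: open_mulmx u (@std_simplex_open R n).
have /eqP d0 : \det (vertex_mx q) == 0 by move: nu; rewrite unitmxE unitfE negbK.
apply: (@caratheodory_null _ _ vol); rewrite [LHS]volume_simplex.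
by rewrite d0 normr0 mul0r.
Qed.

Let ae_generic : {ae mu, forall x, generic x}.
Proof.
have plane (I : finType) (h : I -> V) (b : I -> R) : (forall i, h i != 0) ->
    {ae mu, forall x, forall i, dotv (h i) x != b i}.
  move=> h0; apply: (@filter_forall _ _ (fun i (x : T) => dotv (h i) x != b i)) => i.
  exists [set x : T | dotv (h i) x = b i]; split.
  - apply: (@caratheodory_null _ _ vol).
    exact: invariant_hyperplane volume_invariant (h0 i).
  - exact: invariant_hyperplane volume_invariant (h0 i).
  - by move=> x /= /negP; rewrite negbK => /eqP.
have w0 j : w j != 0 by rewrite wedge_neq0// p_nd.
have h1 := plane _ w (fun=> 0) w0.
have h2 := plane _ w (fun j => dotv (w j) (p j ord0)) w0.
have h3 := plane _ (fun ji : 'I_J * 'I_n.+1 => facet ji.1 ji.2) (fun=> 0)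
  (fun ji => facet_neq0 ji.1 ji.2).
have FA : Filter (almost_everywhere mu) := ae_filter_ringOfSetsType mu.
by apply: (@filterS3 _ _ FA _ _ _ _ _ h1 h2 h3) => x a b c; split.
Qed.

(** Integration of [generic_indicator]: a cone has the volume of the standard simplex times [|det|],
    and the sign [s j] turns this into the signed determinant. *)
Lemma volume_interior : volume D =
  ((-1) ^+ n * fine (volume (@std_simplex R n)) * \sum_j \det (vertex_mx (p j)))%:E.
Proof.
(* With no element, [D] is open, closed and bounded, hence empty. Otherwise an element is at hand to
   see that generic points are nonzero. *)
have [J0|Jn0] := eqVneq J 0%N.
  have sE : surface p = set0.
    by apply/seteqP; split=> // x [[j jJ]]; exfalso; move: jJ; rewrite J0.
  have cD : closed D.
    have [_ _ _ DS _] := pD; apply/closure_id/seteqP; split; first exact: subset_closure.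
    move=> x cx; apply: contrapT => nx.
    have : (closure D `\` D) x by []. 
    by rewrite DS sE.
  have [B Bc] : exists B : R, forall x, closure D x -> forall i, `|x 0 i| <= B.
    by apply: closure_bounded; case: pD.
  have -> : D = set0.
    apply/seteqP; split=> // x Dx.
    pose e : V := (const_mx (`|B| + 1) - x).
    have : D (x + e) = D x.
      apply: (segment_off_surface pD) => t _ [[j jJ]]; exfalso; move: jJ; by rewrite J0.
    rewrite /e addrC subrK => DD; have : closure D (const_mx (`|B| + 1)).
      by apply: subset_closure; rewrite DD.
    move=> /Bc/(_ ord0); rewrite mxE ger0_norm ?addr_ge0// => h.
    by have := ler_norm B; lra.
  rewrite outer_measure0 big1 ?mulr0// => -[j jJ]; exfalso; move: jJ; by rewrite J0.
have Jp : (0 < J)%N by rewrite lt0n.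
have mD : measurable (D : set T) by apply: mopen; case: pD.
(* Cones with negative sign are moved to the side of [D], so that both sides are integrals of
   nonnegative functions. *)
pose neg := [seq j <- index_enum 'I_J | s j < 0].
pose pos := [seq j <- index_enum 'I_J | 0 < s j].
have fm (A : set V) : measurable (A : set T) -> measurable_fun setT (EFin \o (\1_A : T -> R)).
  by move=> mA; apply/measurable_EFinP; exact: measurable_indic.
have f0 (A : set V) (x : T) : (0 <= (EFin \o (\1_A : T -> R)) x)%E by rewrite lee_fin.
pose f (x : T) : \bar R := ((\1_D x)%:E + \sum_(j <- neg) (\1_(cone (p j)) x)%:E)%E.
pose g (x : T) : \bar R := (\sum_(j <- pos) (\1_(cone (p j)) x)%:E)%E.
have sE j : s j = (0 < s j)%R%:R - (s j < 0)%R%:R.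
  by rewrite /s sgr_gt0 sgr_lt0; case: sgrP => _ /=; rewrite ?subr0 ?sub0r ?subrr.
have mf : measurable_fun setT f.
  apply: emeasurable_funD; first exact: fm.
  by apply: emeasurable_sum => j; exact/fm/mcone.
have mg : measurable_fun setT g by apply: emeasurable_sum => j; exact/fm/mcone.
have fg : ae_eq mu setT f g.
  apply: (@filterS _ _ (ae_filter_ringOfSetsType mu) _ _ _ ae_generic) => x gx _.
  have := generic_indicator (Ordinal Jp) gx.
  move=> e; rewrite /f /g !sumEFin -EFinD /neg /pos !big_filter big_mkcond [in RHS]big_mkcond.
  congr (_%:E); rewrite indicE (_ : (x \in D) = `[< D x >])// e.
  rewrite -big_split /=; apply: eq_bigr => j _.
  rewrite indicE (_ : (x \in cone (p j)) = `[< cone (p j) x >])// {1}sE.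
  by case: ifP; case: ifP => _ _ /=; ring.
have ic (A : set V) : measurable (A : set T) ->
    (\int[mu]_x ((\1_A : T -> R) x)%:E = volume A)%E.
  by move=> mA; rewrite (integral_indic mu measurableT mA) setIT.
have isum (l : seq 'I_J) : (\int[mu]_x (\sum_(j <- l) (\1_(cone (p j)) (x : T))%:E) =
    \sum_(j <- l) volume (cone (p j)))%E.
  apply: etrans (ge0_integral_sum mu measurableT (fun j => fm _ (mcone (p j)))
    (fun j x _ => f0 _ x) l) _.
  by apply: eq_bigr => j _; exact: ic (mcone (p j)).
have iD : (\int[mu]_x f x = volume D + \sum_(j <- neg) volume (cone (p j)))%E.
  have f20 (x : T) : setT x -> (0 <= \sum_(j <- neg) (\1_(cone (p j)) x)%:E :> \bar R)%E.
    by move=> _; apply: sume_ge0 => j _; exact: f0.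
  have mf2 : measurable_fun setT (fun x : T => \sum_(j <- neg) (\1_(cone (p j)) x)%:E : \bar R)%E.
    by apply: emeasurable_sum => j; exact/fm/mcone.
  apply: etrans (ge0_integralD mu measurableT (fun x _ => f0 D x) (fm D mD) f20 mf2) _.
  by congr (_ + _)%E; [exact: ic|exact: isum].
have := ae_eq_integral g f measurableT mf mg fg.
rewrite iD isum.
rewrite (eq_bigr _ (fun j _ => volume_simplex (vertex_mx (p j)))).
rewrite [in RHS](eq_bigr _ (fun j _ => volume_simplex (vertex_mx (p j)))) !sumEFin.
rewrite /neg /pos !big_filter.
set c := fine _; set a := \sum_(j | _) _; set b := \sum_(j | _) _ => ab.
have -> : volume D = (b - a)%:E.
  move: ab; have : (0 <= volume D)%E := outer_measure_ge0 vol D.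
  by case: (volume D) => [v| |] // _ [<-]; rewrite addrK.
rewrite -mulrA mulrCA mulr_sumr mulr_sumr; congr (_%:E).
rewrite /b /a big_mkcond [X in _ - X]big_mkcond -sumrB; apply: eq_bigr => j _.
have : s j * (`|\det (vertex_mx (p j))| * c) = c * ((-1) ^+ n * \det (vertex_mx (p j))).
  rewrite mulrA mulrC; congr (_ * _).
  rewrite /s [RHS]numEsg; congr (_ * _).
  by rewrite normrM normrX normrN normr1 expr1n mul1r.
by move=> <-; rewrite {3}sE; case: ifP; case: ifP => _ _ /=; ring.
Qed.

End EnclosedVolume.

(** * The change of the enclosed volume *)

Lemma poly_ext (R : realType) (P Q : {poly R}) : (forall x, P.[x] = Q.[x]) -> P = Q.
Proof.
move=> PQ; apply/eqP; rewrite -subr_eq0; apply/negPn/negP => /exists_nonroot[t].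
by rewrite /root hornerD hornerN PQ subrr eqxx.
Qed.

Lemma deriv_prod (R : comNzRingType) (I : eqType) (s : seq I) (F : I -> {poly R}) :
  uniq s -> (\prod_(i <- s) F i)^`() =
  \sum_(l <- s) \prod_(i <- s) (if i == l then (F i)^`() else F i).
Proof.
elim: s => [|x s IHs] /=; first by rewrite !big_nil derivC.
move=> /andP[xs us]; rewrite !big_cons derivM IHs// eqxx; congr (_ * _ + _).
  by apply: eq_big_seq => i si; case: eqP => // ix; rewrite -ix si in xs.
rewrite mulr_sumr; apply: eq_big_seq => l sl; rewrite big_cons.
by case: eqP => // xl; rewrite xl sl in xs.
Qed.

Lemma deriv_det (R : comNzRingType) (m : nat) (A : 'M[{poly R}]_m) :
  (\det A)^`() = \sum_l \det (\matrix_(k, c) if k == l then (A k c)^`() else A k c).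
Proof.
rewrite /determinant raddf_sum exchange_big /=; apply: eq_bigr => s _.
rewrite -mulr_sumr mulr_sign; under [in RHS]eq_bigr do
  (under eq_bigr do rewrite mxE).
rewrite mulr_sign -deriv_prod ?index_enum_uniq//; case: ifP => // _.
exact: derivN.
Qed.

Section ReplacedRows.
Context {R : realType} {n : nat}.
Notation V := 'rV[R]_n.+1.
Implicit Types (f : 'I_n.+1 -> V) (a e : V).

Definition replace f l e : 'I_n.+1 -> V := fun k => if k == l then e else f k.

Definition rows_det f : R := \det (vertex_mx f).

(** Both sides are the derivative at 0 of the determinant of the vertices translated by [x *: e].
    Row by row it is the sum on the left; on the other hand translation leaves the edges unchanged,
    and by [wedge_vertex_mx] the determinant is affine in [x] with the slope on the right. *)
Lemma sum_rows_det f e :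
  \sum_l rows_det (replace f l e) = (-1) ^+ n * dotv (wedgev (edges f)) e.
Proof.
pose A : 'M[{poly R}]_n.+1 := \matrix_(k, c) ((f k 0 c)%:P + (e 0 c)%:P * 'X).
pose w := wedgev (edges f).
have detA : \det A = (rows_det f)%:P + ((-1) ^+ n * dotv w e)%:P * 'X.
  apply: poly_ext => x; rewrite !hornerE.
  rewrite -[(\det A).[x]]/(horner_eval x _) -det_map_mx.
  have -> : map_mx (horner_eval x) A = vertex_mx (fun k => f k + x *: e).
    by apply/matrixP => k c; rewrite !mxE /= /horner_eval !hornerE mulrC.
  have ww : wedgev (edges (fun k => f k + x *: e)) = w.
    congr wedgev; apply/matrixP => k c; rewrite !mxE; ring.
  have := wedge_vertex_mx (fun k => f k + x *: e).
  rewrite ww dotvDr dotvZr wedge_vertex_mx -/(rows_det f) => h.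
  apply: (@mulfI _ ((-1) ^+ n)); first by rewrite signr_eq0.
  rewrite -h mulrDr; congr (_ + _).
  by rewrite mulrA mulrA -exprD -signr_odd oddD addbb mul1r mulrC.
have : (\det A)^`().[0] = (-1) ^+ n * dotv w e.
  by rewrite detA derivD derivM !derivC derivX add0r mul0r add0r mulr1 hornerC.
move=> <-; rewrite deriv_det horner_sum; apply: eq_bigr => l _.
rewrite -[(\det _).[0]]/(horner_eval 0 _) -det_map_mx; congr (\det _).
apply/matrixP => k c; rewrite !mxE /= /horner_eval /replace; case: eqP => _.
  by rewrite derivD derivM !derivC derivX add0r mul0r add0r mulr1 hornerC.
by rewrite !hornerE.
Qed.

Lemma rows_det_lin f l (s : R) a e :
  rows_det (replace f l (s *: a + e)) = s * rows_det (replace f l a) + rows_det (replace f l e).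
Proof.
rewrite -[rows_det (replace f l e)]mul1r.
apply: (@determinant_multilinear _ _ _ _ _ l).
- by apply/rowP => c; rewrite !mxE /replace eqxx !mxE mul1r.
- by apply/matrixP => k c; rewrite !mxE /replace eq_sym (negbTE (neq_lift _ _)).
- by apply/matrixP => k c; rewrite !mxE /replace eq_sym (negbTE (neq_lift _ _)).
Qed.

Lemma rows_det_eq0 f k l : k != l -> f k = f l -> rows_det f = 0.
Proof.
by move=> kl fkl; apply: (determinant_alternate kl) => c; rewrite !mxE fkl.
Qed.

Lemma rows_det_dep f (c : 'I_n.+1 -> R) k :
  \sum_i c i *: f i = 0 -> c k != 0 -> rows_det f = 0.
Proof.
move=> cf ck; apply/eqP; rewrite -[_ == 0]negbK -unitfE -/(unitmx _).
apply/negP => uf; move/eqP: ck; apply.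
have : (\row_i c i) *m vertex_mx f = 0.
  by rewrite mul_vertex_mx -[RHS]cf; apply: eq_bigr => i _; rewrite mxE.
move=> /(congr1 (mulmx^~ (invmx (vertex_mx f)))); rewrite mulmxK// mul0mx => /rowP/(_ k).
by rewrite !mxE.
Qed.

Lemma rows_det_perm f (s : {perm 'I_n.+1}) :
  rows_det (f \o s) = (-1) ^+ s * rows_det f.
Proof.
rewrite /rows_det -det_perm -det_mulmx -row_permE; congr (\det _).
by apply/matrixP => k c; rewrite !mxE.
Qed.

Lemma plane_edges f (x : V) : Defs.nondegenerate f ->
  dotv (wedgev (edges f)) x = 0 -> (x <= edges f)%MS.
Proof.
move=> nd wx; pose w := wedgev (edges f).
have w0 : w != 0 by exact: wedge_neq0.
have sub : (edges f <= kermx w^T)%MS by apply/sub_kermxP; exact: mul_wedge.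
have rk : \rank (kermx w^T) = n.
  by rewrite mxrank_ker mxrank_tr rank_rV w0 subn1.
have /eqmxP eqk : (edges f == kermx w^T)%MS.
  by rewrite -(mxrank_leqif_eq sub) rk; move: nd; rewrite /Defs.nondegenerate /row_free.
rewrite eqk; apply/sub_kermxP; apply/matrixP => i j; rewrite !ord1 mxE [RHS]mxE.
by move: wx; rewrite dotvC dotvE mxE.
Qed.

End ReplacedRows.

(** * Cancellation of the facet terms *)

Section FacetCycle.
Context {R : realType} {n K J : nat}.
Notation V := 'rV[R]_n.+2.
Variables (conn : 'I_J -> 'I_n.+2 -> 'I_K) (q : 'I_K -> V) (D : set V).
Hypothesis q_inj : injective q.
Notation p := (with_conn conn q).
Hypothesis pD : closed_polyhedral_hypersurface p D.

Let p_cx : simplicial_complex p. Proof. by case: pD. Qed.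

Let p_nd j : Defs.nondegenerate (p j). Proof. by case: p_cx. Qed.

Lemma conn_inj j : injective (conn j).
Proof. by move=> a b ab; apply: (vertex_inj (p_nd j)); rewrite /with_conn ab. Qed.

(** The facet opposite to the local vertex [ji.2], recorded by global vertex indices and therefore
    independent of the vertex positions. *)
Definition facet_key (ji : 'I_J * 'I_n.+2) : {set 'I_K} :=
  [set conn ji.1 k | k in [set~ ji.2]]%SET.

(** The sign of this permutation compares the orientations that the two elements give to their
    common facet. *)
Lemma facet_perm_exists j i j0 i0 : facet_key (j, i) = facet_key (j0, i0) ->
  exists s : {perm 'I_n.+2}, s i = i0 /\ forall k, k != i -> conn j k = conn j0 (s k).
Proof.
move=> key.
have h k : exists k', (k == i -> k' = i0) /\ (k != i -> k' != i0 /\ conn j k = conn j0 k').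
  have [ki|ki] := eqVneq k i; first by exists i0.
  have : conn j k \in facet_key (j0, i0).
    by rewrite -key; apply/imsetP; exists k => //; rewrite !inE.
  by move=> /imsetP[k' /=]; rewrite !inE => ? ?; exists k'.
have [g gP] := choice h.
have g_inj : injective g.
  move=> a b gab; have [g1 g2] := gP a; have [g3 g4] := gP b.
  have [ai|ai] := boolP (a == i); have [bi|bi] := boolP (b == i).
  - by rewrite (eqP ai) (eqP bi).
  - by have [] := g4 bi; rewrite -gab (g1 ai) eqxx.
  - by have [] := g2 ai; rewrite gab (g3 bi) eqxx.
  - have [_ e1] := g2 ai; have [_ e2] := g4 bi.
    by apply: (@conn_inj j); rewrite e1 e2 gab.
exists (perm g_inj); split; first by rewrite permE; apply: (gP i).1.
by move=> k ki; rewrite permE; have [_ /(_ ki)[]] := gP k.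
Qed.

Section FacetClass.
Variables (j0 : 'I_J) (i0 : 'I_n.+2).

Let c k : R := if k == i0 then 0 else n.+1%:R^-1.

Let n1 : (n.+1%:R : R) != 0. Proof. by rewrite pnatr_eq0. Qed.

Let c1 : \sum_k c k = 1.
Proof.
rewrite (bigD1 i0)//= {1}/c eqxx add0r.
rewrite (eq_bigr (fun=> n.+1%:R^-1)); last by move=> k /negbTE ki; rewrite /c ki.
by rewrite sumr_const cardC1 card_ord -[LHS]mulr_natr mulVf.
Qed.

(* barycenter of the facet opposite to the vertex [i0] of the element [j0] *)
Let z : V := \sum_k c k *: p j0 k.

Let member j i := facet_key (j, i) = facet_key (j0, i0).

Let sigma j i : {perm 'I_n.+2} :=
  if pselect (member j i) is left h then sval (cid (facet_perm_exists h)) else 1%g.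

Let sigmaP j i : member j i ->
  sigma j i i = i0 /\ forall k, k != i -> conn j k = conn j0 (sigma j i k).
Proof. by rewrite /sigma; case: pselect => // h _; case: cid. Qed.

Let bary_z j i k : member j i -> bary (p j) k z = if k == i then 0 else n.+1%:R^-1.
Proof.
move=> /sigmaP[si sk].
have -> : z = \sum_k c (sigma j i k) *: p j k.
  rewrite /z (reindex_inj (@perm_inj _ (sigma j i))) /=.
  apply: eq_bigr => l _; have [->|li] := eqVneq l i.
    by rewrite si /c eqxx !scale0r.
  by rewrite /with_conn sk.
rewrite baryE//; last by rewrite -[RHS]c1 [RHS](reindex_inj (@perm_inj _ (sigma j i))).
by rewrite /c -si (inj_eq perm_inj).
Qed.

Let z_closure j i : member j i -> closure (simplex (p j)) z.
Proof.
move=> mji; have [si sk] := sigmaP mji.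
apply/(closure_simplexP (p_nd j)); split; last first.
  by move=> k; rewrite (bary_z _ mji); case: eqP => // _; rewrite invr_ge0.
have -> : z = \sum_k c (sigma j i k) *: p j k.
  rewrite /z (reindex_inj (@perm_inj _ (sigma j i))) /=.
  apply: eq_bigr => l _; have [->|li] := eqVneq l i.
    by rewrite si /c eqxx !scale0r.
  by rewrite /with_conn sk.
by apply: affine_hull_comb; rewrite -[RHS]c1 [RHS](reindex_inj (@perm_inj _ (sigma j i))).
Qed.

Let member_unique j i i' : member j i -> member j i' -> i = i'.
Proof.
move=> mi mi'; apply/eqP/negPn/negP => ii.
have := bary_z i' mi; rewrite (bary_z i' mi') eqxx eq_sym (negbTE ii) => /esym/eqP.
by rewrite invr_eq0 (negbTE n1).
Qed.

(** As [z] is interior to the facet, the face shared with the element [j0] contains all vertices of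
    the facet; the full vertex set would make the elements equal. Injectivity of [q] turns equality
    of the vertices into equality of their indices. *)
Let closure_member j : closure (simplex (p j)) z -> exists i, member j i.
Proof.
move=> cz; have [->|jj] := eqVneq j j0; first by exists i0.
have cz0 : closure (simplex (p j0)) z by exact: (z_closure (i := i0)).
have [_ _ /(_ _ _ jj)[I0|[A [B [_ _ IA IB]]]]] := p_cx.
  have : (closure (simplex (p j)) `&` closure (simplex (p j0))) z by [].
  by rewrite I0.
have AB : face (p j) A = face (p j0) B by rewrite -IA IB.
have /(face_baryP p_cx)[_ _ zB] : face (p j0) B z by rewrite -IB.
have kB k : k != i0 -> k \in B.
  move=> ki; apply/negPn/negP => /zB; rewrite (bary_z (i := i0))// (negbTE ki).
  by move/eqP; rewrite invr_eq0 (negbTE n1).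
have iB : i0 \notin B.
  apply/negP => iB; move/eqP: jj; apply.
  pose m : R := n.+2%:R^-1; have m0 : 0 < m by rewrite invr_gt0.
  have sm : \sum_(k < n.+2) m = 1.
    by rewrite sumr_const card_ord -[LHS]mulr_natr mulVf// pnatr_eq0.
  have sx : simplex (p j0) (\sum_k m *: p j0 k) by exists (fun=> m).
  apply: (simplex_unique pD sx).
  have : face (p j) A (\sum_k m *: p j0 k).
    rewrite AB; exists (fun=> m); split=> // [k|k]; first exact: ltW.
    by have [->|/kB ->//] := eqVneq k i0; rewrite iB.
  by rewrite -IA => -[].
have keyA : [set conn j k | k in A]%SET = [set conn j0 k | k in B]%SET.
  apply/setP => x; apply/imsetP/imsetP => -[a aA ->].
    by have [b bB e] := face_vertex_match p_cx AB aA; exists b => //; apply: q_inj; exact: esym e.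
  have [b bB e] := face_vertex_match p_cx (esym AB) aA.
  by exists b => //; apply: q_inj; exact: esym e.
have BE : B = [set~ i0]%SET.
  by apply/setP => k; rewrite !inE; have [->|/kB//] := eqVneq k i0; exact/negbTE.
have cA : #|~: A| = 1%N.
  have : #|A| = n.+1.
    rewrite -(card_imset (mem A) (@conn_inj j)) keyA (card_imset (mem B) (@conn_inj j0)).
    by rewrite BE cardsC1 card_ord.
  move=> AE; have := cardsC A; rewrite AE card_ord; move: #|_| => m.
  by rewrite -[n.+2]addn1 => /addnI.
have /eqP/cards1P[i iA] := cA.
exists i; rewrite /member /facet_key /= -BE -keyA.
by rewrite -iA finset.setCK.
Qed.

Let f0 k : V := p j0 k - z.

(** Up to a factor, the oriented area in the plane that remains when the directions of the facet are
    factored out: it is bilinear, alternating and zero on facet directions. In this plane the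
    elements around the facet are rays spanned by the [y j i]. *)
Let Om a e : R := \sum_(l | l != i0) rows_det (replace (replace f0 i0 a) l e).

Let f0_sum : \sum_k c k *: f0 k = 0.
Proof.
rewrite /f0; under eq_bigr do rewrite scalerBr.
by rewrite sumrB -scaler_suml c1 scale1r subrr.
Qed.

Let Om_linr a s e e' : Om a (s *: e + e') = s * Om a e + Om a e'.
Proof.
rewrite /Om mulr_sumr -big_split /=; apply: eq_bigr => l _.
exact: rows_det_lin.
Qed.

Let replaceC f k l a e : k != l ->
  replace (replace f k a) l e = replace (replace f l e) k a :> ('I_n.+2 -> V).
Proof.
move=> kl; apply/funext => m; rewrite /replace.
by have [->|//] := eqVneq m l; rewrite eq_sym (negbTE kl).
Qed.

Let Om_linl s a a' e : Om (s *: a + a') e = s * Om a e + Om a' e.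
Proof.
rewrite /Om mulr_sumr -big_split /=; apply: eq_bigr => l li.
have il : i0 != l by rewrite eq_sym.
by rewrite !(replaceC f0 _ _ il) rows_det_lin.
Qed.

Let Om_alt a : Om a a = 0.
Proof.
rewrite /Om big1// => l li; apply: (@rows_det_eq0 _ _ _ i0 l); first by rewrite eq_sym.
by rewrite /replace eqxx eq_sym (negbTE li) eqxx.
Qed.

Let Om0l e : Om 0 e = 0.
Proof. by have := Om_linl 1 0 0 e; rewrite scaler0 addr0 mul1r => h; lra. Qed.

Let Om0r e : Om e 0 = 0.
Proof. by have := Om_linr e 1 0 0; rewrite scaler0 addr0 mul1r => h; lra. Qed.

Let OmDl a a' e : Om (a + a') e = Om a e + Om a' e.
Proof. by have := Om_linl 1 a a' e; rewrite scale1r mul1r. Qed.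

Let OmDr a e e' : Om a (e + e') = Om a e + Om a e'.
Proof. by have := Om_linr a 1 e e'; rewrite scale1r mul1r. Qed.

Let OmZl s a e : Om (s *: a) e = s * Om a e.
Proof. by have := Om_linl s a 0 e; rewrite !addr0 Om0l addr0. Qed.

Let OmZr s a e : Om a (s *: e) = s * Om a e.
Proof. by have := Om_linr a s e 0; rewrite !addr0 Om0r addr0. Qed.

Let OmNl a e : Om (- a) e = - Om a e.
Proof. by rewrite -scaleN1r OmZl mulN1r. Qed.

Let OmNr a e : Om a (- e) = - Om a e.
Proof. by rewrite -scaleN1r OmZr mulN1r. Qed.

Let OmC a e : Om e a = - Om a e.
Proof.
have := Om_alt (a + e); rewrite OmDl !OmDr !Om_alt => h; lra.
Qed.

Let Om_facet k e : k != i0 -> Om (f0 k) e = 0.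
Proof.
move=> ki; rewrite /Om big1// => l li; have [kl|kl] := eqVneq k l.
  apply: (@rows_det_dep _ _ _ (fun m => if m == i0 then n.+1%:R^-1 else c m * (m != l)%:R) i0).
    rewrite (bigD1 i0)//= eqxx /replace eq_sym (negbTE li) eqxx.
    rewrite -[RHS]f0_sum (bigD1 k)//= [RHS](bigD1 i0)//= {3}/c eqxx scale0r add0r.
    rewrite [RHS](bigD1 k)//= (negbTE ki) kl !eqxx mulr0 scale0r add0r.
    have -> : c l = n.+1%:R^-1 by rewrite /c (negbTE li).
    congr (_ + _).
    rewrite [RHS](eq_bigl (fun m => (m != i0) && (m != l)))//.
    apply: eq_bigr => m /andP[mi mk].
    by rewrite (negbTE mi) (negbTE mk) /= mulr1.
  by rewrite eqxx invr_neq0.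
apply: (@rows_det_eq0 _ _ _ i0 k); first by rewrite eq_sym.
by rewrite /replace [i0 == l]eq_sym (negbTE li) eqxx (negbTE kl) (negbTE ki).
Qed.

Let y j i : V := p j i - z.

(** [sum_rows_det] is applied to the vertices relative to [z]. The term that replaces row [i]
    vanishes, because the remaining rows are linearly dependent; the others are reordered by
    [sigma j i]. *)
Let wedge_Om j i e : member j i ->
  (-1) ^+ n.+1 * dotv (wedgev (edges (p j))) e = (-1) ^+ sigma j i * Om (y j i) e.
Proof.
move=> mji; have [si sk] := sigmaP mji.
have <- : wedgev (edges (fun k => p j k - z)) = wedgev (edges (p j)).
  by congr wedgev; apply/matrixP => k l; rewrite !mxE; ring.
have sE k : (sigma j i k == i0) = (k == i) by rewrite -{1}si (inj_eq perm_inj).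
rewrite -sum_rows_det (bigD1 i)//=.
rewrite (@rows_det_dep _ _ _ (c \o sigma j i) (lift i ord0)); first last.
- by rewrite /= /c sE [_ == i]eq_sym (negbTE (neq_lift _ _)) invr_neq0.
- rewrite (bigD1 i)//= {1}/c si eqxx scale0r add0r.
  have zE : z = \sum_k c (sigma j i k) *: p j k.
    rewrite /z (reindex_inj (@perm_inj _ (sigma j i))) /=.
    apply: eq_bigr => l _; have [->|li] := eqVneq l i.
      by rewrite si /c eqxx !scale0r.
    by rewrite /with_conn sk.
  have : \sum_k c (sigma j i k) *: (p j k - z) = 0.
    under eq_bigr do rewrite scalerBr.
    have cs1 : \sum_k c (sigma j i k) = 1.
      by rewrite -[RHS]c1 [RHS](reindex_inj (@perm_inj _ (sigma j i))).
    by rewrite sumrB -zE -scaler_suml cs1 scale1r subrr.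
  rewrite (bigD1 i)//= {1}/c si eqxx scale0r add0r => h; rewrite -[RHS]h.
  by apply: eq_bigr => k /negbTE ki; rewrite /replace ki.
rewrite add0r /Om mulr_sumr [RHS](reindex_inj (@perm_inj _ (sigma j i))) /=.
apply: eq_big => [l|l li]; first by rewrite sE.
rewrite -rows_det_perm; congr rows_det; apply/funext => k.
rewrite /replace /= (inj_eq perm_inj) sE.
case: eqP => // _; case: eqP => [->//|/eqP ki].
by rewrite /f0 /with_conn sk.
Qed.

Let Om_neq0 j i e : member j i ->
  (Om (y j i) e != 0) = (dotv (wedgev (edges (p j))) e != 0).
Proof.
move=> mji; have wO := wedge_Om e mji; congr (~~ _).
rewrite -(inj_eq (mulfI (_ : (-1) ^+ sigma j i != 0))) ?signr_eq0// mulr0 -wedge_Om//.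
by rewrite mulf_eq0 signr_eq0.
Qed.

(** Modulo facet directions, [x - z] is the multiple of [y j i] given by the barycentric coordinate
    of the vertex opposite to the facet. *)
Let Om_bary j i x e : member j i -> affine_hull (p j) x ->
  Om (x - z) e = bary (p j) i x * Om (y j i) e.
Proof.
move=> mji hx; have [si sk] := sigmaP mji.
have -> : x - z = \sum_k bary (p j) k x *: (p j k - z).
  under eq_bigr do rewrite scalerBr.
  by rewrite sumrB -scaler_suml sum_bary scale1r -(affine_hull_bary (p_nd j) hx).
rewrite (big_morph (Om^~ e) (fun a b => OmDl a b e) (Om0l e)) (bigD1 i)//= OmZl big1 ?addr0//.
move=> k ki; rewrite OmZl; have -> : p j k - z = f0 (sigma j i k).
  by rewrite /f0 /with_conn sk.
by rewrite Om_facet ?mulr0// -si (inj_eq perm_inj).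
Qed.

Let Om_plane j i x : member j i ->
  (affine_hull (p j) x <-> Om (y j i) (x - z) = 0).
Proof.
move=> mji; have wz := closure_plane pD (z_closure mji).
have /(closure_simplexP (p_nd j))[hz _] := z_closure mji.
split=> [hx|/eqP Ox].
  apply/eqP; rewrite -[_ == 0]negbK Om_neq0// negbK dotvBr.
  have -> : x = row 0 (x - p j ord0) + p j ord0 by rewrite row_id subrK.
  by rewrite dotvDr [dotv _ (row _ _)]dotvC dotv_wedge_submx// wz add0r subrr.
have wx : dotv (wedgev (edges (p j))) (x - z) = 0.
  by apply/eqP; move: Ox; rewrite -[_ == 0]negbK Om_neq0// negbK.
have -> : affine_hull (p j) x = (x - p j ord0 <= edges (p j))%MS by [].
have -> : x - p j ord0 = (x - z) + (z - p j ord0) by rewrite addrA subrK.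
by apply: addmx_sub => //; exact: plane_edges.
Qed.

(** Within this radius of [z] only elements around the facet occur, and the only barycentric
    coordinate that can vanish or change sign is the one opposite to the facet. *)
Let near_facet : exists2 r : R, 0 < r & forall x : V, (forall i, `|x 0 i - z 0 i| < r) ->
  forall j, (closure (simplex (p j)) x -> closure (simplex (p j)) z) /\
    forall i k, member j i -> k != i -> 0 < bary (p j) k x.
Proof.
apply/near_rV; apply: nbhs_rV_forall => j.
have h1 : nbhs z (fun x => closure (simplex (p j)) x -> closure (simplex (p j)) z).
  have [cz|ncz] := pselect (closure (simplex (p j)) z).
    by have : nbhs z setT := @filterT _ _ (nbhs_filter z); apply: nbhs_rVS.
  have : nbhs z (~` closure (simplex (p j))).
    by apply: open_nbhs_nbhs; split=> //; exact/closed_openC/closed_closure.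
  by apply: nbhs_rVS => x nx /nx.
have h2 : nbhs z (fun x => forall i k, member j i -> k != i -> 0 < bary (p j) k x).
  apply: nbhs_rV_forall => i; apply: nbhs_rV_forall => k.
  have [[mji ki]|nh] := pselect (member j i /\ k != i); last first.
    have : nbhs z setT := @filterT _ _ (nbhs_filter z).
    by apply: nbhs_rVS => x _ mji ki; case: nh.
  have : nbhs (bary (p j) k z) [set s : R | 0 < s].
    by apply: lt_nbhsr; rewrite (bary_z k mji) (negbTE ki) invr_gt0.
  move=> /(@bary_continuous _ _ _ (p j) k z); exact: nbhs_rVS.
by have := nbhs_rVI h1 h2; apply: nbhs_rVS => x [].
Qed.

Let sg_sign (b : nat) (x : R) : Num.sg ((-1) ^+ b * x) = (-1) ^+ b * Num.sg x.
Proof. by rewrite sgrM sgrX sgrN1. Qed.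

(** [crossing_sum] seen in the quotient plane: the segment crosses the ray of [y] precisely when [a]
    and [a'] lie on opposite sides of it in the sense given by [C]. The orientation of the crossing
    is then the sign of the permutation times a common factor. *)
Let segment_sum (r : R) (a a' : V) :
  (forall x : V, (forall i, `|x 0 i - z 0 i| < r) ->
    forall j, (closure (simplex (p j)) x -> closure (simplex (p j)) z) /\
    forall i k, member j i -> k != i -> 0 < bary (p j) k x) ->
  (forall i, `|a 0 i| < r) -> (forall i, `|a' 0 i| < r) ->
  let w j := wedgev (edges (p j)) in
  (forall j, dotv (w j) a != 0) -> (forall j, dotv (w j) a' != 0) ->
  (forall j, dotv (w j) (a' - a) != 0) ->
  let C := Om a (a' - a) in C != 0 ->
  `[< D (z + a') >]%:R - `[< D (z + a) >]%:R = - ((-1) ^+ n.+1 * Num.sg C *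
   \sum_(ji : 'I_J * 'I_n.+2 | facet_key ji == facet_key (j0, i0))
     (-1) ^+ sigma ji.1 ji.2 *
      ((C * Om (y ji.1 ji.2) a < 0) && (0 < C * Om (y ji.1 ji.2) a'))%R%:R) :> R.
Proof.
move=> near ar a'r w wa wa' we C C0.
have seg s : 0 <= s <= 1 -> forall i, `|(z + a + s *: (a' - a)) 0 i - z 0 i| < r.
  move=> /andP[s0 s1] i; rewrite !mxE.
  have -> : z 0 i + a 0 i + s * (a' 0 i - a 0 i) - z 0 i = (1 - s) * a 0 i + s * a' 0 i.
    by ring.
  have := ar i; have := a'r i; rewrite !ltr_norml => /andP[b1 b2] /andP[b3 b4].
  have [->|sn0] := eqVneq s 0; first by apply/andP; split; lra.
  have sp : 0 < s by rewrite lt_def sn0.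
  by apply/andP; split; nra.
have mem s j : 0 <= s <= 1 -> closure (simplex (p j)) (z + a + s *: (a' - a)) ->
    exists i, member j i.
  by move=> s01 cx; apply: closure_member; apply: (near _ (seg s s01) j).1.
have xz s : z + a + s *: (a' - a) - z = a + s *: (a' - a).
  by rewrite addrAC [z + a]addrC addrK.
have CB j i s : member j i -> affine_hull (p j) (z + a + s *: (a' - a)) ->
    C = bary (p j) i (z + a + s *: (a' - a)) * Om (y j i) (a' - a).
  by move=> mji hx; rewrite -Om_bary// xz OmDl OmZl Om_alt mulr0 addr0.
have Oa j i : member j i -> Om (y j i) (a' - a) = Om (y j i) a' - Om (y j i) a.
  by move=> _; rewrite OmDr OmNr.
have zaa : z + a + (a' - a) = z + a' by rewrite -addrA [a + _]addrC subrK.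
have := crossing_sum pD (a := z + a) (e := a' - a).
rewrite zaa => ->; first last.
- move=> [j _ cx]; have [i mji] : exists i, member j i.
    by apply: (mem 1 j); [rewrite ler01 lexx|rewrite scale1r zaa].
  have := closure_plane pD cx; rewrite -(closure_plane pD (z_closure mji)) dotvDr => /eqP.
  by rewrite -subr_eq0 addrC addKr; apply/negP; exact: wa'.
- move=> [j _ cx]; have [i mji] : exists i, member j i.
    by apply: (mem 0 j); [rewrite ler01 lexx|rewrite scale0r addr0].
  have := closure_plane pD cx; rewrite -(closure_plane pD (z_closure mji)) dotvDr => /eqP.
  by rewrite -subr_eq0 addrC addKr; apply/negP; exact: wa.
- move=> s j s01 cx; split; last exact: we.
  have [i mji] := mem s j s01 cx.
  have /(closure_simplexP (p_nd j))[hx b0] := cx.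
  apply/(simplexP (p_nd j)); split=> // k.
  have [->|ki] := eqVneq k i; last exact: (near _ (seg s s01) j).2 mji ki.
  rewrite lt_def b0 andbT; apply: contraNneq C0 => b0'.
  by rewrite (CB _ _ _ mji hx) b0' mul0r.
congr (- _); rewrite mulr_sumr.
rewrite -(pair_big_dep xpredT (fun j i => facet_key (j, i) == facet_key (j0, i0))
  (fun j i => (-1) ^+ n.+1 * Num.sg C * ((-1) ^+ sigma j i *
      ((C * Om (y j i) a < 0) && (0 < C * Om (y j i) a'))%R%:R))) /=.
apply: eq_bigr => j _; have [[i mji]|nm] := pselect (exists i, member j i); last first.
  rewrite asboolF ?mulr0; last first.
    by move=> [s s01 sx]; apply: nm; apply: (mem s) => //; exact: subset_closure.
  by rewrite big_pred0// => i; apply/eqP => mi; apply: nm; exists i.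
rewrite (big_pred1 i); last first.
  by move=> i'; apply/eqP/eqP => [mi'|->//]; exact: member_unique mi' mji.
set A := Om _ a; set B := Om _ a'.
have A0 : A != 0 by rewrite Om_neq0//; exact: wa.
have B0 : B != 0 by rewrite Om_neq0//; exact: wa'.
have BA0 : B - A != 0 by rewrite -Oa// Om_neq0//; exact: we.
have -> : `[< crossing p (z + a) (a' - a) j >] = (C * A < 0) && (0 < C * B).
  apply/asboolP/andP => [[s s01 sx]|[CA CB0]].
    have /(simplexP (p_nd j))[hx b0] := sx.
    have := (Om_plane _ mji).1 hx; rewrite xz OmDr OmZr Oa// -/A -/B => As.
    have := CB _ _ _ mji hx; rewrite Oa// -/A -/B; set b := bary _ _ _ => Cb.
    have bp : 0 < b by exact: b0.
    have P : 0 < C * (B - A).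
      by rewrite Cb -mulrA mulr_gt0// -expr2 lt_def sqr_ge0 sqrf_eq0 BA0.
    case/andP: s01 => s0 s1.
    have sn0 : s != 0 by apply: contraNneq A0 => s0'; move: As; rewrite s0' mul0r addr0 => ->.
    have sn1 : s != 1.
      by apply: contraNneq B0 => s1'; rewrite -As s1' mul1r addrC subrK.
    have sp : 0 < s by rewrite lt_def sn0.
    have s1p : 0 < 1 - s by rewrite subr_gt0 lt_def eq_sym sn1.
    have AE : C * A = - (s * (C * (B - A))).
      have -> : C * A = C * (A + s * (B - A)) - s * (C * (B - A)) by ring.
      by rewrite As mulr0 sub0r.
    have BE : C * B = (1 - s) * (C * (B - A)).
      have -> : C * B = C * (A + s * (B - A)) + (1 - s) * (C * (B - A)) by ring.
      by rewrite As mulr0 add0r.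
    by split; rewrite ?AE ?BE ?oppr_lt0; apply: mulr_gt0.
  have P : 0 < C * (B - A) by rewrite mulrBr; lra.
  pose s := - A / (B - A).
  have s01 : 0 <= s <= 1.
    have -> : s = - (C * A) / (C * (B - A)) by rewrite /s; field; rewrite BA0 C0.
    apply/andP; split; first by rewrite divr_ge0 ?oppr_ge0 ?(ltW CA) ?(ltW P).
    by rewrite ler_pdivrMr// mul1r mulrBr; lra.
  exists s => //.
  have hx : affine_hull (p j) (z + a + s *: (a' - a)).
    apply/(Om_plane _ mji); rewrite xz OmDr OmZr Oa// -/A -/B /s divfK//.
    exact: subrr.
  apply/(simplexP (p_nd j)); split=> // k.
  have [->|ki] := eqVneq k i; last exact: (near _ (seg s s01) j).2 mji ki.
  have Cb := CB _ _ _ mji hx; rewrite Oa// -/A -/B in Cb.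
  have : 0 < bary (p j) i (z + a + s *: (a' - a)) * (B - A) ^+ 2.
    by rewrite expr2 mulrA -Cb.
  by rewrite pmulr_lgt0// lt_def sqr_ge0 sqrf_eq0 BA0.
case: andP => [[CA CB0]|_]; last by rewrite !mulr0.
rewrite !mulr1; have P : 0 < C * (B - A) by rewrite mulrBr; lra.
have -> : dotv (wedgev (edges (p j))) (a' - a) =
    (-1) ^+ n.+1 * ((-1) ^+ sigma j i * (B - A)).
  by rewrite -Oa// -wedge_Om// mulrA -exprD -signr_odd oddD addbb mul1r.
rewrite !sg_sign -mulrA; congr (_ * _); rewrite mulrC; congr (_ * _).
have := gtr0_sg P; rewrite sgrM => e.
have C2 : Num.sg C * Num.sg C = 1 by rewrite -expr2 sqr_sg C0.
by rewrite -[LHS]mul1r -C2 -mulrA e mulr1.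
Qed.

(** All terms of the class equal one number [T] up to the sign of [sigma], so it suffices that these
    signs sum to 0. This follows from a closed loop around the facet: the jumps of the indicator of
    [D] telescope, and each element is crossed once. *)
Lemma facet_class_sum (Y b : 'I_K -> V) :
  \sum_(ji : 'I_J * 'I_n.+2 | facet_key ji == facet_key (j0, i0))
    \sum_(k | k != ji.2)
      rows_det (replace (fun l => Y (conn ji.1 l)) ji.2 (b (conn ji.1 k))) = 0.
Proof.
suff sg0 : \sum_(ji : 'I_J * 'I_n.+2 | facet_key ji == facet_key (j0, i0))
    (-1) ^+ sigma ji.1 ji.2 = 0 :> R.
  pose T := \sum_(k | k != i0) rows_det (replace (fun l => Y (conn j0 l)) i0 (b (conn j0 k))).
  rewrite (eq_bigr (fun ji => (-1) ^+ sigma ji.1 ji.2 * T)).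
    by rewrite -mulr_suml sg0 mul0r.
  move=> [j i] /= /eqP /[dup] mji /sigmaP[si sk].
  have sE k : (sigma j i k == i0) = (k == i) by rewrite -{1}si (inj_eq perm_inj).
  rewrite /T mulr_sumr [RHS](reindex_inj (@perm_inj _ (sigma j i))) /=.
  apply: eq_big => [k|k ki]; first by rewrite sE.
  rewrite -rows_det_perm -sk//; congr rows_det; apply/funext => l.
  by rewrite /replace /= sE; case: eqP => // /eqP li; rewrite sk.
pose w j := wedgev (edges (p j)).
have w0 j : w j != 0 by apply: wedge_neq0; exact: p_nd.
have [u wu] := generic_vector (fun=> 0) w0.
pose g : V := \row_l Om u (delta_mx 0 l).
have gE v : Om u v = dotv g v.
  rewrite [v in Om u v]row_sum_delta (big_morph (Om u) (OmDr u) (Om0r u)) /dotv.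
  by apply: eq_bigr => l _; rewrite OmZr mxE mulrC.
have m0 : member j0 i0 by [].
have g0 : g != 0.
  apply/eqP => g0; have := gE (y j0 i0); rewrite g0 dot0v => /eqP.
  by rewrite OmC oppr_eq0; apply/negP; rewrite Om_neq0//; exact: wu.
(* The three values per element make [v], [v - u] and [v + u] transversal to it, as the corners and
   sides of the loop require; the extra index demands [Om u v != 0]. *)
have [v vP] := @generic_vector R _ (option ('I_J * 'I_3))
  (fun x => if x is Some (j, _) then w j else g)
  (fun x => if x is Some (j, i) then nth 0 [:: 0; dotv (w j) u; - dotv (w j) u] i else 0)
  (fun x => match x with Some (j, _) => w0 j | None => g0 end).
have wv j : dotv (w j) v != 0 by have := vP (Some (j, inord 0)); rewrite inordK.
have wv1 j : dotv (w j) v != dotv (w j) u by have := vP (Some (j, inord 1)); rewrite inordK.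
have wv2 j : dotv (w j) v != - dotv (w j) u by have := vP (Some (j, inord 2)); rewrite inordK.
have uv : Om u v != 0 by rewrite gE; exact: vP None.
have [r r0 near] := near_facet.
pose M := \sum_i (`|u 0 i| + `|v 0 i|) + 1.
have M0 : 0 < M by rewrite ltr_wpDl// sumr_ge0// => i _; rewrite addr_ge0.
pose d := r / M; have d0 : 0 < d by rewrite divr_gt0.
have small (x : V) : (forall i, `|x 0 i| <= `|u 0 i| + `|v 0 i|) ->
    forall i, `|(d *: x) 0 i| < r.
  move=> xi i; rewrite mxE normrM gtr0_norm// /d -mulrA gtr_pMr// mulrC.
  rewrite ltr_pdivrMr// mul1r; apply: le_lt_trans (xi i) _.
  rewrite /M (bigD1 i)//= -addrA ltrDl ltr_wpDl// sumr_ge0//.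
have su : forall i, `|(d *: u) 0 i| < r by apply: small => i; rewrite lerDl.
have sv : forall i, `|(d *: v) 0 i| < r by apply: small => i; rewrite lerDr.
have sN (x : V) : (forall i, `|x 0 i| < r) -> forall i, `|(- x) 0 i| < r.
  by move=> h i; rewrite mxE normrN.
have dn0 := lt0r_neq0 d0.
have wdu j : dotv (w j) (d *: u) != 0 by rewrite dotvZr mulf_neq0.
have wdv j : dotv (w j) (d *: v) != 0 by rewrite dotvZr mulf_neq0.
have wN (x : V) : (forall j, dotv (w j) x != 0) -> forall j, dotv (w j) (- x) != 0.
  by move=> h j; rewrite dotvNr oppr_eq0.
have wBuv j : dotv (w j) (d *: v - d *: u) != 0.
  by rewrite -scalerBr dotvZr mulf_neq0// dotvBr subr_eq0.
have wDuv j : dotv (w j) (- (d *: u) - d *: v) != 0.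
  rewrite -opprD -scalerDr dotvNr dotvZr oppr_eq0 mulf_neq0// dotvDr addrC.
  by rewrite addr_eq0.
set a1 := d *: u in su wdu wBuv wDuv; set a2 := d *: v in sv wdv wBuv wDuv.
(* The loop runs through [a1], [a2], [- a1], [- a2]. Consecutive corners have the same [Om], so the
   four sides turn in the same sense and share the factor [Num.sg C]. *)
pose C := Om a1 a2.
have C0 : C != 0 by rewrite /C /a1 /a2 OmZl OmZr; do 2!apply: mulf_neq0 => //.
have C1 : Om a1 (a2 - a1) = C by rewrite OmDr OmNr Om_alt subr0.
have C2 : Om a2 (- a1 - a2) = C by rewrite OmDr !OmNr Om_alt subr0 -OmC.
have C3 : Om (- a1) (- a2 - - a1) = C by rewrite OmNl opprK OmDr OmNr Om_alt addr0 opprK.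
have C4 : Om (- a2) (a1 - - a2) = C by rewrite OmNl opprK OmDr Om_alt addr0 -OmC.
have s1 := segment_sum near su sv wdu wdv wBuv.
have s2 := segment_sum near sv (sN _ su) wdv (wN _ wdu) wDuv.
have w3 j : dotv (w j) (- a2 - - a1) != 0 by rewrite -opprD wN.
have s3 := segment_sum near (sN _ su) (sN _ sv) (wN _ wdu) (wN _ wdv) w3.
have w4 j : dotv (w j) (a1 - - a2) != 0.
  have -> : a1 - - a2 = - (- a1 - a2) by rewrite opprD !opprK.
  exact: wN.
have s4 := segment_sum near (sN _ sv) su (wN _ wdv) wdu w4.
move: s1 s2 s3 s4; rewrite /= C1 C2 C3 C4 => /(_ C0) s1 /(_ C0) s2 /(_ C0) s3 /(_ C0) s4.
pose S (a a' : V) := \sum_(ji : 'I_J * 'I_n.+2 | facet_key ji == facet_key (j0, i0))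
     (-1) ^+ sigma ji.1 ji.2 *
      ((C * Om (y ji.1 ji.2) a < 0) && (0 < C * Om (y ji.1 ji.2) a'))%R%:R : R.
have tot : (-1) ^+ n.+1 * Num.sg C * (S a1 a2 + S a2 (- a1) + S (- a1) (- a2) + S (- a2) a1) = 0.
  by rewrite !mulrDr /S; lra.
have /eqP : S a1 a2 + S a2 (- a1) + S (- a1) (- a2) + S (- a2) a1 = 0.
  apply/eqP; move/eqP: tot; rewrite mulf_eq0 mulf_eq0 signr_eq0 sgr_eq0 (negbTE C0).
  by [].
rewrite /S -!big_split /= => /eqP h; rewrite -[RHS]h; apply: eq_bigr => -[j i] /= /eqP mji.
rewrite -!mulrDr -[LHS]mulr1; congr (_ * _); rewrite !OmNr.
have A0 : Om (y j i) a1 != 0 by rewrite Om_neq0//; exact: wdu.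
have B0 : Om (y j i) a2 != 0 by rewrite Om_neq0//; exact: wdv.
have CA0 : C * Om (y j i) a1 != 0 by rewrite mulf_neq0.
have CB0 : C * Om (y j i) a2 != 0 by rewrite mulf_neq0.
move: CA0 CB0; rewrite !mulrN !oppr_lt0 !oppr_gt0.
(* Each of the four combinations of signs selects exactly one side of the loop. *)
case: (ltgtP (C * Om (y j i) a1) 0) => //= _ _;
  by case: (ltgtP (C * Om (y j i) a2) 0) => //= _ _; rewrite ?addr0 ?add0r.
Qed.

End FacetClass.

Lemma facet_cycle (Y b : 'I_K -> V) :
  \sum_j \sum_i \sum_(k | k != i)
    rows_det (replace (fun l => Y (conn j l)) i (b (conn j k))) = 0.
Proof.
rewrite pair_big /=.
rewrite (partition_big (fun ji => facet_key ji) xpredT)//= big1// => S _.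
have [[[j0 i0] /eqP S0]|nS] := pselect (exists ji, facet_key ji == S).
  by rewrite -{}S0; exact: facet_class_sum.
by rewrite big_pred0// => ji; apply/negbTE/negP => h; apply: nS; exists ji.
Qed.

End FacetCycle.

(** * The volume along the linear motion of the vertices *)

Section PolynomialPaths.
Context {R : realType}.

Lemma poly_continuous (Q : {poly R}) : continuous (horner Q).
Proof.
move=> x; apply: differentiable_continuous.
by apply/derivable1_diffP; case: (is_derive_poly Q x).
Qed.

Lemma integral_deriv_poly (Q : {poly R}) (a b : R) : a < b ->
  \int[lebesgue_measure]_(x in `[a, b]) (Q^`()).[x] = Q.[b] - Q.[a].
Proof.
move=> ab; rewrite /Rintegral (continuous_FTC2 (F := horner Q))//.
- by apply: continuous_subspaceT; exact: poly_continuous.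
- split.
  + by move=> x _; case: (is_derive_poly Q x).
  + exact/cvg_at_right_filter/poly_continuous.
  + exact/cvg_at_left_filter/poly_continuous.
- by move=> x _; rewrite derivE.
Qed.

Lemma poly_primitive (Q : {poly R}) : exists P : {poly R}, P^`() = Q.
Proof.
exists (\poly_(i < (size Q).+1) (Q`_i.-1 / i%:R)).
apply/polyP => i; rewrite coef_deriv coef_poly ltnS.
case: ltnP => iQ; last by rewrite mul0rn nth_default.
by rewrite /= -[LHS]mulr_natr divfK// pnatr_eq0.
Qed.

Lemma deriv0_poly_const (Q : {poly R}) x y : Q^`() = 0 -> Q.[x] = Q.[y].
Proof.
move=> Q0; suff -> : Q = (Q`_0)%:P by rewrite !hornerC.
apply/polyP => -[|i]; rewrite coefC//=.
have := congr1 (fun P : {poly R} => P`_i) Q0; rewrite coef_deriv coef0 => /eqP.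
by rewrite mulrn_eq0 => /eqP.
Qed.

End PolynomialPaths.

Section InterpolatedVolume.
Context {R : realType} {n K J : nat}.
Notation V := 'rV[R]_n.+2.
Variables (conn : 'I_J -> 'I_n.+2 -> 'I_K) (t0 t1 : R) (q0 q1 : 'I_K -> V).
Hypothesis t01 : t0 < t1.

Notation p := (interp_surface conn t0 t1 q0 q1).

Let dt_neq0 : t1 - t0 != 0. Proof. by rewrite subr_eq0 gt_eqF. Qed.

Let b k : V := q1 k - q0 k.

Lemma interp_verticesE t k :
  interp_vertices t0 t1 q0 q1 t k = q0 k + ((t - t0) / (t1 - t0)) *: b k.
Proof.
rewrite /interp_vertices scalerBr [RHS]addrCA addrC; congr (_ + _).
rewrite -[X in _ = X - _]scale1r -scalerBl; congr (_ *: _).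
by field.
Qed.

Lemma interp_surface0 : p t0 = with_conn conn q0.
Proof.
apply/funext => j; apply/funext => i.
by rewrite /interp_surface /with_conn interp_verticesE subrr mul0r scale0r addr0.
Qed.

Lemma interp_surface1 : p t1 = with_conn conn q1.
Proof.
apply/funext => j; apply/funext => i.
rewrite /interp_surface /with_conn interp_verticesE divff// scale1r.
by rewrite addrC subrK.
Qed.

Definition averaged_element_normal (j : 'I_J) : V := \row_i
  (((t1 - t0) * area (with_conn conn q0) j)^-1 *
   \int[lebesgue_measure]_(t in `[t0, t1]) (unit_normal (p t) j 0 i * area (p t) j)).

Let path k (c : 'I_n.+2) : {poly R} :=
  (q0 k 0 c)%:P + (b k 0 c / (t1 - t0))%:P * ('X - t0%:P).

Let pathE k c t : (path k c).[t] = interp_vertices t0 t1 q0 q1 t k 0 c.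
Proof.
rewrite interp_verticesE !hornerE !mxE; congr (_ + _).
by field; exact: dt_neq0.
Qed.

Let path_deriv k c : (path k c)^`() = (b k 0 c / (t1 - t0))%:P.
Proof.
by rewrite /path derivD derivC add0r derivM derivC mul0r add0r derivB derivX derivC subr0 mulr1.
Qed.

Let wedge_poly j c : exists Q : {poly R}, forall t, Q^`().[t] = wedgev (edges (p t j)) 0 c.
Proof.
pose A : 'M[{poly R}]_n.+2 := \matrix_(k, l)
  oapp (fun i : 'I_n.+1 => path (conn j (lift ord0 i)) l - path (conn j ord0) l)
    ((l == c)%:R)%:P (unlift ord_max k).
have [Q QA] := poly_primitive (\det A); exists Q => t.
rewrite QA mxE -[LHS]/(horner_eval t _) -det_map_mx; congr (\det _).
apply/matrixP => k l; rewrite !mxE /= /horner_eval.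
case: unliftP => [i _|_] /=; last by rewrite hornerC mxE eqxx.
by rewrite hornerD hornerN !pathE !mxE.
Qed.

Let volume_poly : {poly R} := \sum_j \det (\matrix_(k, c) path (conn j k) c).

Let volume_polyE t : volume_poly.[t] = \sum_j rows_det (p t j).
Proof.
rewrite horner_sum; apply: eq_bigr => j _.
rewrite -[LHS]/(horner_eval t _) -det_map_mx; congr (\det _).
by apply/matrixP => k l; rewrite [LHS]mxE mxE [RHS]mxE /= /horner_eval pathE.
Qed.

Let volume_poly_deriv t : (t1 - t0) * volume_poly^`().[t] =
  \sum_j \sum_l rows_det (replace (p t j) l (b (conn j l))).
Proof.
rewrite raddf_sum /= horner_sum mulr_sumr; apply: eq_bigr => j _.
rewrite deriv_det horner_sum mulr_sumr; apply: eq_bigr => l _.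
rewrite -[X in _ * X]/(horner_eval t _) -det_map_mx /rows_det.
have -> : vertex_mx (replace (p t j) l (b (conn j l))) =
    vertex_mx (replace (p t j) l ((t1 - t0) *: ((t1 - t0)^-1 *: b (conn j l)) + 0)).
  by rewrite scalerA mulfV// scale1r addr0.
have := @rows_det_lin R _ (p t j) l (t1 - t0) ((t1 - t0)^-1 *: b (conn j l)) 0.
rewrite {1}/rows_det => ->.
have -> : rows_det (replace (p t j) l 0) = 0.
  have := @rows_det_lin R _ (p t j) l 1 0 0; rewrite scaler0 addr0 mul1r => h; lra.
rewrite addr0; congr (_ * \det _).
apply/matrixP => k c; rewrite !mxE /= /horner_eval /replace.
case: eqP => [->|_]; last by rewrite pathE.
by rewrite path_deriv hornerC !mxE mulrC.
Qed.

Variable D : R -> set V.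
Hypothesis q0_inj : injective q0.
Hypothesis pD : forall t, t0 <= t <= t1 -> closed_polyhedral_hypersurface (p t) (D t).

Let p_nd t j : t0 <= t <= t1 -> Defs.nondegenerate (p t j).
Proof. by move=> /pD[[nd _ _] _ _ _ _]. Qed.

Lemma unit_normal_area t j : t0 <= t <= t1 ->
  area (p t) j *: unit_normal (p t) j = std_content n *: wedgev (edges (p t j)).
Proof.
move=> tt; have nd := p_nd j tt.
rewrite areaE// /unit_normal scalerA mulfK// gt_eqF// enorm_gt0.
exact: wedge_neq0.
Qed.

(** Unit normal times area is [std_content n] times the wedge product, which is polynomial in time;
    the time average is therefore the increment of a polynomial primitive. *)
Lemma averaged_normal_area j v : exists Q : {poly R},
  (forall t, Q^`().[t] = dotv (wedgev (edges (p t j))) v) /\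
  (t1 - t0) * area (with_conn conn q0) j * dotv (averaged_element_normal j) v =
  std_content n * (Q.[t1] - Q.[t0]).
Proof.
have [Q QP] := choice (wedge_poly j).
exists (\sum_c v 0 c *: Q c); split=> [t|].
  rewrite raddf_sum /= horner_sum; apply: eq_bigr => c _.
  by rewrite derivZ hornerZ QP mulrC.
have a0 : area (with_conn conn q0) j != 0.
  rewrite -interp_surface0 areaE; last by apply: p_nd; rewrite lexx ltW.
  rewrite mulf_neq0 ?gt_eqF ?std_content_gt0// enorm_gt0; apply: wedge_neq0.
  by apply: p_nd; rewrite lexx ltW.
rewrite !horner_sum -sumrB !mulr_sumr; apply: eq_bigr => c _.
rewrite mxE !hornerZ -mulrBr -integral_deriv_poly//.
have -> : \int[lebesgue_measure]_(t in `[t0, t1]) (unit_normal (p t) j 0 c * area (p t) j) =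
    std_content n * \int[lebesgue_measure]_(t in `[t0, t1]) (Q c)^`().[t].
  have -> : std_content n * \int[lebesgue_measure]_(t in `[t0, t1]) (Q c)^`().[t] =
     \int[lebesgue_measure]_(t in `[t0, t1]) (std_content n *: Q c)^`().[t].
    by rewrite !integral_deriv_poly// !hornerZ mulrBr.
  apply: eq_Rintegral => t; rewrite inE /= in_itv /= => tt.
  have /rowP/(_ c) := unit_normal_area j tt; rewrite !mxE => e.
  by rewrite derivZ hornerZ QP mxE -e mulrC.
by field; rewrite a0 dt_neq0.
Qed.

(** The hypothesis says that [H], a primitive of the sum of all [w . b], has equal values at both
    times. Once the facet terms cancel, [H] and [volume_poly] have proportional derivatives, so the
    same holds for the volume. *)
Lemma interp_volume :
  \sum_j area (with_conn conn q0) j *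
    \sum_i dotv (averaged_element_normal j) (q1 (conn j i) - q0 (conn j i)) = 0 ->
  volume (D t1) = volume (D t0).
Proof.
move=> E0.
have [Q QP] := choice (fun ji : 'I_J * 'I_n.+2 =>
  averaged_normal_area ji.1 (b (conn ji.1 ji.2))).
pose H : {poly R} := \sum_j \sum_i Q (j, i).
have tt0 : t0 <= t0 <= t1 by rewrite lexx ltW.
have tt1 : t0 <= t1 <= t1 by rewrite lexx ltW.
have H0 : H.[t1] - H.[t0] = 0.
  apply: (mulfI (lt0r_neq0 (@std_content_gt0 R n))); rewrite mulr0.
  have -> : std_content n * (H.[t1] - H.[t0]) = (t1 - t0) *
      \sum_j area (with_conn conn q0) j *
      \sum_i dotv (averaged_element_normal j) (q1 (conn j i) - q0 (conn j i)).
    rewrite !horner_sum -sumrB !mulr_sumr; apply: eq_bigr => j _.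
    rewrite !horner_sum -sumrB !mulr_sumr; apply: eq_bigr => i _.
    by have [_ <-] := QP (j, i); rewrite mulrA.
  by rewrite E0 mulr0.
(* The geometry enters at time [t0] only; the positions at time [t] are merely the argument [Y] of
   [facet_cycle]. Hence the identity holds for every real [t], as needed for equality of
   polynomials. *)
have cyc t : \sum_j \sum_i \sum_(k | k != i) rows_det (replace (p t j) i (b (conn j k))) = 0.
  have pD0 : closed_polyhedral_hypersurface (with_conn conn q0) (D t0).
    by rewrite -interp_surface0; exact: pD.
  exact: (facet_cycle q0_inj pD0 (interp_vertices t0 t1 q0 q1 t) b).
have HV : H^`() = ((-1) ^+ n.+1 * (t1 - t0)) *: volume_poly^`().
  apply: poly_ext => t; rewrite hornerZ -mulrA volume_poly_deriv.
  transitivity ((-1) ^+ n.+1 * (\sum_j \sum_l rows_det (replace (p t j) l (b (conn j l))) +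
      \sum_j \sum_i \sum_(k | k != i) rows_det (replace (p t j) i (b (conn j k))))).
    2: by rewrite cyc addr0.
  rewrite -big_split /=.
  rewrite raddf_sum /= horner_sum mulr_sumr; apply: eq_bigr => j _.
  rewrite -big_split /= raddf_sum /= horner_sum.
  rewrite [in RHS](eq_bigr
    (fun i => \sum_k rows_det (replace (p t j) i (b (conn j k))))); last first.
    by move=> i _; rewrite [RHS](bigD1 i).
  rewrite [in RHS]exchange_big /= mulr_sumr; apply: eq_bigr => k _.
  have [-> _] := QP (j, k); rewrite sum_rows_det mulrA -exprD -signr_odd oddD addbb.
  by rewrite mul1r.
have : (H - ((-1) ^+ n.+1 * (t1 - t0)) *: volume_poly).[t1] =
    (H - ((-1) ^+ n.+1 * (t1 - t0)) *: volume_poly).[t0].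
  by apply: deriv0_poly_const; rewrite derivB derivZ HV subrr.
rewrite !hornerD !hornerN !hornerZ => e.
have {}e : ((-1) ^+ n.+1 * (t1 - t0)) * volume_poly.[t1] =
    ((-1) ^+ n.+1 * (t1 - t0)) * volume_poly.[t0] by lra.
have VV : volume_poly.[t1] = volume_poly.[t0].
  by apply: mulfI e; rewrite mulf_neq0// signr_eq0.
by rewrite (volume_interior (pD tt1)) (volume_interior (pD tt0)) -!volume_polyE VV.
Qed.

End InterpolatedVolume.

Section SurfaceForms.
Context {R : realType} {n J : nat}.
Notation V := 'rV[R]_n.+2.
Variable p : 'I_J -> 'I_n.+2 -> V.
Hypothesis p_cx : simplicial_complex p.

Let p_nd j : Defs.nondegenerate (p j). Proof. by case: p_cx. Qed.

Let p_disj i j : i != j -> simplex (p i) `&` simplex (p j) = set0.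
Proof. by case: p_cx => _ + _; exact. Qed.

Lemma simplex_indic i j x : simplex (p j) x -> \1_(simplex (p i)) x = (i == j)%:R :> R.
Proof.
move=> sx; rewrite indicE; have [->|ij] := eqVneq i j; first by rewrite mem_set.
rewrite memNset// => six; have : (simplex (p i) `&` simplex (p j)) x by [].
by rewrite p_disj.
Qed.

Lemma pw_constE (c : 'I_J -> V) j x : simplex (p j) x -> pw_const p c x = c j.
Proof.
move=> sx; rewrite /pw_const (bigD1 j)//= (simplex_indic _ sx) eqxx scale1r big1 ?addr0//.
by move=> i /negbTE ij; rewrite (simplex_indic _ sx) ij scale0r.
Qed.

Lemma cst_surf_fe (c : R) : surf_fe p (fun=> c).
Proof.
have := affine_surf_fe p 0 c; rewrite (_ : (fun x => _) = fun=> c)//.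
by apply/funext => x; rewrite dot0v add0r.
Qed.

Lemma displacement_surf_fev (X : V -> V) : surf_fev p X -> surf_fev p (fun x => X x - x).
Proof.
move=> fX i; have -> : (fun x : V => (X x - x) 0 i) = fun x => X x 0 i - x 0 i.
  by apply/funext => x; rewrite !mxE.
apply: surf_feB; first exact: fX.
have := affine_surf_fe p (delta_mx 0 i) 0.
rewrite (_ : (fun x => _) = fun x : V => x 0 i)//; apply/funext => x.
rewrite addr0 /dotv (bigD1 i)//= mxE !eqxx mul1r big1 ?addr0// => l /negbTE li.
by rewrite mxE li andbF mul0r.
Qed.

(** The vertex rule integrates affine functions exactly on a simplex, so both choices of [h] give
    the same value against the constant 1. *)
Lemma surf_ip_opt1 h (f : V -> R) : surf_fe p f ->
  surf_ip_opt p h f (fun=> 1) = n.+2%:R^-1 * \sum_j area p j * \sum_i f (p j i).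
Proof.
move=> ff; case: h; rewrite /surf_ip_opt.
  rewrite lumped_ipE//; last exact: cst_surf_fe.
  by under eq_bigr do under eq_bigr do rewrite mulr1.
apply: surf_integralE => // j x sx; rewrite mulr1.
by apply: surf_fe_bary => //; exact: subset_closure.
Qed.

Lemma surf_ip_optC h (f g : V -> R) : surf_ip_opt p h f g = surf_ip_opt p h g f.
Proof.
by case: h; rewrite /surf_ip_opt; [congr lumped_integral|congr surf_integral];
  apply/funext => x; rewrite mulrC.
Qed.

Lemma surf_ipv_pw_const (c : 'I_J -> V) (phi : V -> V) : surf_fev p phi ->
  surf_ipv p (pw_const p c) phi =
  n.+2%:R^-1 * \sum_j area p j * \sum_i dotv (c j) (phi (p j i)).
Proof.
move=> fp; apply: surf_integralE => // j x sx.
rewrite (pw_constE _ sx) /dotv; under [RHS]eq_bigr do rewrite mulr_suml.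
rewrite exchange_big /=; apply: eq_bigr => l _.
rewrite (surf_fe_bary p_nd (fp l) (subset_closure sx)) mulr_sumr.
by apply: eq_bigr => i _; rewrite mulrA.
Qed.

End SurfaceForms.

Lemma dirichlet_cst (R : realType) (n : nat) (Omega : set 'rV[R]_n.+1) (u : 'rV[R]_n.+1 -> R) c :
  dirichlet Omega u (fun=> c) = 0.
Proof.
rewrite /dirichlet (_ : (fun x => _) = fun=> 0); first by rewrite /Rintegral integral0.
by apply/funext => x; apply: big1 => i _; rewrite derive_cst mulr0.
Qed.

Section VolumePreservation.
Context {R : realType} {n K J N : nat}.
Notation V := 'rV[R]_n.+2.
Variables (conn : 'I_J -> 'I_n.+2 -> 'I_K) (t0 t1 : R) (q : 'I_K -> V).
Variables (Omega : set V) (o : 'I_N -> 'I_n.+3 -> V) (h : bool).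
Variables (U : V -> R) (X omega : V -> V) (D : R -> set V).

Let dt := t1 - t0.
Let q1 k := X (q k).
Let Gam := with_conn conn q.

Hypothesis t01 : t0 < t1.
Hypothesis q_inj : injective q.
Hypothesis X_fe : surf_fev Gam X.
Hypothesis pD : forall s, t0 <= s <= t1 ->
  closed_polyhedral_hypersurface (interp_surface conn t0 t1 q q1 s) (D s).
Hypothesis omegaP : averaged_vertex_normal conn t0 t1 q q1 omega.
Hypothesis eq1 : forall phi, bulk_fe Omega o phi ->
  dirichlet Omega U phi - surf_ip_opt Gam h
    (nodal_interp Gam (fun x => dotv (dt^-1 *: (X x - x)) (omega x))) phi = 0.

Lemma initial_complex : simplicial_complex Gam.
Proof.
by rewrite /Gam -(interp_surface0 conn q q1 t01); case: (pD (s := t0)); rewrite ?lexx ?ltW.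
Qed.

(** The test field [X - id] in the definition of [omega] exchanges the vertex normals for the
    averaged element normals, the form in which [interp_volume] expects the balance. *)
Lemma volume_preserved : volume (D t1) = volume (D t0).
Proof.
have cx := initial_complex.
have nd j : Defs.nondegenerate (Gam j) by case: cx.
apply: (interp_volume t01 q_inj pD); rewrite -/Gam.
have bulk1 : bulk_fe Omega o (fun=> 1).
  split; first by apply: continuous_subspaceT; exact: cst_continuous.
  by move=> i; exists 0, 1 => x _; rewrite dot0v add0r.
have [ife inod] := nodal_interpP cx (fun x => dotv (dt^-1 *: (X x - x)) (omega x)).
have := eq1 bulk1; rewrite dirichlet_cst sub0r surf_ip_opt1// => /eqP.
rewrite oppr_eq0 mulf_eq0 invr_eq0 pnatr_eq0 /= => /eqP I0.
have [om_fe om_eq] := omegaP.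
have fX := displacement_surf_fev X_fe.
have := om_eq _ fX; rewrite lumped_ipvE// -/Gam.
have -> : averaged_normal conn t0 t1 q q1 =
  pw_const Gam (averaged_element_normal conn t0 t1 q q1) by [].
have n0 : (n.+2%:R^-1 : R) != 0 by rewrite invr_eq0 pnatr_eq0.
rewrite surf_ipv_pw_const// => /(mulfI n0) <-.
apply: (mulfI (_ : dt^-1 != 0)); first by rewrite invr_eq0 subr_eq0 gt_eqF.
rewrite mulr0 -[RHS]I0 mulr_sumr; apply: eq_bigr => j _.
rewrite mulrCA; congr (_ * _); rewrite mulr_sumr; apply: eq_bigr => i _.
by rewrite inod dotvZl dotvC.
Qed.

End VolumePreservation.

(** * Stability *)

(** Young's inequality with exponents [r / (r - 1)] and [r]. For [r = 1] the first exponent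
    degenerates and both sides equal [b]. *)
Lemma young (R : realType) (r a b : R) : 1 <= r -> 0 <= a -> 0 <= b ->
  a `^ (r - 1) * b <= (1 - r^-1) * a `^ r + r^-1 * b `^ r.
Proof.
move=> r1 a0 b0; have r0 : 0 < r by apply: lt_le_trans r1.
have [->|rn1] := eqVneq r 1.
  by rewrite subrr powRr0 invr1 subrr mul0r add0r !mul1r powRr1.
have rp : 0 < r - 1 by rewrite subr_gt0 lt_def rn1.
have q0 : 0 < r / (r - 1) by rewrite divr_gt0.
have := @conjugate_powR R (a `^ (r - 1)) b (r / (r - 1)) r (powR_ge0 _ _) b0 q0 r0.
have -> : (r / (r - 1))^-1 = 1 - r^-1 by field; rewrite !gt_eqF.
rewrite subrK -powRrM => /(_ erefl).
have -> : (r - 1) * (r / (r - 1)) = r by field; rewrite gt_eqF.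
by rewrite [_ * (1 - _)]mulrC [b `^ r / r]mulrC.
Qed.

Lemma young_sum (R : realType) (I : finType) (r gx gy : R) (x y : I -> R) :
  1 <= r -> 0 < gx -> 0 < gy -> (forall l, 0 <= x l) -> (forall l, 0 <= y l) ->
  \sum_l (x l / gx) `^ r = 1 -> \sum_l (y l / gy) `^ r = 1 ->
  gx - gy <= \sum_l (x l / gx) `^ (r - 1) * (x l - y l).
Proof.
move=> r1 gx0 gy0 x0 y0 sx sy; have r_gt0 : 0 < r by apply: lt_le_trans r1.
pose a l := x l / gx; pose b l := y l / gy.
have a0 l : 0 <= a l := divr_ge0 (x0 l) (ltW gx0).
have b0 l : 0 <= b l := divr_ge0 (y0 l) (ltW gy0).
have -> : \sum_l (x l / gx) `^ (r - 1) * (x l - y l) =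
    gx * (\sum_l a l `^ r) - gy * (\sum_l a l `^ (r - 1) * b l).
  rewrite !mulr_sumr -sumrB; apply: eq_bigr => l _.
  rewrite -(mulr_powRB1 (a0 l) r_gt0) -/(a l) mulrBr; congr (_ - _).
    by rewrite mulrA [gx * _]mulrC divfK ?gt_eqF// mulrC.
  by rewrite mulrCA; congr (_ * _); rewrite mulrC divfK ?gt_eqF.
rewrite sx mulr1 lerB// ger_pMr//.
apply: (@le_trans _ _ (\sum_l ((1 - r^-1) * a l `^ r + r^-1 * b l `^ r))).
  by apply: ler_sum => l _; exact: young.
rewrite big_split /= -!mulr_sumr sx sy; lra.
Qed.

Lemma det_mx22 (R : comPzRingType) (P : 'M[R]_2) :
  \det P = P 0 0 * P 1 1 - P 0 1 * P 1 0.
Proof.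
rewrite (expand_det_row _ 0) big_ord_recl big_ord1 /cofactor !det_mx11 !mxE /=.
rewrite (_ : lift _ _ = 1); last exact: val_inj.
rewrite (_ : lift 1 0 = 0); last exact: val_inj.
by rewrite (_ : (0 : nat) + 1 = 1)%N// expr0 expr1; ring.
Qed.

(* AM-GM for the eigenvalues of [P]; it fails for larger sizes. *)
Lemma sqrt_det_le_trace (R : realType) (n : nat) (P : 'M[R]_n) :
  n = 1%N \/ n = 2%N -> P^T = P -> (forall i, 0 <= P i i) ->
  Num.sqrt (\det P) - 1 <= (\tr P - n%:R) / 2.
Proof.
move=> n12 PT P0; have symP i j : P i j = P j i by rewrite -{1}PT mxE.
case: n12 P PT P0 symP => -> P PT P0 symP.
  rewrite det_mx11 /mxtrace big_ord1; have := sqr_sqrtr (P0 0) => e.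
  have := sqr_ge0 (Num.sqrt (P 0 0) - 1); rewrite sqrrB expr1n mulr1 {1}e; lra.
rewrite det_mx22 /mxtrace big_ord_recl big_ord1 (_ : lift _ _ = 1); last exact: val_inj.
rewrite (symP 1 0); have a0 := P0 0; have b0 := P0 1.
have : Num.sqrt (P 0 0 * P 1 1 - P 0 1 * P 0 1) <= (P 0 0 + P 1 1) / 2.
  have t0 : 0 <= (P 0 0 + P 1 1) / 2 by rewrite divr_ge0// addr_ge0.
  rewrite -[leRHS]ger0_norm// -sqrtr_sqr ler_wsqrtr//.
  by have := sqr_ge0 (P 0 0 - P 1 1); have := sqr_ge0 (P 0 1); nra.
lra.
Qed.

Section AnisotropicEnergy.
Context {R : realType} {n L : nat}.
Notation V := 'rV[R]_n.+1.
Variables (r : R) (G : 'I_L -> 'M[R]_n.+1).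
Hypothesis L_gt0 : (0 < L)%N.
Hypothesis r_ge1 : 1 <= r.
Hypothesis G_spd : forall l, spd (G l).

Let r_gt0 : 0 < r. Proof. exact: lt_le_trans r_ge1. Qed.

Lemma gamma_lZ l a v : 0 <= a -> gamma_l G l (a *: v) = a * gamma_l G l v.
Proof.
move=> a0; rewrite /gamma_l bformZ sqrtrM ?sqr_ge0// sqrtr_sqr ger0_norm//.
Qed.

Lemma gamma_l_gt0 l v : v != 0 -> 0 < gamma_l G l v.
Proof. by move=> v0; rewrite sqrtr_gt0; exact: (G_spd l).2. Qed.

Lemma gamma_l_ge0 l v : 0 <= gamma_l G l v.
Proof. exact: sqrtr_ge0. Qed.

Lemma gammaE v : gamma r G v = (\sum_l gamma_l G l v `^ r) `^ r^-1.
Proof.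
congr (_ `^ _); apply: eq_bigr => l _.
by rewrite mulrC powRrM powR12_sqrt// bform_ge0.
Qed.

Lemma gamma_powR v : gamma r G v `^ r = \sum_l gamma_l G l v `^ r.
Proof.
rewrite gammaE -powRrM mulVf ?gt_eqF// powRr1//.
by apply: sumr_ge0 => l _; exact: powR_ge0.
Qed.

Lemma gammaZ a v : 0 <= a -> gamma r G (a *: v) = a * gamma r G v.
Proof.
move=> a0; rewrite !gammaE (eq_bigr (fun l => a `^ r * gamma_l G l v `^ r)); last first.
  by move=> l _; rewrite gamma_lZ// powRM// gamma_l_ge0.
rewrite -mulr_sumr powRM ?powR_ge0//.
  by rewrite -powRrM mulfV ?gt_eqF// powRr1.
by apply: sumr_ge0 => l _; exact: powR_ge0.
Qed.

Lemma gamma_gt0 v : v != 0 -> 0 < gamma r G v.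
Proof.
move=> v0; rewrite gammaE powR_gt0// (bigD1 (Ordinal L_gt0))//= ltr_pwDl//.
  by rewrite powR_gt0// gamma_l_gt0.
by apply: sumr_ge0 => l _; exact: powR_ge0.
Qed.

Lemma sum_ratio_powR v : v != 0 -> \sum_l (gamma_l G l v / gamma r G v) `^ r = 1.
Proof.
move=> v0; have g0 := gamma_gt0 v0.
rewrite (eq_bigr (fun l => gamma_l G l v `^ r * (gamma r G v)^-1 `^ r)); last first.
  by move=> l _; rewrite powRM// ?gamma_l_ge0// invr_ge0 (ltW g0).
rewrite -mulr_suml -gamma_powR -powRM ?invr_ge0 ?(ltW g0)// mulfV ?gt_eqF//.
by rewrite powR1.
Qed.

Lemma gamma_convex v w : v != 0 -> w != 0 ->
  gamma r G w - gamma r G v <=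
  \sum_l (gamma_l G l w / gamma r G w) `^ (r - 1) * (gamma_l G l w - gamma_l G l v).
Proof.
move=> v0 w0; apply: young_sum => //.
- exact: gamma_gt0.
- exact: gamma_gt0.
- by move=> l; exact: gamma_l_ge0.
- by move=> l; exact: gamma_l_ge0.
- exact: sum_ratio_powR.
- exact: sum_ratio_powR.
Qed.

End AnisotropicEnergy.

Section ElementEnergy.
Context {R : realType} {n : nat}.
Notation V := 'rV[R]_n.+1.
Variable G : 'M[R]_n.+1.
Hypothesis G_spd : spd G.
Hypothesis n12 : n = 1%N \/ n = 2%N.

Let H := (\det G `^ n%:R^-1) *: invmx G.

Let n_neq0 : (n%:R : R) != 0. Proof. by case: n12 => ->; rewrite pnatr_eq0. Qed.

Lemma spd_det_gt0 (m : nat) (A : 'M[R]_m) : spd A -> 0 < \det A.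
Proof.
move=> /spd_onb[B uB BAB].
have : \det B * \det A * \det B = 1.
  by have := congr1 determinant BAB; rewrite !det_mulmx det_tr det1.
move=> e; have dB : \det B != 0 by move: uB; rewrite unitmxE unitfE.
have d2 : 0 < \det B ^+ 2 by rewrite lt_def sqr_ge0 sqrf_eq0 dB.
rewrite -(pmulr_rgt0 _ d2); have -> : \det B ^+ 2 * \det A = 1 by rewrite -e; ring.
exact: ltr01.
Qed.

Let H_spd : spd H.
Proof. by apply: spdZ; [rewrite powR_gt0// spd_det_gt0|exact: spd_inv]. Qed.

Lemma bform_sub_ge u v : bform H u u / 2 - bform H v v / 2 <= bform H u (u - v).
Proof.
have := bform_ge0 (u - v) H_spd.
have sym : bform H v u = bform H u v.
  rewrite /bform; have -> : v *m H *m u^T = (u *m H *m v^T)^T.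
    by rewrite !trmx_mul trmxK H_spd.1 mulmxA.
  by rewrite mxE.
have Dl (x y z : V) : bform H (x - y) z = bform H x z - bform H y z.
  by rewrite /bform !mulmxBl !mxE.
have Dr (x y z : V) : bform H z (x - y) = bform H z x - bform H z y.
  by rewrite /bform linearB /= mulmxBr !mxE.
rewrite !Dl !Dr sym; lra.
Qed.

(** The exponent [n^-1] in [Gtilde] is made for this: an [n] by [n] determinant raises the scalar
    factor to the power [n], which restores the [det G] of [bform_wedge]. *)
Let det_gram (E : 'M[R]_(n, n.+1)) : row_free E ->
  \det (E *m H *m E^T) = bform G (wedgev E) (wedgev E).
Proof.
move=> fE; rewrite (bform_wedge G_spd fE) /H -scalemxAr -scalemxAl detZ; congr (_ * _).
rewrite -powR_mulrn ?powR_ge0// -powRrM mulVf// powRr1// ltW//.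
exact: spd_det_gt0.
Qed.

(** [B] expresses the orthonormal frame [tau] in the edges [E], and [P] is the Gram matrix of its
    image under the deformation. By [det_gram], [sqrt (det P)] is the ratio of the energies of [F]
    and [E]; the sum is at least [(tr P - n) / 2], since the rows of [tau] have unit length, and
    [sqrt_det_le_trace] connects the two. *)
Lemma element_energy (E F tau : 'M[R]_(n, n.+1)) : row_free E -> row_free F ->
  (tau <= E)%MS -> tau *m H *m tau^T = 1%:M ->
  Num.sqrt (bform G (wedgev F) (wedgev F)) - Num.sqrt (bform G (wedgev E) (wedgev E)) <=
  (\sum_i bform H (row i (tau *m pinvmx E *m F)) (row i (tau *m pinvmx E *m (F - E)))) *
    Num.sqrt (bform G (wedgev E) (wedgev E)).
Proof.
move=> fE fF tE tH; set B := tau *m pinvmx E.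
have tB : tau = B *m E by rewrite mulmxKpV.
have gE : 0 < bform G (wedgev E) (wedgev E) by apply: G_spd.2; exact: wedge_neq0.
pose P := (B *m F) *m H *m (B *m F)^T.
have Pii i : P i i = bform H (row i (B *m F)) (row i (B *m F)).
  rewrite /bform /P [LHS]mxE [RHS]mxE; apply: eq_bigr => k _.
  by rewrite -row_mul !mxE.
have tii i : bform H (row i tau) (row i tau) = 1.
  transitivity ((tau *m H *m tau^T) i i); last by rewrite tH mxE eqxx.
  by rewrite /bform !mxE; apply: eq_bigr => k _; rewrite -row_mul !mxE.
have lower : (\tr P - n%:R) / 2 <=
    \sum_i bform H (row i (B *m F)) (row i (B *m (F - E))).
  have -> : (\tr P - n%:R) / 2 = \sum_i (P i i / 2 - 2^-1).
    by rewrite sumrB -mulr_suml sumr_const card_ord -[X in _ - X]mulr_natr /mxtrace; lra.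
  apply: ler_sum => i _; rewrite mulmxBr -tB linearB /=.
  have := bform_sub_ge (row i (B *m F)) (row i tau); rewrite tii -Pii; lra.
have detP : \det P * bform G (wedgev E) (wedgev E) = bform G (wedgev F) (wedgev F).
  rewrite -!det_gram// -[RHS]mul1r -(det1 R n) -tH tB /P.
  have grp X : B *m X *m H *m (B *m X)^T = B *m (X *m H *m X^T) *m B^T.
    by rewrite trmx_mul !mulmxA.
  by rewrite !grp !det_mulmx; ring.
have PT : P^T = P by rewrite /P trmx_mul trmxK [(_ *m H)^T]trmx_mul H_spd.1 mulmxA.
have P0 i : 0 <= P i i by rewrite Pii bform_ge0.
have := sqrt_det_le_trace n12 PT P0 => h.
have P_ge0 : 0 <= \det P.
  by rewrite -(pmulr_lge0 _ gE) detP bform_ge0.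
have -> : Num.sqrt (bform G (wedgev F) (wedgev F)) =
    Num.sqrt (\det P) * Num.sqrt (bform G (wedgev E) (wedgev E)).
  by rewrite -detP sqrtrM.
rewrite -[X in _ - X]mul1r -mulrBl ler_wpM2r ?sqrtr_ge0//.
exact: le_trans h lower.
Qed.

Lemma tangent_onbP (J : nat) (p : 'I_J -> 'I_n.+1 -> V) j :
  Defs.nondegenerate (p j) ->
  (tangent_onb p H j <= edges (p j))%MS /\
  tangent_onb p H j *m H *m (tangent_onb p H j)^T = 1%:M.
Proof.
move=> nd; rewrite /tangent_onb.
apply: (xgetPex 0 (P := [set tau | (tau <= edges (p j))%MS /\ tau *m H *m tau^T = 1%:M])).
have [B uB BH] := row_free_onb H_spd nd.
by exists (B *m edges (p j)); split=> //=; exact: submxMl.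
Qed.

End ElementEnergy.

Section Stability.
Context {R : realType} {n : nat}.
Notation V := 'rV[R]_n.+2.

Lemma derive_affine (f : V -> V) x v L :
  (\forall h \near (0 : R), f (h *: v + x) - f x = h *: L) -> 'D_v f x = L.
Proof.
move=> fL; apply: cvg_lim; first exact: norm_hausdorff.
apply: cvg_near_cst; near=> h.
have -> : (f \o shift x) (h *: v) - f x = h *: L by near: h; exact: nbhs_dnbhs.
rewrite scalerA mulVf ?scale1r//; near: h; exact: nbhs_dnbhs_neq.
Unshelve. all: by end_near. Qed.

Lemma bary_sum_edges (q Y : 'I_n.+2 -> V) x :
  \sum_i bary q i x *: Y i = edge_coord q x *m edges Y + Y ord0.
Proof.
rewrite sum_scale_edges ?sum_bary//; congr (_ *m _ + _).
by apply/rowP => k; rewrite mxE bary_lift.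
Qed.

Lemma simplex_shift (q : 'I_n.+2 -> V) x v : Defs.nondegenerate q -> simplex q x ->
  (v <= edges q)%MS -> \forall h \near (0 : R), simplex q (h *: v + x).
Proof.
move=> nd /(simplexP nd)[hx b0] vE.
have hb : \forall h \near (0 : R), forall i, 0 < bary q i (h *: v + x).
  apply: (@filter_forall R _ (fun i h => 0 < bary q i (h *: v + x)) (nbhs (0 : R))) => i.
  have : nbhs (x + (0 : R) *: v) [set y : V | 0 < bary q i y].
    rewrite scale0r addr0; have := lt_nbhsr (b0 i).
    by move=> /(@bary_continuous _ _ _ q i x).
  move=> /nbhs_line; apply: filterS => h /=.
  by rewrite addrC.
near=> h; apply/(simplexP nd); split; last by near: h.
rewrite /affine_hull /= -addrA; apply: addmx_sub => //; exact: scalemx_sub.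
Unshelve. all: by end_near. Qed.

(** The derivative is taken in the ambient space, but along a tangent direction small increments
    stay in the element, so only values of [f] on it enter. *)
Lemma derive_simplex (q Y : 'I_n.+2 -> V) (f : V -> V) x v : Defs.nondegenerate q ->
  (forall y, simplex q y -> f y = \sum_i bary q i y *: Y i) ->
  simplex q x -> (v <= edges q)%MS -> 'D_v f x = v *m pinvmx (edges q) *m edges Y.
Proof.
move=> nd fE sx vE; apply: derive_affine.
near=> h; have sh : simplex q (h *: v + x) by near: h; exact: simplex_shift.
rewrite !fE// !bary_sum_edges opprD addrACA subrr addr0 -mulmxBl /edge_coord -mulmxBl.
rewrite (_ : _ - (x - q ord0) = h *: v); last by rewrite opprB addrA subrK addrK.
by rewrite -!scalemxAl.
Unshelve. all: by end_near. Qed.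

Context {J L : nat}.
Variables (r : R) (G : 'I_L -> 'M[R]_n.+2).
Hypothesis L_gt0 : (0 < L)%N.
Hypothesis r_ge1 : 1 <= r.
Hypothesis G_spd : forall l, spd (G l).

Lemma surf_integral_pw_const (p : 'I_J -> 'I_n.+2 -> V) (f : V -> R) (c : 'I_J -> R) :
  simplicial_complex p -> (forall j x, simplex (p j) x -> f x = c j) ->
  surf_integral p f = \sum_j area p j * c j.
Proof.
move=> [nd dis _] fc; rewrite (surf_integralE (g := fun j _ => c j))//.
  rewrite mulr_sumr; apply: eq_bigr => j _.
  rewrite sumr_const card_ord -[c j *+ _]mulr_natl mulrCA; congr (_ * _).
  by rewrite mulKf// pnatr_eq0.
by move=> j x sx; rewrite (fc j x sx) -mulr_sumr sum_bary mulr1.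
Qed.

Lemma aniso_energyE (p : 'I_J -> 'I_n.+2 -> V) : simplicial_complex p ->
  aniso_energy r G p = std_content n * \sum_j gamma r G (wedgev (edges (p j))).
Proof.
move=> cx; have [nd _ _] := cx.
have gE j x : simplex (p j) x ->
    gamma r G (normal_field p x) = gamma r G (unit_normal p j).
  by move=> sx; rewrite /normal_field (pw_constE cx _ sx).
rewrite /aniso_energy (surf_integral_pw_const cx gE) mulr_sumr; apply: eq_bigr => j _.
have e0 : 0 < enorm (wedgev (edges (p j))) by rewrite enorm_gt0 wedge_neq0// nd.
rewrite (areaE (nd j)) /unit_normal gammaZ ?invr_ge0 ?enorm_ge0//.
by rewrite -mulrA mulVKf// gt_eqF.
Qed.

Lemma aniso_form_ge (p : 'I_J -> 'I_n.+2 -> V) (X : V -> V) :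
  let p1 := fun j i => X (p j i) in
  n = 0%N \/ n = 1%N ->
  simplicial_complex p -> simplicial_complex p1 -> surf_fev p X ->
  aniso_energy r G p1 - aniso_energy r G p <=
  aniso_form r G p p1 X (fun x => X x - x).
Proof.
move=> p1 n12 cx cx1 fX; have [nd _ _] := cx; have [nd1 _ _] := cx1.
have n12' : n.+1 = 1%N \/ n.+1 = 2%N by case: n12 => ->; [left|right].
have XE j x : simplex (p j) x -> X x = \sum_i bary (p j) i x *: p1 j i.
  move=> sx; apply/rowP => c; rewrite (surf_fe_bary nd (fX c) (subset_closure sx)).
  by rewrite summxE; apply: eq_bigr => i _; rewrite mxE mulrC.
have Xs j x : simplex (p j) x -> simplex (p1 j) (X x).
  move=> /[dup] sx /(simplexP (nd j))[_ b0].
  by exists (fun i => bary (p j) i x); split=> //; [exact: sum_bary|exact: XE].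
pose w0 j := wedgev (edges (p j)); pose w1 j := wedgev (edges (p1 j)).
have w0n j : w0 j != 0 by rewrite wedge_neq0// nd.
have w1n j : w1 j != 0 by rewrite wedge_neq0// nd1.
pose tau l j := tangent_onb p (Gtilde G l) j.
have tauP l j : (tau l j <= edges (p j))%MS /\
    tau l j *m Gtilde G l *m (tau l j)^T = 1%:M.
  exact: (tangent_onbP (G_spd l) (nd j)).
pose B l j := tau l j *m pinvmx (edges (p j)).
pose S l j := \sum_i bform (Gtilde G l) (row i (B l j *m edges (p1 j)))
  (row i (B l j *m (edges (p1 j) - edges (p j)))).
pose ratio l j := gamma_l G l (w1 j) / gamma r G (w1 j).
have SE l j : gamma_l G l (w1 j) - gamma_l G l (w0 j) <= S l j * gamma_l G l (w0 j).
  exact: (element_energy (G_spd l) n12' (nd j) (nd1 j) (tauP l j).1 (tauP l j).2).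
have gradE l j x : simplex (p j) x ->
    surf_grad_ip p (Gtilde G l) X (fun y => X y - y) x = S l j.
  move=> sx; rewrite /surf_grad_ip (bigD1 j)//= (simplex_indic cx _ sx) eqxx mul1r.
  rewrite [X in _ + X]big1; last first.
    by move=> i /negbTE ij; rewrite (simplex_indic cx _ sx) ij mul0r.
  rewrite addr0; apply: eq_bigr => i _.
  have ti : (row i (tau l j) <= edges (p j))%MS.
    by apply: submx_trans (tauP l j).1; exact: row_sub.
  rewrite (derive_simplex (nd j) (XE j) sx ti).
  have dE y : simplex (p j) y -> X y - y = \sum_k bary (p j) k y *: (p1 j k - p j k).
    move=> sy; rewrite {1}(XE j y sy).
    have [hy _] := proj1 (simplexP (nd j) y) sy.
    rewrite {2}(affine_hull_bary (nd j) hy) -sumrB; apply: eq_bigr => k _.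
    by rewrite scalerBr.
  rewrite (derive_simplex (nd j) dE sx ti) /B !row_mul; congr bform.
  by congr (_ *m _); apply/matrixP => a b; rewrite !mxE; ring.
have ratioE l j : gamma_l G l (unit_normal p1 j) / gamma r G (unit_normal p1 j) = ratio l j.
  have e1 : 0 < enorm (w1 j) by rewrite enorm_gt0.
  have i1 : 0 <= (enorm (w1 j))^-1 by rewrite invr_ge0 ltW.
  rewrite /unit_normal -/(w1 j) (gamma_lZ _ _ _ i1) (gammaZ r_ge1 G_spd _ i1).
  rewrite /ratio; have := gamma_gt0 r L_gt0 G_spd (w1n j).
  move: (gamma r G (w1 j)) (gamma_l G l (w1 j)) => g gl g0.
  by field; rewrite !gt_eqF.
have integrandE l j x : simplex (p j) x ->
    (gamma_l G l (normal_field p1 (X x)) / gamma r G (normal_field p1 (X x))) `^ (r - 1)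
    * surf_grad_ip p (Gtilde G l) X (fun x => X x - x) x * gamma_l G l (normal_field p x) =
    ratio l j `^ (r - 1) * S l j * gamma_l G l (unit_normal p j).
  move=> sx; rewrite (gradE l j x sx) /normal_field (pw_constE cx _ sx).
  by rewrite (pw_constE cx1 _ (Xs j x sx)) ratioE.
have intE l : surf_integral p (fun x =>
    (gamma_l G l (normal_field p1 (X x)) / gamma r G (normal_field p1 (X x))) `^ (r - 1)
    * surf_grad_ip p (Gtilde G l) X (fun x => X x - x) x * gamma_l G l (normal_field p x)) =
    std_content n * \sum_j ratio l j `^ (r - 1) * (S l j * gamma_l G l (w0 j)).
  rewrite (@surf_integral_pw_const p _ (fun j => ratio l j `^ (r - 1) * S l j *
    gamma_l G l (unit_normal p j)) cx (@integrandE l)) mulr_sumr; apply: eq_bigr => j _.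
  have e0 : 0 < enorm (w0 j) by rewrite enorm_gt0.
  rewrite (areaE (nd j)) /unit_normal gamma_lZ ?invr_ge0 ?enorm_ge0// -/(w0 j).
  by field; rewrite gt_eqF.
rewrite /aniso_form (eq_bigr _ (fun l _ => intE l)) !aniso_energyE// -mulrBr -mulr_sumr.
rewrite ler_wpM2l ?(ltW (std_content_gt0 _))// -sumrB exchange_big /=.
(* The tangent bound is taken at the new normal [w1 j], matching the weight in the form; as the
   weights are nonnegative, [SE] can be applied for each [l] separately. *)
apply: ler_sum => j _; apply: le_trans (gamma_convex L_gt0 r_ge1 G_spd (w0n j) (w1n j)) _.
by apply: ler_sum => l _; rewrite ler_wpM2l ?powR_ge0.
Qed.

End Stability.

Section EnergyEstimate.
Context {R : realType} {n K J N L : nat}.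
Notation V := 'rV[R]_n.+2.
Variables (conn : 'I_J -> 'I_n.+2 -> 'I_K) (t0 t1 : R) (q : 'I_K -> V).
Variables (Omega : set V) (o : 'I_N -> 'I_n.+3 -> V) (h : bool).
Variables (U kappa : V -> R) (X omega : V -> V) (r : R) (G : 'I_L -> 'M[R]_n.+2).

Let dt := t1 - t0.
Let q1 k := X (q k).
Let Gam := with_conn conn q.
Let Gam1 := with_conn conn q1.
Let I := nodal_interp Gam (fun x => dotv (dt^-1 *: (X x - x)) (omega x)).

Hypothesis t01 : t0 < t1.
Hypothesis Gam_cx : simplicial_complex Gam.
Hypothesis U_fe : bulk_fe Omega o U.
Hypothesis X_fe : surf_fev Gam X.
Hypothesis kappa_fe : surf_fe Gam kappa.
Hypothesis omega_fe : surf_fev Gam omega.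
Hypothesis eq1 : forall phi, bulk_fe Omega o phi ->
  dirichlet Omega U phi - surf_ip_opt Gam h I phi = 0.
Hypothesis eq2 : forall chi, surf_fe Gam chi ->
  surf_ip_opt Gam h U chi - lumped_ip Gam kappa chi = 0.
Hypothesis eq3 : forall eta, surf_fev Gam eta ->
  lumped_ipv Gam (fun x => kappa x *: omega x) eta + aniso_form r G Gam Gam1 X eta = 0.

Lemma energy_identity :
  dt * dirichlet Omega U U + aniso_form r G Gam Gam1 X (fun x => X x - x) = 0.
Proof.
have nd j : Defs.nondegenerate (Gam j) by case: Gam_cx.
have [I_fe IE] := nodal_interpP Gam_cx (fun x => dotv (dt^-1 *: (X x - x)) (omega x)).
have fX := displacement_surf_fev X_fe.
(* The interpolant lies in the surface space, so it is admissible in the second equation and [U] can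
   be traded for [kappa]. The resulting product is lumped, hence depends only on the vertex values
   given by [IE]. *)
have /eqP := eq1 U_fe; rewrite subr_eq0 surf_ip_optC => /eqP ->.
have /eqP := eq2 I_fe; rewrite subr_eq0 => /eqP ->.
rewrite -[RHS](eq3 fX); congr (_ + _).
rewrite lumped_ipE// lumped_ipv_scaleE// mulrCA; congr (_ * _).
rewrite mulr_sumr; apply: eq_bigr => j _; rewrite mulrCA; congr (_ * _).
rewrite mulr_sumr; apply: eq_bigr => i _; rewrite IE dotvZl mulrCA; congr (_ * _).
by rewrite mulVKf ?subr_eq0 ?gt_eqF// dotvC.
Qed.

End EnergyEstimate.

Theorem theorem4p1 (R : realType) (n : nat) (d_ge2 : (2 <= n.+1)%N)
  (* domain and time levels *)
  (Omega : set 'rV[R]_n.+1) (hOmega : polyhedral_domain Omega)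
  (M : nat) (T : R) (t : nat -> R) (t_0 : t 0%N = 0) (t_M : t M = T)
  (t_incr : forall i, (i < M)%N -> t i < t i.+1)
  (m : nat) (m_lt : (m < M)%N)
  (* bulk mesh *)
  (N : nat) (o : 'I_N -> 'I_n.+2 -> 'rV[R]_n.+1) (ho : triangulation Omega o)
  (* surface mesh: the vertices q k of Gamma^m and the local numbering *)
  (K J : nat) (q : 'I_K -> 'rV[R]_n.+1) (conn : 'I_J -> 'I_n.+1 -> 'I_K)
  (q_inj : injective q) (conn_surj : forall k, exists j i, conn j i = k)
  (* anisotropy *)
  (L : nat) (L_gt0 : (0 < L)%N) (r : R) (r_ge1 : 1 <= r)
  (G : 'I_L -> 'M[R]_n.+1) (G_spd : forall l, spd (G l))
  (* true integration or mass lumping *)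
  (h : bool)
  (* the discrete solution *)
  (U kappa : 'rV[R]_n.+1 -> R) (X omega : 'rV[R]_n.+1 -> 'rV[R]_n.+1)
  (D : R -> set 'rV[R]_n.+1) :
  let dt := t m.+1 - t m in
  let q1 := fun k => X (q k) in
  let Gam := with_conn conn q in
  let Gam1 := with_conn conn q1 in
  let GamI := interp_surface conn (t m) (t m.+1) q q1 in
  bulk_fe Omega o U -> surf_fev Gam X -> surf_fe Gam kappa ->
  (forall s, t m <= s <= t m.+1 ->
    closed_polyhedral_hypersurface (GamI s) (D s) /\
    surface (GamI s) `<=` Omega) ->
  averaged_vertex_normal conn (t m) (t m.+1) q q1 omega ->
  (forall phi, bulk_fe Omega o phi ->
    dirichlet Omega U phi
    - surf_ip_opt Gam h
        (nodal_interp Gam (fun x => dotv (dt^-1 *: (X x - x)) (omega x))) phi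
    = 0) ->
  (forall chi, surf_fe Gam chi ->
    surf_ip_opt Gam h U chi - lumped_ip Gam kappa chi = 0) ->
  (forall eta, surf_fev Gam eta ->
    lumped_ipv Gam (fun x => kappa x *: omega x) eta
    + aniso_form r G Gam Gam1 X eta = 0) ->
  volume (D (t m.+1)) = volume (D (t m)) /\
  (n.+1 = 2%N \/ n.+1 = 3%N ->
    aniso_energy r G Gam1 + dt * dirichlet Omega U U <= aniso_energy r G Gam).
Proof.
destruct n as [|n']; first by [].
move=> dt q1 Gam Gam1 GamI U_fe X_fe kappa_fe hD omegaP eq1 eq2 eq3.
have t01 : t m < t m.+1 by exact: t_incr.
have pD s : t m <= s <= t m.+1 -> closed_polyhedral_hypersurface (GamI s) (D s).
  by move=> /hD[].
split; first exact: (volume_preserved t01 q_inj X_fe pD omegaP eq1).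
move=> n12; have cx : simplicial_complex Gam := initial_complex t01 pD.
have cx1 : simplicial_complex Gam1.
  rewrite /Gam1 -(interp_surface1 conn q q1 t01).
  by case: (pD (t m.+1)); rewrite // lexx ltW.
have n01 : n' = 0%N \/ n' = 1%N by case: n12 => -[->]; [left|right].
have lin (a b f e : R) : e + f = 0 -> a - b <= f -> a + e <= b by lra.
apply: lin (energy_identity t01 cx U_fe X_fe kappa_fe omegaP.1 eq1 eq2 eq3) _.
exact: (aniso_form_ge L_gt0 r_ge1 G_spd n01 cx cx1 X_fe).
Qed.
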